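(* Let $\{Y_i\}_{i\in\mathbb{Z}}$ be a centered $L^2[0,1]$-valued sequence that is $L^4$-$m$-approximable with rate $\delta(m)=\exp(-cm)$, $c>0$, and not necessarily causal. Assume that the kernel function $K$ satisfies, as $x\to0$, $$|K(x)-1|=O(|x|^\rho)$$ for some $\rho\ge1$. Let the bandwidth be $h_n=\lfloor c'n^{1/\gamma}\rfloor$ with some $\gamma>3$ and $c'>0$. Then under $H_0$, as $n\to\infty$, $$\|\hat\zeta-\zeta\|=O_P\big((h_n/n)^{1/2}h_n+1/h_n^\rho\big).$$
   Context: $\|\cdot\|$ denotes the norm of $L^2([0,1]\times[0,1])$ when applied to kernels, and of $L^2[0,1]$ when applied to functions on $[0,1]$. $L^\kappa$-$m$-approximability (here $\kappa=4$). Let $H=L^2[0,1]$ with norm $\|\cdot\|_H$. An $H$-valued sequence $\{Y_i\}_{i\in\mathbb{Z}}$ on a probability space $(\Omega,\mathcal{A},P)$ is $L^\kappa$-$m$-approximable with rate $\delta(m)\ge0$, $\delta(m)=o(1)$, and $\kappa\ge2$, iff $E\|Y_0\|_H^\kappa<\infty$ and: (1) $Y_i=f(\dots,\varepsilon_{i+1},\varepsilon_i,\varepsilon_{i-1},\dots)$, where the $\varepsilon_i$ are i.i.d. random elements of a measurable space $S$ and $f:S^\infty\to H$ is measurable; (2) as $m\to\infty$, $\big(E\|Y_0-Y_0^{(m)}\|_H^\kappa\big)^{1/\kappa}=O(\delta(m))$, where $$Y_i^{(m)}=f\big(\dots,\varepsilon^{(m,i)}_{i+M},\varepsilon_{i+(M-1)},\dots,\varepsilon_i,\dots,\varepsilon_{i-(M-1)},\varepsilon^{(m,i)}_{i-M},\dots\big),\quad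 M=\max\{\lfloor m/2\rfloor,1\},$$ for all integers $m\ge0$, and the family $\{\varepsilon_r,\varepsilon_i^{(k,j)}:\ i,j,r,k\in\mathbb{Z},\ k\ge0\}$ is i.i.d.; (3) $Y_i(t,\omega)$ is product measurable in $(t,\omega)$. (The sequence is called causal if $Y_i=f(\varepsilon_i,\varepsilon_{i-1},\dots)$.) Model. The observations are $X_i=\mu_i+Y_i$, $i=1,\dots,n$, with deterministic $\mu_i\in L^2[0,1]$; the null hypothesis is $H_0:\ \mu_1=\dots=\mu_n$. Put $\bar X_n=n^{-1}\sum_{i=1}^nX_i$. Long run covariance kernel. $\zeta(t,s)=\sum_{r\in\mathbb{Z}}E[Y_0(t)Y_r(s)]$ (convergence in $L^2([0,1]\times[0,1])$). Estimator. $\hat\zeta(t,s)=\sum_{r=-n}^nK(r/h_n)\hat\zeta_r(t,s)$, where $\hat\zeta_r(t,s)=\frac1n\sum_{i=1}^{n-r}(X_i(t)-\bar X_n(t))(X_{i+r}(s)-\bar X_n(s))$ for $r\ge0$ and $\hat\zeta_r(t,s)=\hat\zeta_{-r}(s,t)$ for $r<0$. The kernel function $K:\mathbb{R}\to\mathbb{R}$ is symmetric, bounded and compactly supported with $K(0)=1$. *)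

(* Defs.v *)
From HB Require Import structures.
From mathcomp Require Import all_boot all_order all_algebra.
From mathcomp Require Import all_classical all_reals all_analysis.

Set Implicit Arguments.
Unset Strict Implicit.
Unset Printing Implicit Defensive.

Import Order.TTheory GRing.Theory Num.Theory.
Import numFieldNormedType.Exports.

Local Open Scope classical_set_scope.
Local Open Scope ring_scope.

(* A function on [0,1] is represented by a function on the whole of R, its
   values outside [0,1] being invisible to the measure leb01. *)
Definition leb01 (R : realType) : set (measurableTypeR R) -> \bar R :=
  mrestr (@lebesgue_measure R) (measurable_itv `[0%R, 1%R]).
Arguments leb01 : clear implicits.

HB.instance Definition _ (R : realType) := Measure.on (leb01 R).

Fact leb01_fin_num (R : realType) : fin_num_fun (leb01 R).
Proof.
move=> A mA; rewrite ge0_fin_numE//.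
apply: (@le_lt_trans _ _ (@lebesgue_measure R `[0%R, 1%R])).
  apply: le_measure; rewrite ?inE//.
  exact: measurableI.
by rewrite lebesgue_measure_itv/= lte_fin ltr01 -EFinB ltry.
Qed.

HB.instance Definition _ (R : realType) :=
  @Measure_isFinite.Build _ _ R (leb01 R) (@leb01_fin_num R).

(* Square integrable functions, before the identification of functions that
   are equal almost everywhere: equality in L^2[0,1] is f = g %[ae leb01 R]. *)
Definition L2 (R : realType) := LfunType (leb01 R) (lee1n 2).

Definition L2kernel (R : realType) :=
  LfunType (leb01 R \x leb01 R)%E (lee1n 2).

Definition norm2 (R : realType) (f : measurableTypeR R -> R) : \bar R :=
  ('N[leb01 R]_2%:E [EFin \o f])%E.

Definition knorm2 (R : realType) (k : measurableTypeR R * measurableTypeR R -> R) :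
    \bar R :=
  ('N[(leb01 R \x leb01 R)%E]_2%:E [EFin \o k])%E.

Definition L2open (R : realType) (U : set (L2 R)) :=
  forall f : L2 R, U f ->
    exists2 e : R, 0 < e & forall g : L2 R, (norm2 (f \- g)%R < e%:E)%E -> U g.

Definition L2borel (R : realType) : set (set (L2 R)) := <<s @L2open R >>.

(* The product sigma-algebra on the two-sided sequences in S. *)
Definition seq_cylinder d (S : measurableType d) : set (set (int -> S)) :=
  [set B | exists k (A : set S),
     measurable A /\ B = [set x : int -> S | A (x k)]].

Definition seq_measurable d (S : measurableType d) : set (set (int -> S)) :=
  <<s @seq_cylinder d S >>.

Section Probability.
Context d (Omega : measurableType d) (R : realType) (P : probability Omega R).

Definition mutually_independent (I : eqType) d' (S : measurableType d')
    (X : I -> {RV P >-> S}) :=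
  forall (J : seq I) (A : I -> set S), uniq J -> (forall i, measurable (A i)) ->
  P (\big[setI/setT]_(i <- J) (X i @^-1` A i)) =
  (\prod_(i <- J) P (X i @^-1` A i))%E.

Definition identically_distributed (I : eqType) d' (S : measurableType d')
    (X : I -> {RV P >-> S}) :=
  forall i j (A : set S), measurable A ->
  distribution P (X i) A = distribution P (X j) A.

Definition iid (I : eqType) d' (S : measurableType d')
    (X : I -> {RV P >-> S}) :=
  mutually_independent X /\ identically_distributed X.

(* The sequence (..., eps_(i+1), eps_i, eps_(i-1), ...), read from left to
   right; its position k holds eps_(i-k). *)
Definition shifted d' (S : measurableType d') (eps : int -> {RV P >-> S})
    (i : int) (w : Omega) : int -> S :=
  fun k => eps (i - k) w.

(* eps' m i j stands for eps_j^(m,i). *)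
Definition coupled d' (S : measurableType d') (eps : int -> {RV P >-> S})
    (eps' : nat -> int -> int -> {RV P >-> S}) (m : nat) (i : int) (w : Omega) :
    int -> S :=
  fun k => if (`|k| < maxn m./2 1)%N then eps (i - k) w
           else eps' m i (i - k) w.

Definition all_innovations d' (S : measurableType d')
    (eps : int -> {RV P >-> S}) (eps' : nat -> int -> int -> {RV P >-> S})
    (a : int + nat * int * int) : {RV P >-> S} :=
  match a with
  | inl r => eps r
  | inr (k, j, i) => eps' k j i
  end.

Definition Lm_approximable (kappa : R) (delta : nat -> R)
    (Y : int -> Omega -> L2 R) :=
  [/\ 2 <= kappa,
      (forall m, 0 <= delta m) /\ delta @ \oo --> (0 : R),
      (\int[P]_w (norm2 (Y 0%R w) `^ kappa) < +oo)%E,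
      (exists d' (S : measurableType d') (eps : int -> {RV P >-> S})
              (eps' : nat -> int -> int -> {RV P >-> S})
              (f : (int -> S) -> L2 R),
         [/\ iid (all_innovations eps eps'),
             forall B, L2borel B -> seq_measurable (f @^-1` B),
             forall i, {ae P, forall w,
               (Y i w : R -> R) = f (shifted eps i w) %[ae leb01 R]} &
             exists C : R, \forall m \near \oo,
               ((\int[P]_w (norm2 (Y 0%R w \- f (coupled eps eps' m 0%R w))%R
                              `^ kappa)) `^ kappa^-1 <= (C * delta m)%:E)%E]) &
      forall i, measurable_fun [set: measurableTypeR R * Omega]
                  (fun p => Y i p.2 p.1)].

Definition centered (Y : int -> Omega -> L2 R) :=
  forall i, {ae leb01 R, forall t, ('E_P[fun w => Y i w t] = 0)%E}.

Definition sym_range (n : nat) : seq int :=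
  [seq k%:Z - n%:Z | k <- iota 0 (2 * n).+1].

Definition long_run_partial (Y : int -> Omega -> L2 R) (N : nat) (p : R * R) :
    R :=
  \sum_(r <- sym_range N) fine 'E_P[fun w => (Y 0 w p.1 * Y r w p.2)%R]%E.

(* As for the library's lim, the value is only meaningful when the series
   converges in L^2([0,1]^2); it is then unique up to a.e. equality. *)
Definition long_run_cov (Y : int -> Omega -> L2 R) : L2kernel R :=
  xget 0 [set z : L2kernel R |
    (knorm2 (long_run_partial Y N \- z)%R @[N --> \oo] --> 0)%E].

Definition bigO_in_probability (Z : nat -> Omega -> \bar R) (a : nat -> R) :=
  forall e : R, 0 < e -> exists C : R, \forall n \near \oo,
    (P [set w | (C * a n)%:E < `|Z n w|] <= e%:E)%E.

End Probability.

Section Estimator.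
Context d (Omega : measurableType d) (R : realType).

Definition observation (mu : nat -> L2 R) (Y : int -> Omega -> L2 R)
    (i : nat) (w : Omega) (t : R) : R :=
  mu i t + Y i%:Z w t.

Definition null_hypothesis (mu : nat -> L2 R) (n : nat) :=
  forall i j, (1 <= i <= n)%N -> (1 <= j <= n)%N ->
    (mu i : R -> R) = mu j %[ae leb01 R].

Variable X : nat -> Omega -> R -> R.

Definition sample_mean (n : nat) (w : Omega) (t : R) : R :=
  n%:R^-1 * \sum_(1 <= i < n.+1) X i w t.

Definition sample_autocov_nat (n r : nat) (w : Omega) (t s : R) : R :=
  n%:R^-1 * \sum_(1 <= i < (n - r).+1)
    (X i w t - sample_mean n w t) * (X (i + r) w s - sample_mean n w s).

Definition sample_autocov (n : nat) (r : int) (w : Omega) (t s : R) : R :=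
  match r with
  | Posz r => sample_autocov_nat n r w t s
  | Negz r => sample_autocov_nat n r.+1 w s t
  end.

Definition long_run_estimator (K : R -> R) (h : R) (n : nat) (w : Omega)
    (p : R * R) : R :=
  \sum_(r <- sym_range n) K (r%:~R / h) * sample_autocov n r w p.1 p.2.

End Estimator.

Definition lag_kernel (R : realType) (K : R -> R) :=
  [/\ forall x, K (- x) = K x,
      exists M : R, forall x, `|K x| <= M,
      compact (closure [set x | K x != 0]) &
      K 0 = 1].

Definition bandwidth (R : realType) (c' gamma : R) (n : nat) : R :=
  (Num.floor (c' * n%:R `^ gamma^-1))%:~R.

(* Main.v *)
Require Import Defs.
From HB Require Import structures.
From mathcomp Require Import all_boot all_order all_algebra.
From mathcomp Require Import all_classical all_reals all_analysis.
From mathcomp Require Import measurable_realfun.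
From mathcomp Require Import ring lra zify.

(** All errors are bounded in mean square, and norms are kept squared: the triangle
    inequality then only costs factors 2, and a single application of Markov's
    inequality concludes.

    The coupled variable Y_i^(m) is within O(exp(-cm)) of Y_i in L^4, and coupled
    variables whose indices are at least m apart are functions of disjoint groups
    of innovations, hence uncorrelated, and so are their products
    ([uncorrelated_disjoint]). Replacing the Y_i by coupled versions, with m of the
    order of the gap between the indices, bounds covariances ([cov_approx]). This
    gives the geometric decay of the autocovariance kernels zeta_r ([zeta_norm2]),
    so that their series converges in L^2 with geometrically small tails
    ([series_limit]), and it shows that a sum of n products at lag r has a variance
    of order (1 + |r|) n ([field_var_sum], [autocov_var]). To speak of covariances
    at given arguments, the function f that defines Y is replaced by a jointly
    measurable version ([L2_version]).

    Write h for the bandwidth, and let K vanish outside [-A, A]. Under the null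
    hypothesis the means cancel, and the error of the estimator splits into four
    parts ([autocov_decomposition], [estimator_error]).
    - The centring at the sample mean contributes products of two sums divided by n,
      and such sums have mean squared norm O(1/n). Over the O(h) lags in the window
      this adds up to a squared norm O(h^3 / n^2) in probability.
    - The centred products at a lag in the window have mean squared norm O(h/n);
      Cauchy-Schwarz over the O(h) lags gives O(h^3 / n).
    - The weight of zeta_r differs from 1 by O((|r|/h)^rho + |r|/n). As the zeta_r
      decay geometrically, the squared norm is O(h^(-2 rho) + n^(-2))
      ([bias_norm2]).
    - The tail of the series of the zeta_r beyond lag n is geometrically small.
    Since h is at least 1 for large n, all four are of the order of
    h^3 / n + h^(-2 rho), which is at most the square of the claimed rate. *)

Set Implicit Arguments.
Unset Strict Implicit.
Unset Printing Implicit Defensive.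

Import Order.TTheory GRing.Theory Num.Theory.
Import numFieldNormedType.Exports.

Local Open Scope classical_set_scope.
Local Open Scope ring_scope.

(** * Laws of families of random elements *)

Lemma big_setI_seq (T : Type) (J : eqType) (s : seq J) (F : J -> set T) :
  \big[setI/setT]_(i <- s) F i = [set x | forall i, i \in s -> F i x].
Proof.
elim: s => [|j s IHs]; first by rewrite big_nil; apply/seteqP; split.
rewrite big_cons IHs; apply/seteqP; split => x /=.
  by move=> [Fj Fs] i; rewrite inE => /predU1P[->//|]; exact: Fs.
by move=> Fx; split=> [|i si]; apply: Fx; rewrite inE ?eqxx ?si ?orbT.
Qed.

Section families.
Context d (S : measurableType d).

Definition coordinate_sets (J : Type) : set (set (J -> S)) :=
  [set B | exists k (A : set S),
     measurable A /\ B = [set x : J -> S | A (x k)]].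

(** The product sigma-algebra on the families indexed by [J]; for [J := int] it
    is the sigma-algebra [seq_measurable]. *)
Definition family (J : Type) := g_sigma_algebraType (@coordinate_sets J).

Definition box (J : eqType) (s : seq J) (A : J -> set S) : set (family J) :=
  [set x | forall i, i \in s -> A i (x i)].

Definition boxes (J : eqType) : set (set (family J)) :=
  [set B | exists s (A : J -> set S),
     (forall i, measurable (A i)) /\ B = box s A].

Lemma measurable_coord (J : Type) (k : J) :
  measurable_fun [set: family J] (fun x : family J => (x : J -> S) k).
Proof.
move=> _ A mA; rewrite setTI; apply: sub_sigma_algebra.
by exists k, A.
Qed.

Lemma measurable_to_family d' (T : measurableType d') (J : Type)
    (F : T -> family J) :
  (forall k, measurable_fun [set: T] (fun x => (F x : J -> S) k)) ->
  measurable_fun [set: T] F.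
Proof.
move=> mF; apply: (@measurability _ _ T (family J) setT F (@coordinate_sets J)) => //.
by move=> _ [_ [k [A [mA ->]]] <-]; exact: mF.
Qed.

Lemma measurable_box (J : eqType) s (A : J -> set S) :
  (forall i, measurable (A i)) -> measurable (box s A).
Proof.
move=> mA; rewrite (_ : box s A =
    \big[setI/setT]_(i <- s) [set x : family J | A i (x i)]).
  apply: bigsetI_measurable => i _; rewrite -[X in measurable X]setTI.
  exact: measurable_coord.
by rewrite big_setI_seq.
Qed.

Lemma boxes_setI (J : eqType) : setI_closed (@boxes J).
Proof.
move=> _ _ [s [A [mA ->]]] [s' [A' [mA' ->]]].
exists (s ++ s'), (fun i => (if i \in s then A i else setT) `&`
                    (if i \in s' then A' i else setT)); split.
  by move=> i; apply: measurableI; case: ifP.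
apply/seteqP; split => x /=.
  by move=> [xA xA'] i _; split; case: ifP => // si; [exact: xA|exact: xA'].
move=> xss; split => i si; have := xss i; rewrite mem_cat si ?orbT => /(_ isT)[].
  by [].
by [].
Qed.

Lemma family_measurableE (J : eqType) :
  (measurable : set (set (family J))) = <<s @boxes J >>.
Proof.
apply/seteqP; split.
  apply: smallest_sub; first exact: smallest_sigma_algebra.
  move=> _ [k [A [mA ->]]]; apply: sub_sigma_algebra.
  exists [:: k], (fun=> A); split => //; apply/seteqP; split=> x /=.
    by move=> Ax i; rewrite inE => /eqP ->.
  by apply; rewrite inE.
apply: smallest_sub; first exact: smallest_sigma_algebra.
by move=> _ [s [A [mA ->]]]; exact: measurable_box.
Qed.

(** A finite measure on families is determined by its finite-dimensional
    marginals: boxes are stable under intersection and generate. *)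
Lemma family_law_unique (R : realType) (J : eqType)
    (m1 m2 : {measure set (family J) -> \bar R}) :
  (m1 setT < +oo)%E ->
  (forall (s : seq J) (A : J -> set S), uniq s -> (forall i, measurable (A i)) ->
    m1 (box s A) = m2 (box s A)) ->
  forall B, measurable B -> m1 B = m2 B.
Proof.
move=> m1oo m12 B mB.
have boxT : @boxes J setT.
  by exists [::], (fun=> setT); split=> //; apply/seteqP; split.
apply: (@measure_unique _ R (family J) (@boxes J) (fun=> setT)) => //.
- exact: family_measurableE.
- exact: boxes_setI.
- by rewrite bigcup_const.
- move=> _ [s [A [mA ->]]].
  have -> : box s A = box (undup s) A.
    by apply/seteqP; split=> x /= xs i; have := xs i; rewrite mem_undup.
  by apply: m12; rewrite ?undup_uniq.
Qed.

End families.

Section same_law.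
Context d (S : measurableType d) (R : realType) (I : eqType).
Context d1 (T1 : measurableType d1) (P1 : probability T1 R).
Context d2 (T2 : measurableType d2) (P2 : probability T2 R).

Lemma same_law_integral (F1 : T1 -> family S I) (F2 : T2 -> family S I)
    (g : family S I -> \bar R) :
  measurable_fun [set: T1] F1 -> measurable_fun [set: T2] F2 ->
  measurable_fun [set: family S I] g ->
  (forall (s : seq I) (A : I -> set S), uniq s -> (forall i, measurable (A i)) ->
    P1 (F1 @^-1` box s A) = P2 (F2 @^-1` box s A)) ->
  (\int[P1]_w g (F1 w) = \int[P2]_w g (F2 w))%E.
Proof.
move=> mF1 mF2 mg law.
pose X1 : {mfun T1 >-> family S I} := HB.pack F1 (isMeasurableFun.Build _ _ _ _ _ mF1).
pose X2 : {mfun T2 >-> family S I} := HB.pack F2 (isMeasurableFun.Build _ _ _ _ _ mF2).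
have ge0 (f : family S I -> \bar R) : measurable_fun [set: family S I] f ->
    (forall x, 0 <= f x)%E -> (\int[P1]_w f (F1 w) = \int[P2]_w f (F2 w))%E.
  move=> mf f0; rewrite -[LHS](@ge0_integral_distribution _ _ _ _ _ P1 X1 f)//.
  rewrite -[RHS](@ge0_integral_distribution _ _ _ _ _ P2 X2 f)//.
  apply: eq_measure_integral => B mB _.
  apply: (@family_law_unique _ S R I (distribution P1 X1) (distribution P2 X2)) => //.
  apply: (@le_lt_trans _ _ 1%E); last by rewrite ltry.
  exact: (@probability_le1 _ _ _ (distribution P1 X1)).
rewrite -[LHS]/(\int[P1]_w (g \o F1) w)%E -[RHS]/(\int[P2]_w (g \o F2) w)%E.
rewrite [LHS]integralE [RHS]integralE (funepos_comp g F1)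
  (funepos_comp g F2) (funeneg_comp g F1) (funeneg_comp g F2); congr (_ - _)%E.
  by apply: (ge0 (g^\+)%E) => //; exact: measurable_funepos.
by apply: (ge0 (g^\-)%E) => //; exact: measurable_funeneg.
Qed.

End same_law.

Section iid_family.
Context d (Omega : measurableType d) (R : realType) (P : probability Omega R).
Context d' (S : measurableType d') (I : eqType) (X : I -> {RV P >-> S}).
Hypothesis X_iid : iid X.

Definition sample (w : Omega) : family S I := fun i => X i w.

Lemma measurable_sample : measurable_fun [set: Omega] sample.
Proof. by apply: measurable_to_family => k; exact: measurable_funPT. Qed.

Lemma measurable_reindex (J : Type) (tau : J -> I) :
  measurable_fun [set: family S I]
    (fun x : family S I => ((x : I -> S) \o tau : family S J)).
Proof. by apply: measurable_to_family => k; exact: measurable_coord. Qed.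

Let sample_box s (A : I -> set S) : uniq s -> (forall i, measurable (A i)) ->
  P (sample @^-1` box s A) = (\prod_(i <- s) P (X i @^-1` A i))%E.
Proof.
move=> us mA; case: X_iid => ind _; rewrite -ind//; congr (P _).
by rewrite big_setI_seq.
Qed.

(** Stationarity: the coordinates being exchangeable, any injective renaming of
    the innovations leaves their joint law unchanged. *)
Lemma integral_reindex (tau : I -> I) (g : family S I -> \bar R) :
  injective tau -> measurable_fun [set: family S I] g ->
  (\int[P]_w g (sample w \o tau) = \int[P]_w g (sample w))%E.
Proof.
move=> itau mg.
apply: (@same_law_integral _ S R I _ Omega P _ Omega P
  (fun w => sample w \o tau : family S I) sample) => //.
- apply: (measurableT_comp (@measurable_reindex I tau)); exact: measurable_sample.
- exact: measurable_sample.
move=> s A us mA; rewrite sample_box//.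
(* the box pulled back along the injection [tau] *)
pose B j := if pselect (exists2 i, i \in s & tau i = j) is left e
  then A (s2val (cid2 e)) else setT.
have Btau i : i \in s -> B (tau i) = A i.
  rewrite /B => si; case: pselect => [e|[]]; last by exists i.
  by case: cid2 => j /= _ /itau ->.
have mB j : measurable (B j) by rewrite /B; case: pselect.
transitivity (P (sample @^-1` box [seq tau i | i <- s] B)).
  congr (P _); apply/seteqP; split => w /= ws i.
    by move=> /mapP[j js ->]; rewrite Btau//; exact: ws.
  by move=> si; have := ws (tau i); rewrite Btau//; apply; exact: map_f.
rewrite sample_box ?map_inj_uniq// big_map; apply: eq_big_seq => i si.
rewrite Btau//; case: X_iid => _ idd.
exact: (idd (tau i) i (A i) (mA i)).
Qed.

Definition depends_only_on (T : Type) (J : pred I) (u : family S I -> T) :=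
  forall x y : family S I, (forall i, J i -> (x : I -> S) i = y i) -> u x = u y.

(** Functions of disjoint groups of innovations are uncorrelated: sampling the
    coordinates in [J] and those outside [J] from two independent copies of the
    probability space does not change the law of the family, and on the product
    space the two functions depend on different variables. *)
Lemma uncorrelated_disjoint (J : pred I) (u v : family S I -> R) :
  measurable_fun [set: family S I] u -> measurable_fun [set: family S I] v ->
  depends_only_on J u -> depends_only_on (predC J) v ->
  P.-integrable setT (EFin \o u \o sample) ->
  P.-integrable setT (EFin \o v \o sample) ->
  (\int[P]_w (u (sample w) * v (sample w))%:E =
   \int[P]_w (u (sample w))%:E * \int[P]_w (v (sample w))%:E)%E.
Proof.
move=> mu mv uJ vJ iu iv.
pose mix (z : Omega * Omega) : family S I :=
  fun i => if J i then X i z.1 else X i z.2.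
have mX i : measurable_fun setT (X i) by exact: measurable_funPT.
have mmix : measurable_fun [set: Omega * Omega] mix.
  apply: measurable_to_family => i /=; rewrite /mix; case: (J i).
    exact: (measurableT_comp (mX i)).
  exact: (measurableT_comp (mX i)).
have muv : measurable_fun [set: family S I] (fun x => (u x * v x)%:E).
  by apply/measurable_EFinP; exact: measurable_funM.
have -> : (\int[P]_w (u (sample w) * v (sample w))%:E =
           \int[P \x P]_z (u (mix z) * v (mix z))%:E)%E.
  apply: (same_law_integral (g := fun x => (u x * v x)%:E)) => //.
    exact: measurable_sample.
  move=> s A us mA; rewrite sample_box//.
  have -> : mix @^-1` box s A =
      (sample @^-1` box [seq i <- s | J i] A) `*`
      (sample @^-1` box [seq i <- s | predC J i] A).
    apply/seteqP; split => z /=.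
      move=> zA; split => i; rewrite mem_filter => /andP[/= Ji si];
      by have := zA i si; rewrite /mix ?Ji // (negbTE Ji).
    move=> [z1 z2] i si; rewrite /mix; case: ifPn => Ji.
      by apply: z1; rewrite mem_filter Ji.
    by apply: z2; rewrite mem_filter /= Ji.
  have mbox t : measurable (sample @^-1` box t A).
    rewrite -[X in measurable X]setTI; apply: measurable_sample => //.
    exact: measurable_box.
  apply: etrans (esym (product_measure1E P P (mbox _) (mbox _))).
  rewrite [LHS](bigID J)/=; congr (_ * _)%E; rewrite -big_filter; apply/esym.
    by apply: sample_box; rewrite ?filter_uniq.
  by apply: sample_box; rewrite ?filter_uniq.
have mu' := measurable_int _ iu; have mv' := measurable_int _ iv.
have uv z : (u (mix z) * v (mix z))%:E =
    ((u (sample z.1))%:E * (v (sample z.2))%:E)%E.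
  have -> : u (mix z) = u (sample z.1) by apply: uJ => i Ji; rewrite /mix Ji.
  have -> // : v (mix z) = v (sample z.2).
  by apply: vJ => i /negbTE Ji; rewrite /mix Ji.
under eq_integral do rewrite uv.
pose h (z : Omega * Omega) := ((u (sample z.1))%:E * (v (sample z.2))%:E)%E.
have mh : measurable_fun setT h.
  apply: emeasurable_funM.
    by apply: (measurableT_comp mu').
  by apply: (measurableT_comp mv').
have /integrableP[_ iu'] := iu; have /integrableP[_ iv'] := iv.
have ih : (P \x P)%E.-integrable setT h.
  apply/integrable12ltyP => //=.
  have -> : (\int[P]_x \int[P]_y `|h (x, y)| =
      \int[P]_x `|(u (sample x))%:E| * \int[P]_y `|(v (sample y))%:E|)%E.
    rewrite -ge0_integralZr//; last 2 first.
    - exact: measurableT_comp.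
    - exact: integral_ge0.
    apply: eq_integral => x _; rewrite -ge0_integralZl//; last first.
      exact: measurableT_comp.
    by apply: eq_integral => y _; rewrite /h abseM.
  by apply: lte_mul_pinfty => //; rewrite ?ge0_fin_numE//; apply: integral_ge0.
rewrite -(integral12_prod_meas1 ih) /fubini_F /h /=.
under eq_integral do rewrite integralZl//.
have fv : (\int[P]_w (v (sample w))%:E)%E \is a fin_num.
  exact: (integrable_fin_num measurableT iv).
by rewrite -(fineK fv) integralZr.
Qed.

End iid_family.

(** * Jointly measurable versions of random elements of L2 *)

Section almost_everywhere.
Context d (T : measurableType d) (R : realType) (mu : {measure set T -> \bar R}).

Lemma ae_impl (P Q : T -> Prop) : (forall x, P x -> Q x) ->
  {ae mu, forall x, P x} -> {ae mu, forall x, Q x}.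
Proof.
by move=> PQ; apply: negligibleS => x /= nQ Px; apply: nQ; exact: PQ.
Qed.

Lemma ae_and (P Q : T -> Prop) :
  {ae mu, forall x, P x} -> {ae mu, forall x, Q x} ->
  {ae mu, forall x, P x /\ Q x}.
Proof.
move=> nP nQ; apply: negligibleS (negligibleU nP nQ) => x /= /not_andP[];
by [left|right].
Qed.

End almost_everywhere.

Section version.
Context (R : realType).
Local Notation T := (measurableTypeR R).
Local Notation lam := (leb01 R).

Lemma leb01_sub (A : set T) : A `<=` `[0%R, 1%R] -> lam A = lebesgue_measure A.
Proof. by move=> A01; rewrite /leb01 /mrestr setIidl. Qed.

Lemma leb01_setT : lam setT = 1%E.
Proof.
rewrite /leb01 /mrestr setTI lebesgue_measure_itv /= lte_fin ltr01.
by rewrite oppr0 adde0.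
Qed.

Lemma integral_leb01 (A : set T) (f : T -> \bar R) : A `<=` `[0%R, 1%R] ->
  (\int[lam]_(x in A) f x = \int[lebesgue_measure]_(x in A) f x)%E.
Proof.
move=> A01; apply: eq_measure_integral => B mB BA; apply: leb01_sub.
exact: subset_trans A01.
Qed.

Lemma ae_leb01 (Q : T -> Prop) :
  {ae (@lebesgue_measure R), forall t, t \in `[0%R, 1%R[ -> Q t} ->
  {ae lam, forall t, Q t}.
Proof.
move=> [N [mN N0 QN]].
have m1 : measurable (~` `[0%R, 1%R[%classic : set T) by exact: measurableC.
exists (N `|` ~` `[0%R, 1%R[); split; first exact: measurableU.
  apply/eqP; rewrite -measure_le0 (le_trans (measureU2 _ _ _))//.
  apply: adde_le0.
    rewrite -N0 /leb01 /mrestr.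
    by apply: le_measure; rewrite ?inE//; exact: measurableI.
  rewrite /leb01 /mrestr -(@lebesgue_measure_set1 R 1).
  apply: le_measure; rewrite ?inE//; first exact: measurableI.
  move=> x /= [x1]; rewrite !in_itv/= => /andP[x0 x2]; apply/eqP.
  rewrite eq_le x2 /= leNgt; apply/negP => xlt1; apply: x1.
  by rewrite /= in_itv /= x0.
move=> t /= nQ; have [t01|t01] := boolP (t \in `[0%R, 1%R[).
  by left; apply: QN => /= /(_ t01).
by right; apply/negP.
Qed.

Lemma norm1_le_norm2 (f : T -> R) : measurable_fun setT f ->
  (\int[lam]_t `|f t|%:E <= norm2 f)%E.
Proof.
move=> mf.
have := @hoelder _ _ _ lam f (cst 1) 2 2 mf (measurable_cst _).
rewrite Lnorm1 => /(_ ltac:(by []) ltac:(by []) ltac:(by lra)).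
have -> : ('N[lam]_2%:E [EFin \o cst 1%R] = 1)%E.
  rewrite (_ : EFin \o cst 1%R = cst 1%E)//.
  by rewrite (@Lnorm_cst1 _ _ R lam 2) [X in (X `^ _)%E]leb01_setT poweR1r.
by rewrite mule1; under eq_integral do rewrite /= mulr1.
Qed.

Lemma L2_integrable (f : L2 R) : lam.-integrable setT (EFin \o f).
Proof.
apply/Lfun1_integrable; apply: (@Lfun_subset12 _ _ _ lam) => //.
  exact: fin_num_measure.
exact: LfunP.
Qed.

(** Integrating over a fixed set is continuous on L2. *)
Lemma L2open_integral_gt (A : set T) (a : R) : measurable A ->
  L2open [set f : L2 R | a < \int[lam]_(t in A) f t].
Proof.
move=> mA f /= af; exists (\int[lam]_(t in A) f t - a); first by rewrite subr_gt0.
move=> g fg.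
have iA (u : L2 R) : lam.-integrable A (EFin \o u).
  by apply: (integrableS (E := setT)) => //; exact: L2_integrable.
have : `|\int[lam]_(t in A) f t - \int[lam]_(t in A) g t| <
        \int[lam]_(t in A) f t - a.
  rewrite -lte_fin; apply: le_lt_trans fg.
  rewrite -RintegralB// EFin_normr_Rintegral//; last first.
    by apply: eq_integrable (integrableB mA (iA f) (iA g)) => // x _.
  apply: le_trans (norm1_le_norm2 _); last first.
    by apply: measurable_funB; exact: measurable_funPT.
  have mfg : measurable_fun setT (fun t : T => (f t - g t)%:E).
    by apply/measurable_EFinP; apply: measurable_funB; exact: measurable_funPT.
  apply: (le_trans (le_abse_integral _ _ _)) => //.
    exact: measurable_funTS.
  by apply: ge0_subset_integral => //; exact: measurableT_comp.
by rewrite ltr_norml => /andP[_]; lra.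
Qed.

Definition cell (n : nat) (j : int) : set T :=
  `[j%:~R / n.+1%:R, (j%:~R + 1) / n.+1%:R[.

Definition cell_of (x : R) (n : nat) : set R := cell n (Num.floor (n.+1%:R * x)).

Lemma cell_ofP (x : R) n : cell_of x n x.
Proof.
rewrite /cell_of /cell /= in_itv /= ler_pdivrMr// ltr_pdivlMr// [x * _]mulrC.
by rewrite -intrD1 Num.Theory.floor_le floorD1_gt.
Qed.

Lemma cellP (x : R) n j : cell n j x -> j = Num.floor (n.+1%:R * x).
Proof.
rewrite /cell /= in_itv /= ler_pdivrMr// ltr_pdivlMr// [x * _]mulrC -intrD1.
by move=> H; apply/esym/floor_def.
Qed.

Lemma cell_measure n j : lebesgue_measure (cell n j) = (n.+1%:R^-1)%:E.
Proof.
rewrite /cell lebesgue_measure_itv /= lte_fin ltr_pM2r ?invr_gt0//.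
by rewrite ltrDl ltr01 -EFinB -mulrBl addrAC subrr add0r mul1r.
Qed.

Lemma cell_of_shrinking (x : R) : nicely_shrinking x (cell_of x).
Proof.
split; first by move=> n; exact: measurable_itv.
exists (2, fun n => (n.+1%:R^-1)%:pos); split => //=.
- rewrite (_ : (fun n => _) = (fun n : nat => n.+1%:R^-1 : R))//.
  exact: cvg_harmonic.
- move=> n y yx; have xx := cell_ofP x n.
  move: yx xx; rewrite /cell_of; set j := Num.floor _.
  rewrite /cell /= !in_itv/= mulrDl mul1r => /andP[y1 y2] /andP[x1 x2].
  rewrite /ball /= ltr_norml.
  set v := _^-1 in x1 x2 y1 y2 *. move: (_ * v) x1 x2 y1 y2 => z x1 x2 y1 y2.
  by apply/andP; split; lra.
- move=> n; rewrite lebesgue_measure_ball ?invr_ge0// cell_measure -EFinM.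
  by rewrite lee_fin mulr_natl.
Qed.

Section one_function.
Variable f : L2 R.

Let f01 := f \_ `[0%R, 1%R].

Lemma L2_locally_integrable : locally_integrable setT f01.
Proof.
apply: open_integrable_locally; first exact: openT.
rewrite /f01 -restrict_EFin; apply/(integrable_mkcond (EFin \o f)) => //.
have : lam.-integrable `[0%R, 1%R] (EFin \o f).
  by apply: (integrableS (E := setT)) => //; exact: L2_integrable.
move=> /integrableP[mf lf]; apply/integrableP; split=> //.
by rewrite -integral_leb01.
Qed.

Definition cell_average n (t : R) : R :=
  \sum_(j < n.+1) \1_(cell n j) t * (n.+1%:R * \int[lam]_(y in cell n j) f y).

Lemma cell_averageE n t : t \in `[0%R, 1%R[ ->
  (cell_average n t)%:E = ((lebesgue_measure (cell_of t n))^-1 *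
    \int[lebesgue_measure]_(y in cell_of t n) (f01 y)%:E)%E.
Proof.
rewrite in_itv /= => /andP[t0 t1].
have jt0 : 0 <= Num.floor (n.+1%:R * t) by rewrite floor_ge0 mulr_ge0.
have jtn : (`|Num.floor (n.+1%:R * t)| < n.+1)%N.
  by rewrite -ltz_nat gez0_abs// floor_lt_int gtr_pMr.
have [k kE] : exists k : 'I_n.+1, (k : nat)%:Z = Num.floor (n.+1%:R * t).
  by exists (Ordinal jtn); rewrite /= gez0_abs.
have c01 : cell_of t n `<=` `[0, 1].
  rewrite /cell_of -kE => y; rewrite /cell /= !in_itv/= => /andP[y0 y1].
  apply/andP; split; first by apply: le_trans y0; rewrite divr_ge0.
  apply: (le_trans (ltW y1)); rewrite ler_pdivrMr// mul1r.
  by rewrite -natr1 lerD2r -pmulrn ler_nat -ltnS.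
rewrite /cell_average (bigD1 k)//= big1 ?addr0; last first.
  move=> i ik; rewrite indicE memNset ?mul0r// => /cellP; rewrite -kE => -[] ki.
  by move/eqP: ik; apply; exact/val_inj.
rewrite kE indicE mem_set ?mul1r; last exact: cell_ofP.
rewrite /cell_of cell_measure EFinM; congr (_ * _)%E.
  by rewrite -[n.+1%:R in LHS]invrK inver invr_eq0 pnatr_eq0.
rewrite /Rintegral fineK; last first.
  apply: integrable_fin_num; first exact: measurable_itv.
  apply: integrableS (L2_integrable f) => //; exact: measurable_itv.
rewrite -integral_leb01//; apply: eq_integral => y yc.
by rewrite /f01 patchE mem_set//; apply: c01; rewrite inE in yc.
Qed.

Lemma cell_average_cvg :
  {ae lam, forall t, (cell_average n t)%:E @[n --> \oo] --> (f t)%:E}.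
Proof.
apply: ae_leb01.
have [N [mN N0 NP]] := lebesgue_differentiation L2_locally_integrable.
exists N; split => // t; apply: contra_notP => Nt t01.
have tP : lebesgue_pt f01 t by apply: contra_notP Nt => ?; exact: NP.
have := nice_lebesgue_differentiation cell_of_shrinking L2_locally_integrable tP.
have -> : f01 t = f t.
  rewrite /f01 patchE mem_set//; move: t01; rewrite /= !in_itv/= => /andP[-> /ltW].
  by [].
apply: cvg_trans; apply: near_eq_cvg; apply: nearW => n.
by rewrite cell_averageE.
Qed.

End one_function.

(** A Borel map into L2 only gives classes of functions of [t]; averages over
    cells depend measurably on the class and step-wise on [t], hence jointly
    measurably on both, and they converge almost everywhere. *)
Lemma L2_version d (V : measurableType d) (F : V -> L2 R) :
  (forall B, L2borel B -> measurable (F @^-1` B)) ->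
  exists2 g : V * T -> R, measurable_fun setT g &
    forall x, {ae lam, forall t, g (x, t) = F x t}.
Proof.
move=> mF; pose G n (z : V * T) := (cell_average (F z.1) n z.2)%:E.
have mI (A : set T) : measurable A ->
    measurable_fun setT (fun x => \int[lam]_(t in A) F x t).
  move=> mA; apply: (measurability _ (RGenOInfty.measurableE R)) => //.
  move=> _ [_ [a ->] <-]; rewrite setTI.
  have bA : L2borel [set f : L2 R | a < \int[lam]_(t in A) f t].
    by apply: sub_sigma_algebra; exact: L2open_integral_gt.
  have := mF _ bA.
  congr measurable; apply/seteqP; split => x /=; by rewrite in_itv /= andbT.
have mG n : measurable_fun setT (G n).
  apply/measurable_EFinP; apply: measurable_sum => j.
  apply: measurable_funM.
    have mi : measurable_fun setT (\1_(cell n j) : T -> R).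
      by apply: measurable_indic; exact: measurable_itv.
    exact: (measurableT_comp mi measurable_snd).
  apply: measurable_funM => //.
  have mA : measurable (cell n j) by exact: measurable_itv.
  exact: (measurableT_comp (mI _ mA) measurable_fst).
exists (fun z => fine (limn_esup (G ^~ z))).
  by apply: measurableT_comp => //; exact: measurable_fun_limn_esup.
move=> x; apply: (ae_impl (mu := leb01 R) _ (cell_average_cvg (F x))) => t Gt.
rewrite is_cvg_limn_esupE; last by apply/cvg_ex; eexists; exact: Gt.
by rewrite (cvg_lim _ Gt).
Qed.

End version.

(** * Covariances of square integrable random variables *)

Section covariances.
Context d (Omega : measurableType d) (R : realType) (P : probability Omega R).
Implicit Types X Y Z : Omega -> R.

Definition moment2 X : \bar R := (\int[P]_w ((X w) ^+ 2)%:E)%E.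

Definition mean X : R := \int[P]_w X w.

Definition sq_int X := measurable_fun [set: Omega] X /\ (moment2 X < +oo)%E.

Definition cov X Y : R := mean (X \* Y) - mean X * mean Y.

Local Notation int X := (P.-integrable [set: Omega] (EFin \o X)).

Lemma moment2_ge0 X : (0 <= moment2 X)%E.
Proof. by apply: integral_ge0 => w _; rewrite lee_fin sqr_ge0. Qed.

Lemma measurable_sqr d' (T : measurableType d') (f : T -> R) :
  measurable_fun [set: T] f ->
  measurable_fun [set: T] (fun x => ((f x) ^+ 2)%:E).
Proof. by move=> mf; apply/measurable_EFinP; exact: measurable_funX. Qed.

Lemma sq_int_sqr X : sq_int X -> int (fun w => X w ^+ 2).
Proof.
move=> [mX X2]; apply/integrableP; split; first exact: measurable_sqr.
by under eq_integral do rewrite /= ger0_norm ?sqr_ge0//.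
Qed.

Lemma int_le X Y : measurable_fun [set: Omega] X ->
  (forall w, `|X w| <= Y w) -> int Y -> int X.
Proof.
move=> mX XY; apply: le_integrable => //; first exact/measurable_EFinP.
by move=> w _; rewrite lee_fin (le_trans (XY w))// ler_norm.
Qed.

Lemma intD X Y : int X -> int Y -> int (X \+ Y).
Proof. by move=> iX iY; exact: (integrableD measurableT iX iY). Qed.

Lemma intB X Y : int X -> int Y -> int (X \- Y).
Proof. by move=> iX iY; exact: (integrableB measurableT iX iY). Qed.

Lemma intZ (a : R) X : int X -> int (fun w => a * X w).
Proof. by move=> iX; exact: (integrableZl measurableT a iX). Qed.

Lemma sq_int_mul X Y : sq_int X -> sq_int Y -> int (X \* Y).
Proof.
move=> X2 Y2; have [mX _] := X2; have [mY _] := Y2.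
apply: (int_le (Y := (fun w => X w ^+ 2) \+ (fun w => Y w ^+ 2))).
- exact: measurable_funM.
- by move=> w /=; rewrite ler_norml; apply/andP; split; nra.
- by apply: intD; exact: sq_int_sqr.
Qed.

Lemma sq_int_cst (r : R) : sq_int (fun=> r).
Proof.
split; first exact: measurable_cst.
by rewrite /moment2 integral_cst//= probability_setT mule1 ltry.
Qed.

Lemma sq_intP X : sq_int X -> int X.
Proof.
move=> X2; have := sq_int_mul X2 (sq_int_cst 1).
by apply: eq_integrable => // w _ /=; rewrite mulr1.
Qed.

Lemma sq_intD X Y : sq_int X -> sq_int Y -> sq_int (X \+ Y).
Proof.
move=> X2 Y2; have [mX _] := X2; have [mY _] := Y2.
split; first exact: measurable_funD.
have i2 : int ((fun w => 2 * X w ^+ 2) \+ (fun w => 2 * Y w ^+ 2)).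
  by apply: intD; apply: intZ; exact: sq_int_sqr.
apply: le_lt_trans (integrable_lty _ i2) => //.
apply: ge0_le_integral => //.
- by move=> w _; rewrite lee_fin sqr_ge0.
- by apply: measurable_sqr; exact: measurable_funD.
- by have /integrableP[] := i2.
- move=> w _; rewrite lee_fin /= sqrrD; have := sqr_ge0 (X w - Y w).
  by rewrite sqrrB; lra.
Qed.

Lemma sq_intZ (a : R) X : sq_int X -> sq_int (fun w => a * X w).
Proof.
move=> X2; have [mX _] := X2; split; first exact: measurable_funM.
apply: le_lt_trans (integrable_lty _ (intZ (a ^+ 2) (sq_int_sqr X2))) => //.
by rewrite /moment2; under [leLHS]eq_integral do rewrite exprMn.
Qed.

Lemma sq_intB X Y : sq_int X -> sq_int Y -> sq_int (X \- Y).
Proof.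
move=> X2 Y2; have := sq_intD X2 (sq_intZ (-1) Y2).
by rewrite (_ : _ \+ _ = X \- Y)//; apply/funext => w /=; rewrite mulN1r.
Qed.

Lemma moment2E X : sq_int X -> moment2 X = (mean (X \* X))%:E.
Proof.
move=> X2; rewrite /mean /Rintegral fineK; last first.
  by apply: integrable_fin_num => //; exact: sq_int_mul.
by apply: eq_integral => w _.
Qed.

Lemma meanB X Y : int X -> int Y -> mean (X \- Y) = mean X - mean Y.
Proof. by move=> iX iY; rewrite /mean RintegralB. Qed.

Lemma meanZ (a : R) X : int X -> mean (fun w => a * X w) = a * mean X.
Proof. by move=> iX; rewrite /mean RintegralZl. Qed.

Lemma integrable_sum (I : Type) (s : seq I) (F : I -> Omega -> R) :
  (forall i, int (F i)) -> int (fun w => \sum_(i <- s) F i w).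
Proof.
move=> iF; elim: s => [|i s IHs].
  apply: (eq_integrable _ (EFin \o cst 0%R)) => //.
    by move=> w _ /=; rewrite big_nil.
  by apply: sq_intP; exact: sq_int_cst.
have := integrableD measurableT (iF i) IHs.
by apply: eq_integrable => // w _ /=; rewrite big_cons.
Qed.

Lemma mean_sum (I : Type) (s : seq I) (F : I -> Omega -> R) :
  (forall i, int (F i)) ->
  mean (fun w => \sum_(i <- s) F i w) = \sum_(i <- s) mean (F i).
Proof.
move=> iF; elim: s => [|i s IHs].
  rewrite big_nil /mean; under eq_Rintegral do rewrite big_nil.
  by rewrite Rintegral_cst// mul0r.
rewrite big_cons -IHs /mean; under eq_Rintegral do rewrite big_cons.
by rewrite RintegralD//; exact: integrable_sum.
Qed.

Lemma covBl X Y Z : sq_int X -> sq_int Y -> sq_int Z ->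
  cov (X \- Y) Z = cov X Z - cov Y Z.
Proof.
move=> X2 Y2 Z2; rewrite /cov.
rewrite (_ : (X \- Y) \* Z = (X \* Z) \- (Y \* Z)); last first.
  by apply/funext => w /=; rewrite mulrBl.
rewrite !meanB ?mulrBl; try by [exact: sq_int_mul | exact: sq_intP].
ring.
Qed.

Lemma covC X Y : cov X Y = cov Y X.
Proof.
rewrite /cov mulrC; congr (mean _ - _); apply/funext => w /=; exact: mulrC.
Qed.

Lemma cov_centered X Y : sq_int X -> sq_int Y ->
  mean (fun w => (X w - mean X) * (Y w - mean Y)) = cov X Y.
Proof.
move=> X2 Y2.
have -> : (fun w => (X w - mean X) * (Y w - mean Y)) =
    ((X \* Y) \- (fun w => mean Y * X w)) \- (fun w => mean X * (Y w - mean Y)).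
  by apply/funext => w /=; ring.
have iY : int (fun w => Y w - mean Y).
  by apply: sq_intP; apply: (sq_intB Y2); exact: sq_int_cst.
rewrite !meanB//; last 4 first.
- exact: sq_int_mul.
- by apply: sq_intP; exact: sq_intZ.
- apply: intB; first exact: sq_int_mul.
  by apply: sq_intP; exact: sq_intZ.
- by apply: sq_intP; apply: sq_intZ; apply: (sq_intB Y2); exact: sq_int_cst.
rewrite !meanZ//; last exact: sq_intP.
rewrite (_ : mean (fun w => Y w - mean Y) = 0) ?mulr0 ?subr0 ?[mean Y * _]mulrC//.
rewrite (@meanB Y (cst (mean Y))); last 2 first.
- exact: sq_intP.
- by apply: sq_intP; exact: sq_int_cst.
have -> : mean (cst (mean Y)) = mean Y; last by rewrite subrr.
by rewrite {1}/mean Rintegral_cst//= probability_setT mulr1.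
Qed.

Lemma mean_sqr_le X : sq_int X -> mean X ^+ 2 <= mean (X \* X).
Proof.
move=> X2; rewrite -subr_ge0 expr2 -/(cov X X) -cov_centered//.
by apply: Rintegral_ge0 => w _; rewrite -expr2 sqr_ge0.
Qed.

Lemma mean_mul_le X Y (a : R) : 0 < a -> sq_int X -> sq_int Y ->
  2 * `|mean (X \* Y)| <= a * mean (X \* X) + a^-1 * mean (Y \* Y).
Proof.
move=> a0 X2 Y2.
have YX := sq_int_mul X2 Y2.
have i2 : int (fun w => a * (X \* X) w).
  by apply: intZ; exact: sq_int_mul.
have i3 : int (fun w => a^-1 * (Y \* Y) w).
  by apply: intZ; exact: sq_int_mul.
have i1 : int (fun w => `|(X \* Y) w|) by exact: (integrable_abse YX).
rewrite -(meanZ a) -?(meanZ a^-1)//; try exact: sq_int_mul.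
rewrite -RintegralD//; apply: (@le_trans _ _ (2 * mean (fun w => `|(X \* Y) w|))).
  by rewrite ler_pM2l// le_normr_Rintegral.
rewrite -(meanZ 2)//; apply: le_Rintegral => //.
- exact: intZ.
- exact: intD.
move=> w _ /=; rewrite normrM.
have := sqr_ge0 (a * `|X w| - `|Y w|).
rewrite sqrrB exprMn !real_normK ?num_real// => H.
rewrite -subr_ge0 -(pmulr_rge0 _ a0) (le_trans H)//.
rewrite le_eqVlt; apply/orP; left; apply/eqP; field; exact: lt0r_neq0.
Qed.

Lemma cov_le X Y (a : R) : 0 < a -> sq_int X -> sq_int Y ->
  `|cov X Y| <= a * mean (X \* X) + a^-1 * mean (Y \* Y).
Proof.
move=> a0 X2 Y2; have := mean_mul_le a0 X2 Y2.
have := mean_sqr_le X2; have := mean_sqr_le Y2.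
set x := mean X; set y := mean Y; set xx := mean (X \* X); set yy := mean (Y \* Y).
move=> hy hx h; rewrite /cov (le_trans (ler_normB _ _))// normrM.
have ax := ler_wpM2l (ltW a0) hx.
have ai0 : 0 <= a^-1 by rewrite invr_ge0 ltW.
have ay := ler_wpM2l ai0 hy.
suff : 2 * (`|x| * `|y|) <= a * x ^+ 2 + a^-1 * y ^+ 2 by lra.
have := sqr_ge0 (a * `|x| - `|y|).
rewrite sqrrB exprMn !real_normK ?num_real// => H.
rewrite -subr_ge0 -(pmulr_rge0 _ a0) (le_trans H)//.
rewrite le_eqVlt; apply/orP; left; apply/eqP; field; exact: lt0r_neq0.
Qed.

(** By bilinearity, [cov X Y] is the sum of two covariances that each contain one of
    the differences; [a] weighs these small differences against the variables. *)
Lemma cov_approx X Y X' Y' (a : R) : 0 < a ->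
  sq_int X -> sq_int Y -> sq_int X' -> sq_int Y' -> cov X' Y' = 0 ->
  ((`|cov X Y|)%:E <= a%:E * (moment2 (X \- X')%R + moment2 (Y \- Y')%R) +
    a^-1%:E * (moment2 Y + moment2 X'))%E.
Proof.
move=> a0 X2 Y2 X'2 Y'2 c0.
have XX := sq_intB X2 X'2; have YY := sq_intB Y2 Y'2.
rewrite !moment2E// lee_fin.
have -> : cov X Y = cov (X \- X') Y + cov X' (Y \- Y').
  by rewrite [cov X' _]covC !covBl// (covC Y') c0 (covC Y); ring.
rewrite (le_trans (ler_normD _ _))//.
have := cov_le a0 XX Y2; have := cov_le a0 YY X'2; rewrite (covC (Y \- Y')).
lra.
Qed.

Lemma var_sum (I : Type) (s : seq I) (X : I -> Omega -> R) :
  (forall i, sq_int (X i)) ->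
  moment2 (fun w => \sum_(i <- s) (X i w - mean (X i))) =
  (\sum_(i <- s) \sum_(j <- s) cov (X i) (X j))%:E.
Proof.
move=> X2.
have Xc i : sq_int (fun w => X i w - mean (X i)).
  by apply: (sq_intB (X2 i)); exact: sq_int_cst.
have E w : (\sum_(i <- s) (X i w - mean (X i))) ^+ 2 =
    \sum_(i <- s) \sum_(j <- s) (X i w - mean (X i)) * (X j w - mean (X j)).
  by rewrite expr2 mulr_suml; apply: eq_bigr => i _; rewrite mulr_sumr.
rewrite /moment2; under eq_integral do rewrite E.
have iij i j : int (fun w => (X i w - mean (X i)) * (X j w - mean (X j))).
  exact: (sq_int_mul (Xc i) (Xc j)).
have ii i : int (fun w =>
    \sum_(j <- s) (X i w - mean (X i)) * (X j w - mean (X j))).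
  exact: integrable_sum.
transitivity ((mean (fun w => \sum_(i <- s) \sum_(j <- s)
    (X i w - mean (X i)) * (X j w - mean (X j))))%:E).
  rewrite /mean /Rintegral fineK//; apply: integrable_fin_num => //.
  exact: integrable_sum.
rewrite mean_sum//; congr (_%:E); apply: eq_bigr => i _.
by rewrite mean_sum//; apply: eq_bigr => j _; exact: cov_centered.
Qed.

(** Where a bound is infinite there is nothing to prove; elsewhere the variables are
    square integrable. *)
Lemma var_sum_le (I : finType) (X : I -> Omega -> R) (b : I -> I -> \bar R) :
  (forall i, measurable_fun setT (X i)) ->
  (forall i j, 0 <= b i j)%E ->
  (forall i, moment2 (X i) <= b i i)%E ->
  (forall i j, sq_int (X i) -> sq_int (X j) -> (`|cov (X i) (X j)|)%:E <= b i j)%E ->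
  (moment2 (fun w => (\sum_i (X i w - mean (X i)))%R) <=
   \sum_i \sum_j b i j)%E.
Proof.
move=> mX b0 bii bij.
have [X2|/existsNP[i nX]] := pselect (forall i, sq_int (X i)).
  rewrite var_sum// -sumEFin; apply: lee_sum => i _.
  rewrite -sumEFin; apply: lee_sum => j _.
  by apply: le_trans (bij i j _ _); rewrite // lee_fin ler_norm.
have bi : b i i = +oo%E.
  apply/eqP; rewrite -leye_eq leNgt; apply/negP => bi; apply: nX.
  by split => //; exact: le_lt_trans (bii _) _.
rewrite (bigD1 i)//= (bigD1 i)//= bi addye ?addye ?leey//.
  by rewrite gt_eqF// (@lt_le_trans _ _ 0%E) ?ltNyr// sume_ge0// => j _; exact: sume_ge0.
by rewrite gt_eqF// (@lt_le_trans _ _ 0%E) ?ltNyr// sume_ge0.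
Qed.

End covariances.

(** * Sums of weakly dependent random fields *)

Lemma sum_dist_le (R : realType) (F : nat -> R) N i : (i < N)%N -> (forall k, 0 <= F k) ->
  \sum_(j < N) F ((i - j) + (j - i))%N <= 2 * \sum_(k < N) F k.
Proof.
move=> iN F0.
have S a b : (a <= b)%N -> \sum_(k < a) F k <= \sum_(k < b) F k.
  move=> ab; rewrite -!(big_mkord xpredT F) (big_cat_nat _ ab)//= lerDl.
  by apply: sumr_ge0.
rewrite -(big_mkord xpredT (fun j => F ((i - j) + (j - i))%N)).
rewrite (big_cat_nat (leq0n i) (ltnW iN))//= mulr2n mulrDl mul1r; apply: lerD.
  rewrite big_nat_rev /= add0n.
  rewrite (eq_big_nat _ _ (F2 := fun k => F k.+1)); last first.
    by move=> k /andP[_ ki]; congr F; lia.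
  rewrite big_mkord; apply: le_trans (S i.+1 N iN).
  by rewrite big_ord_recl lerDr; exact: F0.
rewrite -[X in \sum_(X <= _ < _) _]add0n big_addn.
rewrite (eq_big_nat _ _ (F2 := F)); last by move=> k _; congr F; lia.
by rewrite big_mkord; apply: S; exact: leq_subr.
Qed.

Section geometric.
Context (R : realType).
Variable th : R.
Hypotheses (th0 : 0 < th) (th1 : th < 1).

Lemma geometric_sum_le N : \sum_(k < N) th ^+ k <= (1 - th)^-1.
Proof.
have t1 : 0 < 1 - th by rewrite subr_gt0.
rewrite -[leRHS]mul1r ler_pdivlMr//.
have := subrX1 th N => H.
have -> : (\sum_(k < N) th ^+ k) * (1 - th) = 1 - th ^+ N.
  by rewrite mulrC -opprB mulNr -H opprB.
by rewrite gerBl exprn_ge0// ltW.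
Qed.

Lemma delayed_geometric_sum_le N r :
  \sum_(k < N) th ^+ (k - r) <= r%:R + (1 - th)^-1.
Proof.
elim: r N => [|r IHr] [|N].
- by rewrite big_ord0 add0r invr_ge0 subr_ge0 ltW.
- by rewrite add0r; under eq_bigr do rewrite subn0; exact: geometric_sum_le.
- by rewrite big_ord0 addr_ge0// invr_ge0 subr_ge0 ltW.
rewrite big_ord_recl /= sub0n expr0 -natr1 addrAC [leRHS]addrC lerD2l.
by apply: le_trans (IHr N); apply: ler_sum => i _; rewrite /bump subSS.
Qed.

End geometric.

Section fields.
Context d (Omega : measurableType d) (R : realType) (P : probability Omega R).
Context d' (Theta : measurableType d') (q : {sigma_finite_measure set Theta -> \bar R}).

Definition field_norm2 (U : Omega * Theta -> R) : \bar R :=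
  (\int[q]_t moment2 P (fun w => U (w, t)))%E.

Lemma measurable_moment2 (U : Omega * Theta -> R) :
  measurable_fun [set: Omega * Theta] U ->
  measurable_fun [set: Theta] (fun t => moment2 P (fun w => U (w, t))).
Proof.
move=> mU; apply: (measurable_fun_fubini_tonelli_G (m1 := P)
  (fun z : Omega * Theta => ((U z) ^+ 2)%:E)) => //.
  exact: measurable_sqr.
by move=> z; rewrite lee_fin sqr_ge0.
Qed.

Lemma measurable_mean (U : Omega * Theta -> R) :
  measurable_fun [set: Omega * Theta] U ->
  measurable_fun [set: Theta] (fun t => mean P (fun w => U (w, t))).
Proof.
move=> mU; have mU' : measurable_fun setT (EFin \o U) by exact/measurable_EFinP.
apply: (measurableT_comp (f := fine)) => //.
rewrite (_ : (fun t => _) = (fubini_G P (EFin \o U)^\+ \- fubini_G P (EFin \o U)^\-)%E).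
  apply: emeasurable_funB; apply: measurable_fun_fubini_tonelli_G => //.
    exact: measurable_funepos.
  exact: measurable_funeneg.
apply/funext => t.
rewrite -[LHS]/(\int[P]_w ((EFin \o U) \o pair^~ t) w)%E integralE.
by rewrite funepos_comp funeneg_comp.
Qed.

Let ge0_integralD2 (f g : Theta -> \bar R) :
  measurable_fun setT f -> measurable_fun setT g ->
  (forall t, 0 <= f t)%E -> (forall t, 0 <= g t)%E ->
  (\int[q]_t (f t + g t) = \int[q]_t f t + \int[q]_t g t)%E.
Proof. by move=> *; rewrite ge0_integralD. Qed.

Let integral_weighted (a b : R) (d1 d2 u1 u2 v1 v2 : Theta -> \bar R) :
  0 < a -> 0 < b ->
  measurable_fun setT d1 -> measurable_fun setT d2 -> measurable_fun setT u1 ->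
  measurable_fun setT u2 -> measurable_fun setT v1 -> measurable_fun setT v2 ->
  (forall t, 0 <= d1 t)%E -> (forall t, 0 <= d2 t)%E -> (forall t, 0 <= u1 t)%E ->
  (forall t, 0 <= u2 t)%E -> (forall t, 0 <= v1 t)%E -> (forall t, 0 <= v2 t)%E ->
  (\int[q]_t (a%:E * (d1 t + d2 t) + b%:E * (u1 t + u2 t + (v1 t + v2 t))) =
   a%:E * (\int[q]_t d1 t + \int[q]_t d2 t) + b%:E *
    (\int[q]_t u1 t + \int[q]_t u2 t + (\int[q]_t v1 t + \int[q]_t v2 t)))%E.
Proof.
move=> a0 b0 md1 md2 mu1 mu2 mv1 mv2 d10 d20 u10 u20 v10 v20.
have mD (f g : Theta -> \bar R) : measurable_fun setT f ->
    measurable_fun setT g -> measurable_fun setT (fun t => f t + g t)%E.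
  exact: emeasurable_funD.
have D0 (f g : Theta -> \bar R) : (forall t, 0 <= f t)%E ->
    (forall t, 0 <= g t)%E -> (forall t, 0 <= f t + g t)%E.
  by move=> f0 g0 t; exact: adde_ge0.
have muu := mD _ _ mu1 mu2; have mvv := mD _ _ mv1 mv2; have mdd := mD _ _ md1 md2.
have uu0 := D0 _ _ u10 u20; have vv0 := D0 _ _ v10 v20; have dd0 := D0 _ _ d10 d20.
have muv := mD _ _ muu mvv; have uv0 := D0 _ _ uu0 vv0.
rewrite ge0_integralD2.
- rewrite !ge0_integralZl//; last 2 first.
    by rewrite lee_fin ltW.
    by rewrite lee_fin ltW.
  by rewrite !ge0_integralD2.
- exact: measurable_funeM.
- exact: measurable_funeM.
- by move=> t; apply: mule_ge0 => //; rewrite lee_fin ltW.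
- by move=> t; apply: mule_ge0 => //; rewrite lee_fin ltW.
Qed.

(** [U i] and [U j] are within mean square distance [th ^ m] of fields that are
    uncorrelated as soon as the gap between [i] and [j] exceeds [r + m]; taking
    for [m] the largest admissible value, covariances decay geometrically once
    the indices are [r] apart, and only pairs that are closer than that
    contribute the factor [r]. *)
Lemma field_var_sum (th B : R) (m0 r N : nat)
    (U : nat -> Omega * Theta -> R) (V : nat -> nat -> Omega * Theta -> R) :
  0 < th -> th < 1 -> 0 <= B ->
  (forall i, measurable_fun setT (U i)) ->
  (forall m i, measurable_fun setT (V m i)) ->
  (forall i, field_norm2 (U i) <= B%:E)%E ->
  (forall m i, (m0 <= m)%N -> field_norm2 (V m i) <= B%:E)%E ->
  (forall m i, (m0 <= m)%N ->
     field_norm2 (U i \- V m i)%R <= (B * th ^+ (2 * m))%:E)%E ->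
  (forall m i j t, (0 < m)%N -> (i + r + m <= j)%N ->
     sq_int P (fun w => V m i (w, t)) -> sq_int P (fun w => V m j (w, t)) ->
     cov P (fun w => V m i (w, t)) (fun w => V m j (w, t)) = 0) ->
  (\int[q]_t moment2 P (fun w =>
      (\sum_(i < N) (U i (w, t) - mean P (fun w' => U i (w', t))))%R) <=
   (12 * B / th ^+ m0.+1 / (1 - th) * (1 + r%:R) * N%:R)%:E)%E.
Proof.
move=> th0 th1 B0 mU mV UB VB UVB UV0.
pose g (i j : nat) := ((i - j) + (j - i) - r)%N.
pose nU i t := moment2 P (fun w => U i (w, t)).
pose nV m i t := moment2 P (fun w => V m i (w, t)).
pose nD m i t := moment2 P (fun w => (U i \- V m i) (w, t)).
(* the bound on [cov (U i) (U j)] at [t]: close indices leave no room for a coupling *)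
pose b i j t := (let m := g i j in if (m0.+1 <= m)%N
  then (th ^+ m)^-1%:E * (nD m i t + nD m j t) +
       (th ^+ m)%:E * (nU i t + nU j t + (nV m i t + nV m j t))
  else nU i t + nU j t)%E.
have mu_ (U' : Omega * Theta -> R) t : measurable_fun setT U' ->
    measurable_fun [set: Omega] (fun w => U' (w, t) : R).
  by move=> mU'; apply: (measurableT_comp mU'); exact: pair2_measurable.
have thg (k : nat) : 0 < th ^+ k by exact: exprn_gt0.
have nU0 i t : (0 <= nU i t)%E by exact: moment2_ge0.
have nV0 m i t : (0 <= nV m i t)%E by exact: moment2_ge0.
have nD0 m i t : (0 <= nD m i t)%E by exact: moment2_ge0.
have mnU i : measurable_fun setT (nU i) by exact: measurable_moment2.
have mnV m i : measurable_fun setT (nV m i) by exact: measurable_moment2.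
have mnD m i : measurable_fun setT (nD m i).
  by apply: measurable_moment2; exact: measurable_funB.
have b0 i j t : (0 <= b i j t)%E.
  rewrite /b; case: ifP => _; last by rewrite adde_ge0.
  apply: adde_ge0; apply: mule_ge0.
  - by rewrite lee_fin invr_ge0; exact: ltW.
  - by apply: adde_ge0; exact: moment2_ge0.
  - by rewrite lee_fin; exact: ltW.
  - by apply: adde_ge0; apply: adde_ge0; exact: moment2_ge0.
have mb i j : measurable_fun setT (b i j).
  rewrite /b /=; case: (m0 < g i j)%N; last exact: emeasurable_funD.
  apply: emeasurable_funD; apply: measurable_funeM; apply: emeasurable_funD => //;
  exact: emeasurable_funD.
have ptw t : (moment2 P (fun w =>
      (\sum_(i < N) (U i (w, t) - mean P (fun w' => U i (w', t))))%R) <=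
      \sum_(i < N) \sum_(j < N) b i j t)%E.
  apply: (var_sum_le (X := fun (i : 'I_N) w => U i (w, t))
      (b := fun i j : 'I_N => b i j t)) => //.
  - by move=> i; exact: mu_.
  - move=> i; rewrite /b /g subnn sub0n.
    by rewrite leeDl//.
  - move=> i j Ui Uj; rewrite /b; case: ifPn => mg; last first.
      have := cov_le (@ltr01 R) Ui Uj; rewrite mul1r invr1 mul1r => h.
      by rewrite /nU !moment2E// lee_fin.
    set m := g i j in mg *.
    have posm : (0 < (th ^+ m)%:E)%E by rewrite lte_fin.
    have poy x y : (0 <= y)%E -> (x = +oo \/ y = +oo)%E ->
        (0 <= x)%E -> (x + y = +oo)%E.
      move=> y0 [->|->] x0; first by rewrite addye// gt_eqF// (lt_le_trans _ y0)// ltNyr.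
      by rewrite addey// gt_eqF// (lt_le_trans _ x0)// ltNyr.
    have [VV|VV] := pselect ((nV m i t < +oo)%E /\ (nV m j t < +oo)%E); last first.
      have -> : (nV m i t + nV m j t = +oo)%E.
        apply: poy => //; move/not_andP: VV => -[] /negP; rewrite -leNgt leye_eq => /eqP.
          by left.
        by right.
      rewrite [(_ + +oo)%E]addey ?gt_eqF ?(lt_le_trans _ (adde_ge0 _ _)) ?ltNyr//.
      rewrite gt0_muley// addey ?leey// gt_eqF// (@lt_le_trans _ _ 0%E) ?ltNyr//.
      apply: mule_ge0; first by rewrite lee_fin invr_ge0; exact: ltW.
      by apply: adde_ge0; exact: moment2_ge0.
    have Vi : sq_int P (fun w => V m i (w, t)) by split; [exact: mu_|case: VV].
    have Vj : sq_int P (fun w => V m j (w, t)) by split; [exact: mu_|case: VV].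
    have am : 0 < (th ^+ m)^-1 by rewrite invr_gt0.
    apply: (le_trans (cov_approx am Ui Uj Vi Vj _)).
      have m0' : (0 < m)%N by apply: leq_trans mg.
      have [ij|ij] := leqP i j.
        by apply: UV0 => //; rewrite /m /g in m0' *; lia.
      by rewrite covC; apply: UV0 => //; rewrite /m /g in m0' *; lia.
    rewrite invrK; apply: leeD => //; apply: lee_wpmul2l; first by rewrite lee_fin ltW.
    rewrite -/(nU j t) -/(nV m i t) [leRHS]addeACA addeC.
    by rewrite [(nU i t + _)%E]addeC leeD// leeDl// leeDr.
pose D := 6 * B / th ^+ m0.+1.
have th_anti (k l : nat) : (k <= l)%N -> th ^+ l <= th ^+ k.
  by move=> kl; apply: ler_wiXn2l => //; exact: ltW.
have D0 : 0 <= D by rewrite /D divr_ge0 ?mulr_ge0// ltW.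
have ib i j : (\int[q]_t b i j t <= (D * th ^+ g i j)%:E)%E.
  rewrite /b /=; have [mg|mg] := ltnP m0 (g i j); last first.
    rewrite ge0_integralD2//; apply: (le_trans (leeD (UB i) (UB j))).
    rewrite -EFinD lee_fin /D -mulrA.
    have : 1 <= (th ^+ m0.+1)^-1 * th ^+ g i j.
      by rewrite mulrC ler_pdivlMr// mul1r th_anti// ltnW.
    by move=> /(ler_wpM2l B0); lra.
  set m := g i j; have mm0 : (m0 <= m)%N by exact: ltnW.
  have am : 0 < (th ^+ m)^-1 by rewrite invr_gt0.
  rewrite integral_weighted//.
  apply: (@le_trans _ _ ((th ^+ m)^-1%:E * ((B * th ^+ (2 * m))%:E + (B * th ^+ (2 * m))%:E) +
     (th ^+ m)%:E * (B%:E + B%:E + (B%:E + B%:E)))%E).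
    apply: leeD; apply: lee_wpmul2l; rewrite ?lee_fin ?(ltW am) ?(ltW (thg _))//.
      by apply: leeD; exact: UVB.
    by apply: leeD; apply: leeD; [exact: UB|exact: UB|exact: VB|exact: VB].
  rewrite lee_fin.
  have -> : (th ^+ m)^-1 * (B * th ^+ (2 * m) + B * th ^+ (2 * m)) +
      th ^+ m * (B + B + (B + B)) = 6 * B * th ^+ m.
    rewrite mulnC muln2 -addnn exprD; field; exact: lt0r_neq0.
  rewrite ler_wpM2r ?(ltW (thg _))// /D ler_peMr ?mulr_ge0// invf_ge1//.
  by apply: exprn_ile1; exact: ltW.
apply: (@le_trans _ _ (\int[q]_t \sum_(i < N) \sum_(j < N) b i j t)%E).
  apply: ge0_le_integral => //.
  - by move=> t _; exact: moment2_ge0.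
  - apply: (measurable_moment2 (U := fun z => \sum_(i < N)
      (U i z - mean P (fun w' => U i (w', z.2))))).
    apply: measurable_sum => i; apply: measurable_funB => //.
    by apply: (measurableT_comp (measurable_mean (mU i))).
  - by apply: emeasurable_sum => i; exact: emeasurable_sum.
rewrite ge0_integral_sum//; last 2 first.
  by move=> i; exact: emeasurable_sum.
  by move=> i t _; exact: sume_ge0.
apply: (@le_trans _ _ (\sum_(i < N) \sum_(j < N) (D * th ^+ g i j)%:E)%E).
  apply: lee_sum => i _; rewrite ge0_integral_sum//.
  by apply: lee_sum.
under eq_bigr do rewrite sumEFin; rewrite sumEFin lee_fin.
apply: (@le_trans _ _ (\sum_(i < N) D * (2 * (r%:R + (1 - th)^-1)))).
  apply: ler_sum => i _; rewrite -mulr_sumr ler_wpM2l//.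
  apply: (@le_trans _ _ (2 * \sum_(k < N) th ^+ (k - r))).
    by apply: (@sum_dist_le R (fun k => th ^+ (k - r)) N i (ltn_ord i)) => k; exact: ltW.
  by rewrite ler_pM2l// delayed_geometric_sum_le.
rewrite sumr_const card_ord -[leLHS]mulr_natr ler_wpM2r//.
have h1 : 1 <= (1 - th)^-1.
  by rewrite invf_ge1 ?subr_gt0// gerBl ltW.
have h2 : r%:R + (1 - th)^-1 <= (1 - th)^-1 * (1 + r%:R).
  by rewrite mulrDr mulr1 addrC lerD2l ler_peMl.
rewrite (_ : 12 * B / th ^+ m0.+1 / (1 - th) * (1 + r%:R) =
  D * (2 * ((1 - th)^-1 * (1 + r%:R)))); last by rewrite /D; ring.
by rewrite ler_wpM2l// ler_pM2l.
Qed.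

End fields.

(** * Null sets and fourth moments of random fields *)

Section product_null_sets.
Context d1 (T1 : measurableType d1) d2 (T2 : measurableType d2) (R : realType).
Variables (m1 : {sigma_finite_measure set T1 -> \bar R})
          (m2 : {sigma_finite_measure set T2 -> \bar R}).

Lemma ae_prod_fst (Q : T1 -> Prop) :
  {ae m1, forall x, Q x} -> {ae (m1 \x m2)%E, forall z, Q z.1}.
Proof.
move=> [N [mN N0 NQ]]; exists (N `*` setT); split.
- exact: measurableX.
- by rewrite (product_measure1E m1 m2 mN measurableT) [X in (X * _)%E]N0 mul0e.
- by move=> z /= nQ; split => //; exact: NQ.
Qed.

Lemma ae_prod_snd (Q : T2 -> Prop) :
  {ae m2, forall x, Q x} -> {ae (m1 \x m2)%E, forall z, Q z.2}.
Proof.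
move=> [N [mN N0 NQ]]; exists (setT `*` N); split.
- exact: measurableX.
- by rewrite (product_measure1E m1 m2 measurableT mN) [X in (_ * X)%E]N0 mule0.
- by move=> z /= nQ; split => //; exact: NQ.
Qed.

(** Fields that agree along almost every path agree at almost every argument: the
    double integral of the squared difference vanishes in either order. *)
Lemma ae_exchange (U V : T1 * T2 -> R) :
  measurable_fun [set: T1 * T2] U -> measurable_fun [set: T1 * T2] V ->
  {ae m1, forall x, {ae m2, forall y, U (x, y) = V (x, y)}} ->
  {ae m2, forall y, {ae m1, forall x, U (x, y) = V (x, y)}}.
Proof.
move=> mU mV UV.
pose D (z : T1 * T2) := ((U z - V z) ^+ 2)%:E.
have mD : measurable_fun setT D by apply: measurable_sqr; exact: measurable_funB.
have D0 z : (0 <= D z)%E by rewrite lee_fin sqr_ge0.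
have Deq0 z : D z = 0%E -> U z = V z.
  by move=> [] /eqP; rewrite sqrf_eq0 subr_eq0 => /eqP.
have mDG := measurable_fun_fubini_tonelli_G (m1 := m1) D mD D0.
have mDF := measurable_fun_fubini_tonelli_F (m2 := m2) D mD D0.
have iD : (\int[m2]_y \int[m1]_x D (x, y) = 0)%E.
  rewrite -fubini_tonelli//.
  rewrite (ge0_ae_eq_integral (g := cst 0%E))//; first by rewrite integral0.
    by move=> x _; exact: integral_ge0.
  apply: (ae_impl (mu := m1) _ UV) => x Ux _.
  rewrite (ge0_ae_eq_integral (g := cst 0%E))//; first by rewrite integral0.
    exact: (measurableT_comp mD).
  by apply: (ae_impl (mu := m2) _ Ux) => y Uxy _; rewrite /D Uxy subrr expr0n.
have : {ae m2, forall y, (\int[m1]_x D (x, y) = 0)%E}.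
  have /(ae_eq_integral_abs m2 measurableT mDG) H :
      (\int[m2]_y `|fubini_G m1 D y| = 0)%E.
    rewrite -[RHS]iD; apply: eq_integral => y _; rewrite gee0_abs//.
    exact: integral_ge0.
  by apply: (ae_impl (mu := m2) _ H) => y; exact.
apply: (ae_impl (mu := m2)) => y Dy.
have mDy : measurable_fun setT (fun x => D (x, y)).
  by apply: (measurableT_comp mD); exact: pair2_measurable.
have /(ae_eq_integral_abs m1 measurableT mDy) H : (\int[m1]_x `|D (x, y)| = 0)%E.
  by rewrite -[RHS]Dy; apply: eq_integral => x _; rewrite gee0_abs.
by apply: (ae_impl (mu := m1) _ H) => x /(_ I) /Deq0.
Qed.

End product_null_sets.

Section fourth_moments.
Context d (Omega : measurableType d) (R : realType) (P : probability Omega R).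
Context d' (T : measurableType d') (q : {sigma_finite_measure set T -> \bar R}).
Implicit Types (U V : Omega * T -> R) (u v : T -> R).

(** The squared norm in L2, infinite for functions outside L2. Squares, unlike
    norms, are additive in the integrand, so that Fubini's theorem applies. *)
Definition sqnorm u : \bar R := (\int[q]_t ((u t) ^+ 2)%:E)%E.

Definition norm4 U : \bar R :=
  (\int[P]_w (sqnorm (fun t => U (w, t)) * sqnorm (fun t => U (w, t))))%E.

Lemma sqnorm_ge0 u : (0 <= sqnorm u)%E.
Proof. by apply: integral_ge0 => t _; rewrite lee_fin sqr_ge0. Qed.

Lemma measurable_sqnorm U : measurable_fun [set: Omega * T] U ->
  measurable_fun [set: Omega] (fun w => sqnorm (fun t => U (w, t))).
Proof.
move=> mU; apply: (measurable_fun_fubini_tonelli_F (m2 := q)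
  (fun z : Omega * T => ((U z) ^+ 2)%:E)) => //; first exact: measurable_sqr.
by move=> z; rewrite lee_fin sqr_ge0.
Qed.

Lemma measurable_sqnorm2 U : measurable_fun [set: Omega * T] U ->
  measurable_fun [set: Omega]
   (fun w => sqnorm (fun t => U (w, t)) * sqnorm (fun t => U (w, t)))%E.
Proof. by move=> mU; apply: emeasurable_funM; exact: measurable_sqnorm. Qed.

Lemma ae_eq_sqnorm u v : measurable_fun [set: T] u -> measurable_fun [set: T] v ->
  {ae q, forall t, u t = v t} -> sqnorm u = sqnorm v.
Proof.
move=> mu mv uv; apply: ge0_ae_eq_integral => //.
- exact: measurable_sqr.
- exact: measurable_sqr.
- by move=> t _; rewrite lee_fin sqr_ge0.
- by move=> t _; rewrite lee_fin sqr_ge0.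
- by apply: (ae_impl (mu := q) _ uv) => t -> _.
Qed.

Lemma measurable_field1 U w : measurable_fun [set: Omega * T] U ->
  measurable_fun [set: T] (fun t => U (w, t)).
Proof. by move=> mU; apply: (measurableT_comp mU); exact: pair1_measurable. Qed.

Lemma measurable_field2 U t : measurable_fun [set: Omega * T] U ->
  measurable_fun [set: Omega] (fun w => U (w, t)).
Proof. by move=> mU; apply: (measurableT_comp mU); exact: pair2_measurable. Qed.

Lemma ae_eq_norm4 U V :
  measurable_fun [set: Omega * T] U -> measurable_fun [set: Omega * T] V ->
  {ae P, forall w, {ae q, forall t, U (w, t) = V (w, t)}} -> norm4 U = norm4 V.
Proof.
move=> mU mV UV; apply: ge0_ae_eq_integral => //.
- exact: measurable_sqnorm2.
- exact: measurable_sqnorm2.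
- by move=> w _; apply: mule_ge0; exact: sqnorm_ge0.
- by move=> w _; apply: mule_ge0; exact: sqnorm_ge0.
apply: (ae_impl (mu := P) _ UV) => w Uw _.
by rewrite (ae_eq_sqnorm _ _ Uw)//; exact: measurable_field1.
Qed.

Lemma sqnormD_le u v : measurable_fun [set: T] u -> measurable_fun [set: T] v ->
  (sqnorm (u \+ v)%R <= 2%:E * (sqnorm u + sqnorm v))%E.
Proof.
move=> mu mv; rewrite /sqnorm.
have mu2 := measurable_sqr mu; have mv2 := measurable_sqr mv.
have u0 t : (0 <= ((u t) ^+ 2)%:E)%E by rewrite lee_fin sqr_ge0.
have v0 t : (0 <= ((v t) ^+ 2)%:E)%E by rewrite lee_fin sqr_ge0.
rewrite -ge0_integralD// -ge0_integralZl//; last 2 first.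
- exact: emeasurable_funD.
- by move=> t _; exact: adde_ge0.
apply: ge0_le_integral => //.
- by move=> t _; rewrite lee_fin sqr_ge0.
- by apply: measurable_sqr; exact: measurable_funD.
- by apply: measurable_funeM; exact: emeasurable_funD.
move=> t _; rewrite lee_fin /= sqrrD; have := sqr_ge0 (u t - v t).
by rewrite sqrrB; lra.
Qed.

Lemma sqr_adde_le (x y : \bar R) : (0 <= x)%E -> (0 <= y)%E ->
  ((x + y) * (x + y) <= 2%:E * (x * x + y * y))%E.
Proof.
case: x => [x| |]//; case: y => [y| |]// x0 y0.
- by rewrite lee_fin; have := sqr_ge0 (x - y); nra.
- by rewrite /= !mulyy addey// gt0_muley ?leey// lte_fin.
- by rewrite /= !mulyy addye// gt0_muley ?leey// lte_fin.
- by rewrite /= !mulyy gt0_muley ?leey// lte_fin.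
Qed.

Lemma norm4D_le U V :
  measurable_fun [set: Omega * T] U -> measurable_fun [set: Omega * T] V ->
  (norm4 (U \+ V)%R <= 8%:E * (norm4 U + norm4 V))%E.
Proof.
move=> mU mV; rewrite /norm4.
have mu2 := measurable_sqnorm2 mU; have mv2 := measurable_sqnorm2 mV.
have nn (u v : Omega * T -> R) w : (0 <= sqnorm (fun t => u (w, t)) *
  sqnorm (fun t => u (w, t)))%E by apply: mule_ge0; exact: sqnorm_ge0.
have nU := nn U; have nV := nn V.
rewrite -ge0_integralD//; [|by move=> w _; exact: nn..].
rewrite -ge0_integralZl//; last 2 first.
- exact: emeasurable_funD.
- by move=> w _; apply: adde_ge0; exact: nn.
apply: ge0_le_integral => //.
- by move=> w _; exact: mule_ge0 (sqnorm_ge0 _) (sqnorm_ge0 _).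
- by apply: measurable_sqnorm2; exact: measurable_funD.
- by apply: measurable_funeM; exact: emeasurable_funD.
move=> w _; have := sqnormD_le (measurable_field1 w mU) (measurable_field1 w mV).
set x := sqnorm (fun t => U (w, t)); set y := sqnorm (fun t => V (w, t)) => xy.
have x0 : (0 <= x)%E by exact: sqnorm_ge0.
have y0 : (0 <= y)%E by exact: sqnorm_ge0.
apply: (le_trans (lee_pmul _ _ xy xy)); do ?exact: sqnorm_ge0.
rewrite muleACA -EFinM (_ : 8 = 2 * 2 * 2 :> R); last by ring.
rewrite (EFinM (2 * 2) 2) -[leRHS]muleA; apply: lee_wpmul2l; first by rewrite lee_fin.
exact: sqr_adde_le.
Qed.

End fourth_moments.

Lemma norm2_pow4 (R : realType) (u : measurableTypeR R -> R) :
  (norm2 u `^ 4 = sqnorm (leb01 R) u * sqnorm (leb01 R) u)%E.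
Proof.
rewrite (_ : 4 = 2 * 2 :> R); last by ring.
rewrite poweRrM /norm2 poweR_Lnorm//.
have -> : (\int[leb01 R]_x (`|(EFin \o u) x| `^ 2) = sqnorm (leb01 R) u)%E.
  apply: eq_integral => t _.
  rewrite -[`|_|%E]/(`|u t|%:E) poweR_EFin -[2]/(2%:R) powR_mulrn//.
  by rewrite real_normK// num_real.
have := sqnorm_ge0 (leb01 R) u; case: (sqnorm _ _) => [x| |]// x0.
  by rewrite poweR_EFin -[2]/(2%:R) powR_mulrn// -EFinM.
by rewrite poweRyr// mulyy.
Qed.

(** * Coupled versions of the field *)

Section approximable_field.
Context d (Omega : measurableType d) (R : realType) (P : probability Omega R).
Local Notation T := (measurableTypeR R).
Local Notation lam := (leb01 R).

(** What is used of the dependence structure: in [Z m i] the innovations from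
    distance about [m / 2] of [i] on are replaced by copies that serve [i] only. *)
Record approximable_field (th B : R) (m0 : nat) (Y : int -> Omega * T -> R)
    (Z : nat -> int -> Omega * T -> R) : Prop := ApproximableField {
  field_measurable : forall i, measurable_fun [set: Omega * T] (Y i);
  coupling_measurable : forall m i, measurable_fun [set: Omega * T] (Z m i);
  field_norm4 : forall i, (norm4 P lam (Y i) <= B%:E)%E;
  coupling_norm4 : forall m i, (m0 <= m)%N -> (norm4 P lam (Z m i) <= B%:E)%E;
  coupling_dist4 : forall m i, (m0 <= m)%N ->
    (norm4 P lam (Y i \- Z m i)%R <= (B * th ^+ (4 * m))%:E)%E;
  coupling_cov1 : forall m i j t s, (0 < m)%N -> (m <= `|i - j|)%N ->
    sq_int P (fun w => Z m i (w, t)) -> sq_int P (fun w => Z m j (w, s)) ->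
    cov P (fun w => Z m i (w, t)) (fun w => Z m j (w, s)) = 0;
  coupling_cov2 : forall m i1 i2 j1 j2 t s, (0 < m)%N ->
    (m <= `|(i1 - j1)%R|)%N -> (m <= `|(i1 - j2)%R|)%N ->
    (m <= `|(i2 - j1)%R|)%N -> (m <= `|(i2 - j2)%R|)%N ->
    sq_int P (fun w => Z m i1 (w, t) * Z m i2 (w, s)) ->
    sq_int P (fun w => Z m j1 (w, t) * Z m j2 (w, s)) ->
    cov P (fun w => Z m i1 (w, t) * Z m i2 (w, s))
          (fun w => Z m j1 (w, t) * Z m j2 (w, s)) = 0;
  field_stationary : forall i j k, {ae (lam \x lam)%E, forall p : T * T,
    mean P (fun w => Y (k + i) (w, p.1) * Y (k + j) (w, p.2)) =
    mean P (fun w => Y i (w, p.1) * Y j (w, p.2))};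
  field_centered : forall i, {ae lam, forall t, mean P (fun w => Y i (w, t)) = 0}
}.

Section construction.
Context d' (S : measurableType d') (eps : int -> {RV P >-> S})
  (eps' : nat -> int -> int -> {RV P >-> S}) (f : (int -> S) -> L2 R).
Hypothesis eps_iid : iid (all_innovations eps eps').
Variable g : family S int * T -> R.
Hypothesis mg : measurable_fun [set: family S int * T] g.

Local Notation I := (int + nat * int * int)%type.
Local Notation smp := (sample (all_innovations eps eps')).

(** The sequences to which [f] is applied, as functions of the family of all
    innovations, the only random element whose law is known. *)
Definition pick_shifted (i : int) (x : family S I) : family S int :=
  fun k => (x : I -> S) (inl (i - k)).

Definition pick_coupled (m : nat) (i : int) (x : family S I) : family S int :=
  fun k => if (`|k| < maxn m./2 1)%N then (x : I -> S) (inl (i - k))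
           else (x : I -> S) (inr (m, i, i - k)).


Lemma measurable_pick_shifted i :
  measurable_fun [set: family S I] (pick_shifted i).
Proof. by apply: measurable_to_family => k; exact: measurable_coord. Qed.

Lemma measurable_pick_coupled m i :
  measurable_fun [set: family S I] (pick_coupled m i).
Proof.
apply: measurable_to_family => k; rewrite /pick_coupled.
by case: (_ < _)%N; exact: measurable_coord.
Qed.

(** A time shift also moves the index that a copy serves, since copies are not
    shared between indices. *)
Definition shift_index (i : int) (a : I) : I :=
  match a with
  | inl r => inl (r + i)
  | inr (k, j, l) => inr (k, j + i, l + i)
  end.

Lemma shift_index_inj i : injective (shift_index i).
Proof.
by move=> [r|[[k j] l]] [r'|[[k' j'] l']] //= [];
  [move=> /addIr -> | move=> -> /addIr -> /addIr ->].
Qed.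

Lemma pick_shifted_shift i j x :
  pick_shifted j (x \o shift_index i : family S I) = pick_shifted (i + j) x.
Proof. by apply/funext => k; rewrite /pick_shifted /=; congr (x (inl _)); ring. Qed.

Lemma pick_coupled_shift m i j x :
  pick_coupled m j (x \o shift_index i : family S I) = pick_coupled m (i + j) x.
Proof.
apply/funext => k; rewrite /pick_coupled /=; case: ifP => _.
  by congr (x (inl _)); ring.
by rewrite (addrC j i) (_ : j - k + i = i + j - k)//; ring.
Qed.

(** The innovations that enter [coupled m i]: the copies carry the pair [(m, i)],
    so those of distinct [i] are disjoint. *)
Definition coupled_index (m : nat) (i : int) : pred I := fun a =>
  match a with
  | inl r => (`|i - r| < maxn m./2 1)%N
  | inr (k, j, _) => (k == m) && (j == i)
  end.

Lemma coupled_index_dep m i : depends_only_on (coupled_index m i) (pick_coupled m i).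
Proof.
move=> x y xy; apply/funext => k; rewrite /pick_coupled; case: ifP => hk.
  by apply: xy; rewrite /= opprB addrCA subrr addr0.
by apply: xy; rewrite /= !eqxx.
Qed.

Lemma coupled_index_disjoint m i j a : (0 < m)%N -> (m <= `|(i - j)%R|)%N ->
  coupled_index m i a -> ~~ coupled_index m j a.
Proof.
move=> m0 mij; case: a => [r|[[k l] ?]] /=.
  by have := half_double m; rewrite /maxn; case: ifP; lia.
move=> /andP[/eqP -> /eqP ->]; rewrite eqxx /= -subr_eq0 -absz_eq0.
by rewrite -lt0n (leq_trans m0).
Qed.

Definition shifted_field (i : int) (z : Omega * T) : R :=
  g (pick_shifted i (smp z.1), z.2).

Definition coupled_field (m : nat) (i : int) (z : Omega * T) : R :=
  g (pick_coupled m i (smp z.1), z.2).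

Let mg_ (h : family S I -> family S int) : measurable_fun [set: family S I] h ->
  measurable_fun [set: family S I * T] (fun z => g (h z.1, z.2)).
Proof.
move=> mh; apply: (measurableT_comp mg); apply: measurable_fun_pair => //.
exact: (measurableT_comp mh).
Qed.

Let smp_pair : measurable_fun [set: Omega * T] (fun z => (smp z.1, z.2)).
Proof.
apply: measurable_fun_pair => //.
exact: (measurableT_comp (measurable_sample (all_innovations eps eps'))).
Qed.

Lemma measurable_shifted_field i : measurable_fun [set: Omega * T] (shifted_field i).
Proof. exact: (measurableT_comp (mg_ (measurable_pick_shifted i)) smp_pair). Qed.

Lemma measurable_coupled_field m i :
  measurable_fun [set: Omega * T] (coupled_field m i).
Proof. exact: (measurableT_comp (mg_ (measurable_pick_coupled m i)) smp_pair). Qed.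

Let mgt (h : family S I -> family S int) t : measurable_fun [set: family S I] h ->
  measurable_fun [set: family S I] (fun x => g (h x, t)).
Proof.
by move=> mh; exact: (measurableT_comp (mg_ mh) (pair2_measurable t)).
Qed.

Let uncorrelated (J1 J2 : pred I) (u v : family S I -> R) :
  measurable_fun [set: family S I] u -> measurable_fun [set: family S I] v ->
  depends_only_on J1 u -> depends_only_on J2 v ->
  (forall a, J1 a -> ~~ J2 a) ->
  sq_int P (u \o smp) -> sq_int P (v \o smp) -> cov P (u \o smp) (v \o smp) = 0.
Proof.
move=> mu mv u1 v2 J12 su sv.
have iu := sq_intP su; have iv := sq_intP sv.
have vJ : depends_only_on (predC J1) v.
  move=> x y xy; apply: v2 => a J2a; apply: xy => /=; apply: contraL J2a.
  exact: J12.
have := uncorrelated_disjoint eps_iid mu mv u1 vJ iu iv.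
rewrite /cov /mean /Rintegral => ->.
by rewrite fineM ?subrr//; apply: integrable_fin_num.
Qed.

Lemma coupled_field_cov1 m i j t s : (0 < m)%N -> (m <= `|(i - j)%R|)%N ->
  sq_int P (fun w => coupled_field m i (w, t)) ->
  sq_int P (fun w => coupled_field m j (w, s)) ->
  cov P (fun w => coupled_field m i (w, t)) (fun w => coupled_field m j (w, s)) = 0.
Proof.
move=> m0 mij; apply: (@uncorrelated (coupled_index m i) (coupled_index m j)
  (fun x => g (pick_coupled m i x, t)) (fun x => g (pick_coupled m j x, s))).
- by apply: mgt; exact: measurable_pick_coupled.
- by apply: mgt; exact: measurable_pick_coupled.
- by move=> x y /coupled_index_dep ->.
- by move=> x y /coupled_index_dep ->.
- by move=> a; exact: coupled_index_disjoint.
Qed.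

Lemma coupled_field_cov2 m i1 i2 j1 j2 t s : (0 < m)%N ->
  (m <= `|(i1 - j1)%R|)%N -> (m <= `|(i1 - j2)%R|)%N ->
  (m <= `|(i2 - j1)%R|)%N -> (m <= `|(i2 - j2)%R|)%N ->
  sq_int P (fun w => coupled_field m i1 (w, t) * coupled_field m i2 (w, s)) ->
  sq_int P (fun w => coupled_field m j1 (w, t) * coupled_field m j2 (w, s)) ->
  cov P (fun w => coupled_field m i1 (w, t) * coupled_field m i2 (w, s))
        (fun w => coupled_field m j1 (w, t) * coupled_field m j2 (w, s)) = 0.
Proof.
move=> m0 m11 m12 m21 m22.
pose u i j x := g (pick_coupled m i x, t) * g (pick_coupled m j x, s).
apply: (@uncorrelated (predU (coupled_index m i1) (coupled_index m i2))
                      (predU (coupled_index m j1) (coupled_index m j2))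
  (u i1 i2) (u j1 j2)).
- by apply: measurable_funM; apply: mgt; exact: measurable_pick_coupled.
- by apply: measurable_funM; apply: mgt; exact: measurable_pick_coupled.
- move=> x y xy; rewrite /u; congr (g (_, _) * g (_, _)).
    by apply: coupled_index_dep => a ai; apply: xy; rewrite /= ai.
  by apply: coupled_index_dep => a ai; apply: xy; rewrite /= ai orbT.
- move=> x y xy; rewrite /u; congr (g (_, _) * g (_, _)).
    by apply: coupled_index_dep => a ai; apply: xy; rewrite /= ai.
  by apply: coupled_index_dep => a ai; apply: xy; rewrite /= ai orbT.
- move=> a /= /orP[] ai; rewrite negb_or; apply/andP; split;
  exact: coupled_index_disjoint ai.
Qed.

Lemma shifted_field_stationary i j k t s :
  mean P (fun w => shifted_field (k + i) (w, t) * shifted_field (k + j) (w, s)) =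
  mean P (fun w => shifted_field i (w, t) * shifted_field j (w, s)).
Proof.
pose h (x : family S I) := (g (pick_shifted i x, t) * g (pick_shifted j x, s))%:E.
have mh : measurable_fun [set: family S I] h.
  by apply/measurable_EFinP; apply: measurable_funM; apply: mgt;
    exact: measurable_pick_shifted.
rewrite /mean /Rintegral; congr fine.
rewrite -(integral_reindex eps_iid (@shift_index_inj k) mh).
by apply: eq_integral => w _; rewrite /h !pick_shifted_shift.
Qed.

Lemma shifted_field_norm4 i : norm4 P lam (shifted_field i) =
  norm4 P lam (shifted_field 0).
Proof.
pose h (x : family S I) := (sqnorm lam (fun t => g (pick_shifted 0 x, t)) *
   sqnorm lam (fun t => g (pick_shifted 0 x, t)))%E.
have mh : measurable_fun [set: family S I] h.
  by apply: (@measurable_sqnorm2 _ (family S I) R _ T lam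
    (fun z => g (pick_shifted 0 z.1, z.2))); apply: mg_; exact: measurable_pick_shifted.
rewrite /norm4 -[RHS](integral_reindex eps_iid (@shift_index_inj i) mh).
by apply: eq_integral => w _; rewrite /h !pick_shifted_shift addr0.
Qed.

Lemma coupled_field_dist4 m i :
  norm4 P lam (shifted_field i \- coupled_field m i) =
  norm4 P lam (shifted_field 0 \- coupled_field m 0).
Proof.
pose k (z : family S I * T) :=
  g (pick_shifted 0 z.1, z.2) - g (pick_coupled m 0 z.1, z.2).
pose h (x : family S I) := (sqnorm lam (fun t => k (x, t)) *
   sqnorm lam (fun t => k (x, t)))%E.
have mh : measurable_fun [set: family S I] h.
  apply: (@measurable_sqnorm2 _ (family S I) R _ T lam k); apply: measurable_funB.
    by apply: mg_; exact: measurable_pick_shifted.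
  by apply: mg_; exact: measurable_pick_coupled.
rewrite /norm4 -[RHS](integral_reindex eps_iid (@shift_index_inj i) mh).
apply: eq_integral => w _; rewrite /h.
have -> // : (fun t => (shifted_field i \- coupled_field m i) (w, t)) =
    (fun t => k (smp w \o shift_index i : family S I, t)).
apply/funext => t.
by rewrite /k pick_shifted_shift pick_coupled_shift addr0.
Qed.

End construction.
End approximable_field.

Section approximable_sequence.
Context d (Omega : measurableType d) (R : realType) (P : probability Omega R).
Local Notation T := (measurableTypeR R).
Local Notation lam := (leb01 R).

Definition field_of (Y : int -> Omega -> L2 R) (i : int) (z : Omega * T) : R :=
  Y i z.1 z.2.

Lemma norm4_field_of (u : Omega -> T -> R) (U : Omega * T -> R) :
  (forall w, {ae lam, forall t, U (w, t) = u w t}) ->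
  (forall w, measurable_fun [set: T] (u w)) ->
  measurable_fun [set: Omega * T] U ->
  norm4 P lam U = (\int[P]_w (norm2 (u w) `^ 4))%E.
Proof.
move=> Uu mu mU; apply: eq_integral => w _; rewrite norm2_pow4.
by rewrite (ae_eq_sqnorm _ _ (Uu w))//; exact: measurable_field1.
Qed.

Lemma poweR_le_root (x : \bar R) (r : R) : (0 <= x)%E ->
  (x `^ 4^-1 <= r%:E)%E -> (x <= (r ^+ 4)%:E)%E.
Proof.
move=> x0 xr; have r0 : 0 <= r.
  by rewrite -lee_fin (le_trans _ xr)// poweR_ge0.
have := @gt0_ler_poweR R 4 ltac:(by []) (x `^ 4^-1)%E r%:E.
rewrite !in_itv/= !poweR_ge0 !leey lee_fin r0 => /(_ isT isT xr).
rewrite -poweRrM mulVf// poweRe1//.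
by rewrite (powR_mulrn 4 r0).
Qed.

(** The moment bounds of the definition concern the index 0; the stationarity of
    the innovations transfers them to all indices. *)
Lemma approximable_fieldP (Y : int -> Omega -> L2 R) (c : R) : 0 < c ->
  centered P Y -> Lm_approximable P 4 (fun m => expR (- c * m%:R)) Y ->
  exists B m0 (Z : nat -> int -> Omega * T -> R),
    0 <= B /\ approximable_field P (expR (- c)) B m0 (field_of Y) Z.
Proof.
move=> c0 Y0 [_ _ Y4 [d' [S [eps [eps' [f [eiid mf Yf [C YC]]]]]]] mY].
have [g mg gf] := @L2_version R _ (family S int) f mf.
set th := expR (- c).
have th0 : 0 < th by exact: expR_gt0.
have th1 : th < 1 by rewrite /th -expR0 ltr_expR oppr_lt0.
have mYf i : measurable_fun [set: Omega * T] (field_of Y i).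
  have mswap : measurable_fun [set: Omega * T] (fun z => (z.2, z.1)).
    by apply: measurable_fun_pair.
  exact: (measurableT_comp (mY i) mswap).
pose V := shifted_field eps eps' g.
pose Z := coupled_field eps eps' g.
have mV i : measurable_fun [set: Omega * T] (V i) by exact: measurable_shifted_field.
have mZ m i : measurable_fun [set: Omega * T] (Z m i).
  exact: measurable_coupled_field.
have YV i : {ae P, forall w, {ae lam, forall t, field_of Y i (w, t) = V i (w, t)}}.
  apply: (ae_impl (mu := P) _ (Yf i)) => w Yw.
  have Yw' : {ae lam, forall t, Y i w t = f (shifted eps i w) t}.
    by apply: (ae_impl (mu := leb01 R) _ Yw) => t /(_ I).
  apply: (ae_impl (mu := leb01 R) _ (ae_and (mu := leb01 R) Yw'
    (gf (pick_shifted i (sample (all_innovations eps eps') w))))) => t [h1 h2].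
  by rewrite /field_of /= h1 /V /shifted_field /= h2.
have n4Y i : norm4 P lam (field_of Y i) = norm4 P lam (V i).
  by apply: ae_eq_norm4.
have n4V i : norm4 P lam (V i) = norm4 P lam (V 0) by exact: shifted_field_norm4.
have Yf0 w : {ae lam, forall t, field_of Y 0 (w, t) = Y 0 w t}.
  exact: (aeW (leb01 R)).
have n4Y0 : norm4 P lam (field_of Y 0) = (\int[P]_w (norm2 (Y 0%R w) `^ 4))%E.
  apply: norm4_field_of => [w|w|//]; last exact: (measurable_funPT (Y 0 w)).
  exact: Yf0.
have n4D m i : norm4 P lam (field_of Y i \- Z m i) =
    (\int[P]_w (norm2 (Y 0%R w \- f (coupled eps eps' m 0%R w))%R `^ 4))%E.
  transitivity (norm4 P lam (V i \- Z m i)).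
    apply: ae_eq_norm4; do ?exact: measurable_funB.
    apply: (ae_impl (mu := P) _ (YV i)) => w Yw.
    by apply: (ae_impl (mu := leb01 R) _ Yw) => t /= ->.
  rewrite coupled_field_dist4//.
  transitivity (norm4 P lam (field_of Y 0 \- Z m 0)).
    apply: ae_eq_norm4; do ?exact: measurable_funB.
    apply: (ae_impl (mu := P) _ (YV 0)) => w Yw.
    by apply: (ae_impl (mu := leb01 R) _ Yw) => t /= ->.
  apply: norm4_field_of.
  - move=> w.
    apply: (ae_impl (mu := leb01 R) _
      (gf (pick_coupled m 0 (sample (all_innovations eps eps') w)))) => t gt.
    by rewrite /= /Z /coupled_field gt.
  - by move=> w; apply: measurable_funB; exact: measurable_funPT.
  - exact: measurable_funB.
have [m0 _ m0C] := YC.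
have n4_ge0 (U : Omega * T -> R) : (0 <= norm4 P lam U)%E.
  by apply: integral_ge0 => w _; exact: mule_ge0 (sqnorm_ge0 _ _) (sqnorm_ge0 _ _).
have n4Dle m i : (m0 <= m)%N ->
    (norm4 P lam (field_of Y i \- Z m i)%R <= (C ^+ 4 * th ^+ (4 * m))%:E)%E.
  move=> mm0; rewrite n4D.
  have -> : C ^+ 4 * th ^+ (4 * m) = (C * expR (- c * m%:R)) ^+ 4.
    by rewrite exprMn mulnC exprM /th -expRM_natr.
  apply: poweR_le_root; first by apply: integral_ge0 => w _; exact: poweR_ge0.
  exact: m0C.
pose A := fine (norm4 P lam (V 0)).
have AE i : norm4 P lam (field_of Y i) = A%:E.
  rewrite n4Y n4V /A fineK// ge0_fin_numE//.
  by rewrite -n4Y n4Y0.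
have A0 : 0 <= A by exact: fine_ge0.
have C40 : 0 <= C ^+ 4 by rewrite -[4%N]/(2 * 2)%N exprM sqr_ge0.
exists (8 * (A + C ^+ 4)), m0, Z; split; first by rewrite mulr_ge0// addr_ge0.
split => //.
- by move=> i; rewrite AE lee_fin; lra.
- move=> m i mm0.
  have -> : Z m i = field_of Y i \+ (Z m i \- field_of Y i).
    by apply/funext => z /=; rewrite addrC subrK.
  apply: (le_trans (norm4D_le _ _ _ _)) => //; first exact: measurable_funB.
  rewrite EFinM; apply: lee_wpmul2l; first by rewrite lee_fin.
  rewrite EFinD; apply: leeD; first by rewrite AE.
  have -> : norm4 P lam (Z m i \- field_of Y i) = norm4 P lam (field_of Y i \- Z m i).
    apply: eq_integral => w _.
    by congr (_ * _)%E; apply: eq_integral => t _ /=; rewrite -sqrrN opprB.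
  apply: (le_trans (n4Dle m i mm0)); rewrite lee_fin ler_piMr//.
  by apply: exprn_ile1; exact: ltW.
- move=> m i mm0; apply: (le_trans (n4Dle m i mm0)); rewrite lee_fin ler_wpM2r//.
    by rewrite exprn_ge0// ltW.
  by lra.
- by move=> m i j t s m_gt0 mij; exact: coupled_field_cov1.
- by move=> m i1 i2 j1 j2 t s m_gt0 *; exact: coupled_field_cov2.
- move=> i j k.
  have YVt l : {ae lam, forall t, {ae P, forall w, field_of Y l (w, t) = V l (w, t)}}.
    exact: (ae_exchange (m1 := P) (m2 := leb01 R)).
  have mean_eq (l1 l2 : int) (p : T * T) :
      {ae P, forall w, field_of Y l1 (w, p.1) = V l1 (w, p.1)} ->
      {ae P, forall w, field_of Y l2 (w, p.2) = V l2 (w, p.2)} ->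
      mean P (fun w => field_of Y l1 (w, p.1) * field_of Y l2 (w, p.2)) =
      mean P (fun w => V l1 (w, p.1) * V l2 (w, p.2)).
    move=> e1 e2; congr fine; apply: ae_eq_integral => //.
    + apply/measurable_EFinP; apply: measurable_funM; exact: measurable_field2.
    + apply/measurable_EFinP; apply: measurable_funM; exact: measurable_field2.
    + by apply: (ae_impl (mu := P) _ (ae_and (mu := P) e1 e2)) => w [-> ->].
  have H1 l := ae_prod_fst (leb01 R) (m1 := leb01 R) (YVt l).
  have H2 l := ae_prod_snd (leb01 R) (m2 := leb01 R) (YVt l).
  have H := ae_and (mu := (leb01 R \x leb01 R)%E) (ae_and (mu := (leb01 R \x leb01 R)%E) (H1 (k + i)) (H2 (k + j)))
      (ae_and (mu := (leb01 R \x leb01 R)%E) (H1 i) (H2 j)).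
  apply: (ae_impl (mu := (leb01 R \x leb01 R)%E) _ H) => p [[h1 h2] [h3 h4]].
  by rewrite !mean_eq// shifted_field_stationary.
- move=> i; apply: (ae_impl (mu := leb01 R) _ (Y0 i)) => t.
  by rewrite unlock /mean /Rintegral => ->.
Qed.

End approximable_sequence.

(** * Mean square estimates for sums of products *)

(** A named copy of the product measure, for which an instance of finite measure
    can be declared. *)
Definition leb2 (R : realType) :
    set (measurableTypeR R * measurableTypeR R) -> \bar R :=
  (leb01 R \x leb01 R)%E.
Arguments leb2 : clear implicits.

HB.instance Definition _ (R : realType) := Measure.on (leb2 R).

Fact leb2_fin_num (R : realType) : fin_num_fun (leb2 R).
Proof.
move=> A mA; rewrite ge0_fin_numE//.
apply: (@le_lt_trans _ _ (leb2 R (setT `*` setT))).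
  by apply: le_measure; rewrite ?inE// setXTT.
rewrite /leb2 product_measure1E// lte_mul_pinfty//.
  exact: fin_num_measure.
by have := fin_num_measure (leb01 R) _ (@measurableT _ (measurableTypeR R));
  rewrite ge0_fin_numE.
Qed.

HB.instance Definition _ (R : realType) :=
  @Measure_isFinite.Build _ _ R (leb2 R) (@leb2_fin_num R).

Section tensor_products.
Context d (Omega : measurableType d) (R : realType) (P : probability Omega R).
Local Notation T := (measurableTypeR R).
Local Notation lam := (leb01 R).
Local Notation lam2 := (leb2 R).

Definition tensor (U V : Omega * T -> R) (z : Omega * (T * T)) : R :=
  U (z.1, z.2.1) * V (z.1, z.2.2).

Lemma measurable_tensor U V :
  measurable_fun [set: Omega * T] U -> measurable_fun [set: Omega * T] V ->
  measurable_fun [set: Omega * (T * T)] (tensor U V).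
Proof.
move=> mU mV; apply: measurable_funM.
  apply: (measurableT_comp mU); apply: measurable_fun_pair => //.
  exact: (measurableT_comp measurable_fst measurable_snd).
apply: (measurableT_comp mV); apply: measurable_fun_pair => //.
exact: (measurableT_comp measurable_snd measurable_snd).
Qed.

Lemma field_norm2E d' (Th : measurableType d')
    (q : {sigma_finite_measure set Th -> \bar R}) (U : Omega * Th -> R) :
  measurable_fun [set: Omega * Th] U ->
  (field_norm2 P q U = \int[P]_w sqnorm q (fun t => U (w, t)))%E.
Proof.
move=> mU; apply/esym/(fubini_tonelli (m1 := P) (m2 := q)
  (fun z : Omega * Th => ((U z) ^+ 2)%:E)); first exact: measurable_sqr.
by move=> z; rewrite lee_fin sqr_ge0.
Qed.

Lemma field_norm2_ge0 d' (Th : measurableType d')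
    (q : {sigma_finite_measure set Th -> \bar R}) (U : Omega * Th -> R) :
  (0 <= field_norm2 P q U)%E.
Proof. by apply: integral_ge0 => t _; exact: moment2_ge0. Qed.

Lemma field_norm2D_le d' (Th : measurableType d')
    (q : {sigma_finite_measure set Th -> \bar R}) (U V : Omega * Th -> R) :
  measurable_fun [set: Omega * Th] U -> measurable_fun [set: Omega * Th] V ->
  (field_norm2 P q (U \+ V)%R <= 2%:E * (field_norm2 P q U + field_norm2 P q V))%E.
Proof.
move=> mU mV; rewrite !field_norm2E//; last exact: measurable_funD.
have nn (u : Omega * Th -> R) w : (0 <= sqnorm q (fun t => u (w, t)))%E.
  exact: sqnorm_ge0.
have mu2 := measurable_sqnorm q mU; have mv2 := measurable_sqnorm q mV.
rewrite -ge0_integralD// -ge0_integralZl//; last 2 first.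
- exact: emeasurable_funD.
- by move=> w _; apply: adde_ge0.
apply: ge0_le_integral => //.
- by apply: measurable_sqnorm; exact: measurable_funD.
- by apply: measurable_funeM; exact: emeasurable_funD.
move=> w _; apply: sqnormD_le; exact: measurable_field1.
Qed.

Lemma sqnorm_tensor (u v : T -> R) :
  measurable_fun [set: T] u -> measurable_fun [set: T] v ->
  (sqnorm lam2 (fun p : T * T => (u p.1 * v p.2)%R) = sqnorm lam u * sqnorm lam v)%E.
Proof.
move=> mu mv; have mu2 := measurable_sqr mu; have mv2 := measurable_sqr mv.
rewrite /sqnorm (fubini_tonelli1 (m1 := lam) (m2 := lam)
  (fun p : T * T => ((u p.1 * v p.2) ^+ 2)%:E)).
- rewrite -ge0_integralZr//; last 2 first.
    by move=> t _; rewrite lee_fin sqr_ge0.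
    by apply: integral_ge0 => t _; rewrite lee_fin sqr_ge0.
  apply: eq_integral => t _; rewrite /fubini_F /= -ge0_integralZl//; last 2 first.
    by move=> s _; rewrite lee_fin sqr_ge0.
    by rewrite lee_fin sqr_ge0.
  by apply: eq_integral => s _; rewrite exprMn EFinM.
- apply: measurable_sqr; apply: measurable_funM.
    exact: (measurableT_comp mu).
  exact: (measurableT_comp mv).
- by move=> p; rewrite lee_fin sqr_ge0.
Qed.

Lemma mule_amgm (a : R) (x y : \bar R) : 0 < a -> (0 <= x)%E -> (0 <= y)%E ->
  (x * y <= a%:E * (x * x) + a^-1%:E * (y * y))%E.
Proof.
move=> a0; have ai0 : 0 < a^-1 by rewrite invr_gt0.
case: x => [x| |]//; case: y => [y| |]// x0 y0.
- rewrite lee_fin; have := sqr_ge0 (a * x - y / 2) => h.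
  rewrite -(ler_pM2l a0) -subr_ge0.
  have -> : a * (a * (x * x) + a^-1 * (y * y)) - a * (x * y) =
    (a * x - y / 2) ^+ 2 + 3 / 4 * y ^+ 2 by field; exact: lt0r_neq0.
  by rewrite addr_ge0// mulr_ge0// sqr_ge0.
- by rewrite mulyy [X in (_ <= _ + X)%E]gt0_muley ?lte_fin// addey ?leey.
- by rewrite mulyy [X in (_ <= X + _)%E]gt0_muley ?lte_fin// addye ?leey.
- by rewrite mulyy !gt0_muley ?lte_fin.
Qed.

(** Fourth moments control products. The free weight [a] allows to balance a small
    factor against a bounded one. *)
Lemma tensor_norm2_le (a A D : R) U V : 0 < a ->
  measurable_fun [set: Omega * T] U -> measurable_fun [set: Omega * T] V ->
  (norm4 P lam U <= A%:E)%E -> (norm4 P lam V <= D%:E)%E ->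
  (field_norm2 P lam2 (tensor U V) <= (a * A + a^-1 * D)%:E)%E.
Proof.
move=> a0 mU mV UA VD; rewrite field_norm2E; last exact: measurable_tensor.
have ai0 : 0 < a^-1 by rewrite invr_gt0.
have nn (u : Omega * T -> R) w : (0 <= sqnorm lam (fun t => u (w, t)))%E.
  exact: sqnorm_ge0.
have nn2 (u : Omega * T -> R) w : (0 <= sqnorm lam (fun t => u (w, t)) *
  sqnorm lam (fun t => u (w, t)))%E by exact: mule_ge0.
have mU2 := measurable_sqnorm2 lam mU; have mV2 := measurable_sqnorm2 lam mV.
apply: (@le_trans _ _ (a%:E * norm4 P lam U + a^-1%:E * norm4 P lam V)%E); last first.
  rewrite EFinD !EFinM; apply: leeD; apply: lee_wpmul2l => //; rewrite lee_fin;
  exact: ltW.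
have Zn (b : R) (W : Omega * T -> R) : 0 < b -> measurable_fun setT W ->
    (b%:E * norm4 P lam W = \int[P]_w (b%:E * (sqnorm lam (fun t => W (w, t)) *
      sqnorm lam (fun t => W (w, t)))))%E.
  move=> b0 mW; rewrite ge0_integralZl//; last by rewrite lee_fin ltW.
  exact: measurable_sqnorm2.
rewrite !Zn//.
rewrite -ge0_integralD//; first last.
- exact: measurable_funeM.
- by move=> w _; apply: mule_ge0; [rewrite lee_fin ltW|exact: nn2].
- exact: measurable_funeM.
- by move=> w _; apply: mule_ge0; [rewrite lee_fin ltW|exact: nn2].
apply: ge0_le_integral => //.
- by move=> w _; exact: sqnorm_ge0.
- by apply: measurable_sqnorm; exact: measurable_tensor.
- by apply: emeasurable_funD; exact: measurable_funeM.
move=> w _; rewrite (sqnorm_tensor (measurable_field1 w mU) (measurable_field1 w mV)).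
exact: mule_amgm.
Qed.

Lemma norm2_le_norm4 (a A : R) U : 0 < a ->
  measurable_fun [set: Omega * T] U -> (norm4 P lam U <= A%:E)%E ->
  (field_norm2 P lam U <= (a + a^-1 * A)%:E)%E.
Proof.
move=> a0 mU UA; rewrite field_norm2E//.
have ai0 : 0 < a^-1 by rewrite invr_gt0.
have mU2 := measurable_sqnorm2 lam mU.
have nn2 w : (0 <= sqnorm lam (fun t => U (w, t)) * sqnorm lam (fun t => U (w, t)))%E.
  by apply: mule_ge0; exact: sqnorm_ge0.
apply: (@le_trans _ _ (\int[P]_w (a%:E + a^-1%:E *
    (sqnorm lam (fun t => U (w, t)) * sqnorm lam (fun t => U (w, t)))))%E).
  apply: ge0_le_integral => //.
  - by move=> w _; exact: sqnorm_ge0.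
  - exact: measurable_sqnorm.
  - by apply: emeasurable_funD => //; exact: measurable_funeM.
  move=> w _; have := @mule_amgm a^-1 (sqnorm lam (fun t => U (w, t))) 1%E ai0
    (sqnorm_ge0 _ _) ltac:(by []).
  by rewrite !mule1 invrK addeC.
rewrite ge0_integralD//; first last.
- exact: measurable_funeM.
- by move=> w _; apply: mule_ge0; [rewrite lee_fin ltW|exact: nn2].
- by move=> w _; rewrite lee_fin ltW.
rewrite integral_cst//= probability_setT mule1 EFinD; apply: leeD => //.
rewrite ge0_integralZl//; last by rewrite lee_fin ltW.
by rewrite EFinM; apply: lee_wpmul2l => //; rewrite lee_fin ltW.
Qed.

End tensor_products.

Section weak_dependence.
Context d (Omega : measurableType d) (R : realType) (P : probability Omega R).
Local Notation T := (measurableTypeR R).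
Local Notation lam := (leb01 R).
Local Notation lam2 := (leb2 R).
Variables (th B : R) (m0 : nat) (Y : int -> Omega * T -> R)
  (Z : nat -> int -> Omega * T -> R).
Hypotheses (th0 : 0 < th) (th1 : th < 1) (B0 : 0 <= B).
Hypothesis YZ : approximable_field P th B m0 Y Z.

Let mY := field_measurable YZ.
Let mZ := coupling_measurable YZ.

Let mYY i j : measurable_fun [set: Omega * (T * T)] (tensor (Y i) (Y j)).
Proof. exact: measurable_tensor. Qed.

Let mZZ m i j : measurable_fun [set: Omega * (T * T)] (tensor (Z m i) (Z m j)).
Proof. exact: measurable_tensor. Qed.

Let thm_gt0 m : 0 < th ^+ m. Proof. exact: exprn_gt0. Qed.

Lemma tensor_field_norm2 i j : (field_norm2 P lam2 (tensor (Y i) (Y j)) <= (2 * B)%:E)%E.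
Proof.
have := tensor_norm2_le (@ltr01 R) (mY i) (mY j) (field_norm4 YZ i) (field_norm4 YZ j).
by rewrite invr1 !mul1r mulr2n mulrDl mul1r.
Qed.

Lemma tensor_coupling_norm2 m i j : (m0 <= m)%N ->
  (field_norm2 P lam2 (tensor (Z m i) (Z m j)) <= (2 * B)%:E)%E.
Proof.
move=> mm.
have := tensor_norm2_le (@ltr01 R) (mZ m i) (mZ m j)
  (coupling_norm4 YZ i mm) (coupling_norm4 YZ j mm).
by rewrite invr1 !mul1r mulr2n mulrDl mul1r.
Qed.

Let th4 m : (th ^+ (2 * m))^-1 * (B * th ^+ (4 * m)) = B * th ^+ (2 * m).
Proof.
rewrite (_ : (4 * m = 2 * m + 2 * m)%N); last by lia.
by rewrite exprD; field; exact: lt0r_neq0.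
Qed.

Lemma tensor_coupling_dist m i j : (m0 <= m)%N ->
  (field_norm2 P lam2 (tensor (Y i) (Y j) \- tensor (Z m i) (Z m j))%R <=
   (8 * B * th ^+ (2 * m))%:E)%E.
Proof.
move=> mm.
have -> : tensor (Y i) (Y j) \- tensor (Z m i) (Z m j) =
    tensor (Y i \- Z m i) (Y j) \+ tensor (Z m i) (Y j \- Z m j).
  by apply/funext => z; rewrite /tensor /=; ring.
have mD k : measurable_fun [set: Omega * T] (Y k \- Z m k) by exact: measurable_funB.
apply: (le_trans (field_norm2D_le _ _ _ _)); do ?exact: measurable_tensor.
(* with these weights all terms are of order [th ^ (2 m)] *)
have h1 := tensor_norm2_le (a := (th ^+ (2 * m))^-1) _ (mD i) (mY j)
  (coupling_dist4 YZ i mm) (field_norm4 YZ j).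
have h2 := tensor_norm2_le (a := th ^+ (2 * m)) (thm_gt0 _) (mZ m i) (mD j)
  (coupling_norm4 YZ i mm) (coupling_dist4 YZ j mm).
rewrite (_ : 8 * B * th ^+ (2 * m) = 2 * (4 * B * th ^+ (2 * m))); last by ring.
rewrite EFinM; apply: lee_wpmul2l; first by rewrite lee_fin.
apply: (le_trans (leeD (h1 _) h2)); first by rewrite invr_gt0.
rewrite -EFinD lee_fin th4 invrK le_eqVlt; apply/orP; left; apply/eqP; ring.
Qed.

(** Two products are separated once their indices are more than [|a - b|] apart,
    whence the factor [1 + |a - b|]. *)
Lemma autocov_var (a b N : nat) :
  (\int[lam2]_p moment2 P (fun w => (\sum_(i < N)
      (tensor (Y (i + a)%N) (Y (i + b)%N) (w, p) -
       mean P (fun w' => tensor (Y (i + a)%N) (Y (i + b)%N) (w', p))))%R) <=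
   (12 * (8 * B) / th ^+ m0.+1 / (1 - th) * (1 + ((a - b) + (b - a))%N%:R) * N%:R)%:E)%E.
Proof.
apply: (@field_var_sum _ _ R P _ _ lam2 th (8 * B) m0 _ N
  (fun i : nat => tensor (Y (i + a)%N) (Y (i + b)%N))
  (fun m (i : nat) => tensor (Z m (i + a)%N) (Z m (i + b)%N))) => //.
- by rewrite mulr_ge0.
- by move=> i; apply: (le_trans (tensor_field_norm2 _ _)); rewrite lee_fin ler_wpM2r// ler_nat.
- move=> m i mm; apply: (le_trans (tensor_coupling_norm2 _ _ mm)).
  by rewrite lee_fin ler_wpM2r// ler_nat.
- by move=> m i; exact: tensor_coupling_dist.
- move=> m i j p mgt0 mij s1 s2; apply: (coupling_cov2 YZ mgt0 _ _ _ _ s1 s2); lia.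
Qed.

Lemma field_norm2_Y i : (field_norm2 P lam (Y i) <= (1 + B)%:E)%E.
Proof.
have := norm2_le_norm4 (@ltr01 R) (mY i) (field_norm4 YZ i).
by rewrite invr1 mul1r.
Qed.

Lemma field_norm2_Z m i : (m0 <= m)%N -> (field_norm2 P lam (Z m i) <= (1 + B)%:E)%E.
Proof.
move=> mm; have := norm2_le_norm4 (@ltr01 R) (mZ m i) (coupling_norm4 YZ i mm).
by rewrite invr1 mul1r.
Qed.

Lemma field_norm2_YZ m i : (m0 <= m)%N ->
  (field_norm2 P lam (Y i \- Z m i)%R <= ((1 + B) * th ^+ (2 * m))%:E)%E.
Proof.
move=> mm; have mD : measurable_fun [set: Omega * T] (Y i \- Z m i).
  exact: measurable_funB.
have := norm2_le_norm4 (thm_gt0 (2 * m)) mD (coupling_dist4 YZ i mm).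
by rewrite th4 mulrDl mul1r.
Qed.

(** The factors themselves are centered, so that here the means are not
    subtracted. *)
Lemma sum_var (a N : nat) :
  (\int[lam]_t moment2 P (fun w => (\sum_(i < N) Y (i + a)%N (w, t))%R) <=
   (12 * (1 + B) / th ^+ m0.+1 / (1 - th) * N%:R)%:E)%E.
Proof.
have := @field_var_sum _ _ R P _ _ lam th (1 + B) m0 0%N N
  (fun i : nat => Y (i + a)%N) (fun m (i : nat) => Z m (i + a)%N) th0 th1.
rewrite addr0 mulr1 => H; apply: le_trans (H _ _ _ _ _ _ _) => //.
- have cent : {ae lam, forall t, forall i : nat, mean P (fun w => Y (i + a)%N (w, t)) = 0}.
    by apply: ae_foralln => i; exact: (field_centered YZ).
  rewrite le_eqVlt; apply/orP; left; apply/eqP; apply: ge0_ae_eq_integral => //.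
  + apply: (@measurable_moment2 _ Omega R P _ T (fun z => \sum_(i < N) Y (i + a)%N z)).
    by apply: measurable_sum => i.
  + apply: (@measurable_moment2 _ Omega R P _ T (fun z => \sum_(i < N) (Y (i + a)%N z
      - mean P (fun w' => Y (i + a)%N (w', z.2))))).
    apply: measurable_sum => i; apply: measurable_funB => //.
    exact: (measurableT_comp (measurable_mean P (mY (i + a)%N))).
  + by move=> t _; exact: moment2_ge0.
  + by move=> t _; exact: moment2_ge0.
  apply: (ae_impl (mu := leb01 R) _ cent) => t ct _; congr moment2.
  by apply/funext => w; apply: eq_bigr => i _; rewrite ct subr0.
- by rewrite addr_ge0.
- by move=> i; exact: field_norm2_Y.
- by move=> m i; exact: field_norm2_Z.
- by move=> m i; exact: field_norm2_YZ.
- by move=> m i j t mgt0 mij s1 s2; apply: (coupling_cov1 YZ mgt0 _ s1 s2); lia.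
Qed.

Definition zeta (r : int) (p : T * T) : R :=
  mean P (fun w => tensor (Y 0) (Y r) (w, p)).

Lemma measurable_zeta r : measurable_fun [set: T * T] (zeta r).
Proof. exact: measurable_mean (mYY 0 r). Qed.

Lemma ae_moment2_lty d' (Th : measurableType d')
    (q : {sigma_finite_measure set Th -> \bar R}) (U : Omega * Th -> R) (A : R) :
  measurable_fun [set: Omega * Th] U -> (field_norm2 P q U <= A%:E)%E ->
  {ae q, forall t, sq_int P (fun w => U (w, t))}.
Proof.
move=> mU UA; have mm := measurable_moment2 P mU.
have : q.-integrable setT (fun t => moment2 P (fun w => U (w, t))).
  apply/integrableP; split => //; apply: le_lt_trans (ltry A); apply: le_trans UA.
  by apply: ge0_le_integral => //; [exact: measurableT_comp|
    move=> t _; rewrite gee0_abs ?moment2_ge0].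
move=> /(integrable_ae measurableT); apply: (ae_impl (mu := q)) => t /(_ I) Ut.
by split; [exact: measurable_field2|rewrite -ge0_fin_numE ?moment2_ge0].
Qed.

Lemma zeta_norm2_trivial r : (sqnorm lam2 (zeta r) <= (2 * B)%:E)%E.
Proof.
apply: le_trans (tensor_field_norm2 0 r).
have sq := ae_moment2_lty (mYY 0 r) (tensor_field_norm2 0 r).
apply: ae_ge0_le_integral => //.
- by move=> p _; rewrite lee_fin sqr_ge0.
- by apply: measurable_sqr; exact: measurable_zeta.
- by move=> p _; exact: moment2_ge0.
- exact: measurable_moment2.
apply: (ae_impl (mu := lam2) _ sq) => p sp _.
by rewrite moment2E// lee_fin; exact: mean_sqr_le.
Qed.

Lemma zeta_norm2_coupling r : (m0 < `|r|)%N ->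
  (sqnorm lam2 (zeta r) <= ((16 * B + 2 * (1 + B) ^+ 2) * th ^+ (2 * `|r|))%:E)%E.
Proof.
set m := `|r|%N => m0m; have mm : (m0 <= m)%N by exact: ltnW.
pose E := tensor (Y 0) (Y r) \- tensor (Z m 0) (Z m r).
have mE : measurable_fun [set: Omega * (T * T)] E by exact: measurable_funB.
pose F := Y 0 \- Z m 0.
have mF : measurable_fun [set: Omega * T] F by exact: measurable_funB.
have sA := ae_moment2_lty (mYY 0 r) (tensor_field_norm2 0 r).
have sA' := ae_moment2_lty (mZZ m 0 r) (tensor_coupling_norm2 0 r mm).
have sZ i := ae_moment2_lty (mZ m i) (field_norm2_Z i mm).
have sY := ae_moment2_lty (mY 0) (field_norm2_Y 0).
have cY := field_centered YZ 0.
pose f t := moment2 P (fun w => F (w, t)).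
pose g s := moment2 P (fun w => Z m r (w, s)).
have mf : measurable_fun setT f by exact: measurable_moment2.
have mg : measurable_fun setT g by exact: measurable_moment2.
have f0 t : (0 <= f t)%E by exact: moment2_ge0.
have g0 t : (0 <= g t)%E by exact: moment2_ge0.
have mfg : measurable_fun setT (fun p : T * T => f p.1 * g p.2)%E.
  by apply: emeasurable_funM; [exact: (measurableT_comp mf)|exact: (measurableT_comp mg)].
have fg0 (p : T * T) : (0 <= f p.1 * g p.2)%E by exact: mule_ge0.
have mEE : measurable_fun setT (fun p => moment2 P (fun w => E (w, p))).
  exact: measurable_moment2.
have ptw : {ae lam2, forall p : T * T, (((zeta r p) ^+ 2)%:E <=
    2%:E * (moment2 P (fun w => E (w, p)) + f p.1 * g p.2))%E}.
  have H1 := ae_prod_fst (leb01 R) (m1 := leb01 R)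
    (ae_and (mu := leb01 R) (ae_and (mu := leb01 R) sY (sZ 0)) cY).
  have H2 := ae_prod_snd (leb01 R) (m2 := leb01 R) (sZ r).
  have H := ae_and (mu := leb2 R) (ae_and (mu := leb2 R) sA sA')
    (ae_and (mu := leb2 R) H1 H2).
  apply: (ae_impl (mu := leb2 R) _ H) => -[t s] [[A2 A'2] [[[Y2 Z2] Y0] Zr2]] /=.
  have F2 := sq_intB Y2 Z2; have E2 := sq_intB A2 A'2.
  rewrite /f /g !moment2E//= lee_fin.
  have zE : zeta r (t, s) = mean P (fun w => E (w, (t, s))) -
      mean P (fun w => F (w, t)) * mean P (fun w => Z m r (w, s)).
    have -> : mean P (fun w => F (w, t)) = - mean P (fun w => Z m 0 (w, t)).
      by rewrite [LHS]meanB ?sq_intP// Y0 sub0r.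
    rewrite [mean P (fun w => E _)]meanB ?sq_intP// mulNr opprK.
    have : cov P (fun w => Z m 0 (w, t)) (fun w => Z m r (w, s)) = 0.
      by apply: (coupling_cov1 YZ) => //; rewrite ?sub0r ?abszN// (leq_ltn_trans _ m0m).
    by rewrite /cov => /subr0_eq <-; rewrite /zeta /tensor /= subrK.
  rewrite zE.
  have hE := mean_sqr_le E2; have hF := mean_sqr_le F2; have hZ := mean_sqr_le Zr2.
  set x := mean P (fun w => E _) in hE *.
  set y := mean P _ in hF *; set z := mean P _ in hZ *.
  apply: (@le_trans _ _ (2 * (x ^+ 2 + y ^+ 2 * z ^+ 2))).
    by have := sqr_ge0 (x + y * z); rewrite !expr2; lra.
  rewrite ler_pM2l//; apply: lerD => //.
  by apply: ler_pM; rewrite ?sqr_ge0.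
apply: (@le_trans _ _ (\int[lam2]_p (2%:E *
    (moment2 P (fun w => E (w, p)) + f p.1 * g p.2)))%E).
  apply: ae_ge0_le_integral => //.
  - by move=> p _; rewrite lee_fin sqr_ge0.
  - by apply: measurable_sqr; exact: measurable_zeta.
  - by move=> p _; apply: mule_ge0 => //; apply: adde_ge0 => //; exact: moment2_ge0.
  - by apply: measurable_funeM; exact: emeasurable_funD.
  by apply: (ae_impl (mu := lam2) _ ptw) => p + _.
rewrite ge0_integralZl//; last 2 first.
- exact: emeasurable_funD.
- by move=> p _; apply: adde_ge0 => //; exact: moment2_ge0.
rewrite ge0_integralD//; last by move=> p _; exact: moment2_ge0.
have -> : (\int[lam2]_p (f p.1 * g p.2) = field_norm2 P lam F * field_norm2 P lam (Z m r))%E.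
  rewrite (fubini_tonelli1 (m1 := lam) (m2 := lam)
    (fun p : T * T => f p.1 * g p.2)%E)//.
  rewrite /field_norm2 -ge0_integralZr//.
  - by apply: eq_integral => t _; rewrite /fubini_F /= ge0_integralZl//; exact: f0.
  - by move=> t _; exact: f0.
  - by apply: integral_ge0 => s _; exact: moment2_ge0.
rewrite (_ : (16 * B + 2 * (1 + B) ^+ 2) * th ^+ (2 * m) =
  2 * (8 * B * th ^+ (2 * m) + ((1 + B) * th ^+ (2 * m)) * (1 + B))); last by ring.
rewrite EFinM; apply: lee_wpmul2l; first by rewrite lee_fin.
rewrite EFinD; apply: leeD; first exact: tensor_coupling_dist.
rewrite EFinM; apply: lee_pmul; do ?exact: field_norm2_ge0.
  exact: field_norm2_YZ.
exact: field_norm2_Z.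
Qed.

Definition zeta_const : R := (18 * B + 2 * (1 + B) ^+ 2) / th ^+ (2 * m0).

(** At lag [r] the coupled variables with [m = |r|] are uncorrelated, and the product
    of their means is small because the field is centered. Lags up to [m0] are
    absorbed by the constant. *)
Lemma zeta_norm2 r : (sqnorm lam2 (zeta r) <= (zeta_const * th ^+ (2 * `|r|))%:E)%E.
Proof.
have c1 : 1 <= (th ^+ (2 * m0))^-1.
  by rewrite invf_ge1//; apply: exprn_ile1; exact: ltW.
have b1 : 0 <= (1 + B) ^+ 2 by exact: sqr_ge0.
have b2 : 0 <= B := B0.
have [rm|rm] := ltnP m0 `|r|%N.
  apply: (le_trans (zeta_norm2_coupling rm)); rewrite lee_fin ler_wpM2r ?(ltW (thm_gt0 _))//.
  apply: (@le_trans _ _ (18 * B + 2 * (1 + B) ^+ 2)); first by lra.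
  by rewrite /zeta_const ler_peMr//; lra.
apply: (le_trans (zeta_norm2_trivial r)); rewrite lee_fin.
apply: (@le_trans _ _ (18 * B + 2 * (1 + B) ^+ 2)); first by lra.
rewrite /zeta_const -mulrA ler_peMr//; first by lra.
rewrite mulrC ler_pdivlMr// mul1r; apply: ler_wiXn2l; do ?exact: ltW.
by rewrite leq_pmul2l.
Qed.

End weak_dependence.

(** * Square summable series of kernels *)

Section finite_sums.
Context (R : realType).

(** Cauchy-Schwarz for the measure with the masses [w i]. *)
Lemma weighted_cauchy_schwarz (I : Type) (s : seq I) (w y : I -> R) :
  (forall i, 0 <= w i) ->
  (\sum_(i <- s) w i * y i) ^+ 2 <=
  (\sum_(i <- s) w i) * \sum_(i <- s) w i * y i ^+ 2.
Proof.
move=> w0.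
suff H : 0 <= \sum_(i <- s) \sum_(j <- s) w i * w j * (y i - y j) ^+ 2.
  have E : \sum_(i <- s) \sum_(j <- s) w i * w j * (y i - y j) ^+ 2 =
      2 * ((\sum_(i <- s) w i) * (\sum_(i <- s) w i * y i ^+ 2) -
           (\sum_(i <- s) w i * y i) ^+ 2).
    transitivity (\sum_(i <- s) ((w i * y i ^+ 2) * (\sum_(j <- s) w j) +
      (w i * (\sum_(j <- s) w j * y j ^+ 2) -
       2 * ((w i * y i) * (\sum_(j <- s) w j * y j))))).
      apply: eq_bigr => i _; rewrite !mulr_sumr -sumrB -big_split /=.
      by apply: eq_bigr => j _; ring.
    rewrite big_split /= sumrB -!mulr_suml -mulr_sumr -!mulr_suml; ring.
  by move: H; rewrite E pmulr_rge0// subr_ge0.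
apply: sumr_ge0 => i _; apply: sumr_ge0 => j _.
by apply: mulr_ge0; [exact: mulr_ge0|exact: sqr_ge0].
Qed.

Lemma sum_sym_rangeS (V : zmodType) (F : int -> V) n :
  \sum_(r <- sym_range n.+1) F r =
  \sum_(r <- sym_range n) F r + (F n.+1%:Z + F (- n.+1%:Z)).
Proof.
rewrite /sym_range !big_map.
have -> : iota 0 (2 * n.+1).+1 =
    0%N :: [seq (1 + k)%N | k <- iota 0 (2 * n).+1] ++ [:: (2 * n).+2].
  rewrite (_ : (2 * n.+1).+1 = (2 * n).+2 + 1)%N; last by lia.
  by rewrite iotaD [iota 0 _.+2]/= -(iotaDl 1 0).
move: (iota 0 (2 * n).+1) => s.
pose G (j : nat) := F (j%:Z - n.+1%:Z).
have -> : \sum_(j <- 0%N :: [seq (1 + k)%N | k <- s] ++ [:: (2 * n).+2]) G j =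
    G 0%N + (\sum_(k <- s) G (1 + k)%N + G (2 * n).+2).
  by rewrite big_cons big_cat big_map big_seq1.
rewrite addrC -addrA /G; congr (_ + _).
  by apply: eq_bigr => k _; congr F; lia.
by rewrite sub0r; congr (F _ + _); lia.
Qed.

Lemma sum_sym_range (V : zmodType) (F : int -> V) n :
  \sum_(r <- sym_range n) F r =
  F 0 + \sum_(k < n) (F k.+1%:Z + F (- k.+1%:Z)).
Proof.
elim: n => [|n IHn]; last by rewrite sum_sym_rangeS IHn big_ord_recr /= -addrA.
by rewrite big_ord0 addr0 /sym_range /= big_cons big_nil addr0 subrr.
Qed.

Variable th : R.
Hypotheses (th0 : 0 < th) (th1 : th < 1).

Let inv_ge0 : 0 <= (1 - th)^-1. Proof. by rewrite invr_ge0 subr_ge0; exact: ltW. Qed.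

Lemma sym_geometric_tail_le n N :
  \sum_(r <- sym_range N) (n < `|r|)%N%:R * th ^+ `|r| <= 2 * th ^+ n / (1 - th).
Proof.
rewrite sum_sym_range /= mul0r add0r.
rewrite (eq_bigr (fun k : 'I_N => 2 * ((n <= k)%N%:R * th ^+ k.+1))); last first.
  by move=> k _; rewrite ltnS; ring.
rewrite -mulr_sumr -mulrA ler_pM2l//.
have le1 (k : 'I_N) : (n <= k)%N%:R * th ^+ k.+1 <= (n <= k)%N%:R * th ^+ k.
  by rewrite ler_wpM2l// exprS ler_piMl ?exprn_ge0// ltW.
apply: (le_trans (ler_sum _ (fun k _ => le1 k))).
case: (leqP N n) => [Nn|/ltnW nN].
  rewrite big1; first by apply: mulr_ge0 => //; exact/exprn_ge0/ltW.
  move=> k _.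
  by rewrite leqNgt (leq_trans (ltn_ord k) Nn) mul0r.
rewrite -(big_mkord xpredT (fun k => (n <= k)%N%:R * th ^+ k)).
rewrite (big_cat_nat (leq0n n) nN)/= big_nat big1 ?add0r; last first.
  by move=> k /andP[_ kn]; rewrite leqNgt kn mul0r.
rewrite -[X in \sum_(X <= _ < _) _]add0n big_addn big_mkord.
rewrite (eq_bigr (fun k : 'I_(N - n) => th ^+ n * th ^+ k)); last first.
  by move=> k _; rewrite leq_addl mul1r exprD mulrC.
by rewrite -mulr_sumr ler_pM2l ?exprn_gt0//; exact: geometric_sum_le.
Qed.

Lemma sym_geometric_sum_le N :
  \sum_(r <- sym_range N) th ^+ `|r| <= 2 / (1 - th).
Proof.
rewrite sum_sym_range /= expr0; under eq_bigr do rewrite -mulr2n -mulr_natl.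
rewrite -mulr_sumr.
have := geometric_sum_le th0 th1 N.+1; rewrite big_ord_recl /= expr0 => h.
have h0 : 0 <= \sum_(i < N) th ^+ bump 0 i.
  by apply: sumr_ge0 => i _; rewrite exprn_ge0// ltW.
move: h h0; rewrite /bump /=; lra.
Qed.

Lemma sum_sym_range_tail (F : int -> R) n N : (n <= N)%N ->
  \sum_(r <- sym_range N) F r - \sum_(r <- sym_range n) F r =
  \sum_(r <- sym_range N) (n < `|r|)%N%:R * F r.
Proof.
move=> nN; rewrite !sum_sym_range /= mul0r add0r opprD addrACA subrr add0r.
pose G k := F k.+1%:Z + F (- k.+1%:Z).
rewrite -(big_mkord xpredT G) -(big_mkord xpredT G).
rewrite (big_cat_nat (leq0n n) nN)/= addrC addKr.
transitivity (\sum_(0 <= k < N) (n <= k)%N%:R * G k); last first.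
  by rewrite big_mkord; apply: eq_bigr => k _; rewrite ltnS mulrDr.
have z : \sum_(0 <= k < n) (n <= k)%N%:R * G k = 0.
  by rewrite big_nat big1// => k /andP[_ kn]; rewrite leqNgt kn mul0r.
rewrite [RHS](big_cat_nat (leq0n n) nN)/= z add0r.
by apply: eq_big_nat => k /andP[-> _]; rewrite mul1r.
Qed.

End finite_sums.

Section kernel_series.
Context (R : realType) d (Th : measurableType d)
  (q : {finite_measure set Th -> \bar R}).
Variables (th D : R) (ze : int -> Th -> R).
Hypotheses (th0 : 0 < th) (th1 : th < 1) (D0 : 0 <= D).
Hypothesis mze : forall r, measurable_fun [set: Th] (ze r).
Hypothesis zeD : forall r, (sqnorm q (ze r) <= (D * th ^+ (2 * `|r|))%:E)%E.

Definition partial_series (N : nat) (p : Th) : R := \sum_(r <- sym_range N) ze r p.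

Lemma measurable_partial_series N : measurable_fun [set: Th] (partial_series N).
Proof. exact: measurable_sum. Qed.

(** The weights [th ^+ |r|] of Cauchy-Schwarz are the square roots of the rate at
    which the squared norms of the terms decay. *)
Lemma series_norm2 (s : seq int) (b : int -> R) :
  (sqnorm q (fun p => \sum_(r <- s) b r * ze r p)%R <=
   ((\sum_(r <- s) th ^+ `|r|) * (D * \sum_(r <- s) b r ^+ 2 * th ^+ `|r|))%R%:E)%E.
Proof.
pose w r : R := th ^+ `|r|%N.
have w0 r : 0 < w r by exact: exprn_gt0.
pose W := \sum_(r <- s) w r.
have W0 : 0 <= W by apply: sumr_ge0 => r _; exact: ltW.
have c0 r : 0 <= b r ^+ 2 / w r by rewrite divr_ge0 ?sqr_ge0// ltW.
have msq r : measurable_fun setT (fun p => ((ze r p) ^+ 2)%:E) by exact: measurable_sqr.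
have sq0 r p : (0 <= ((ze r p) ^+ 2)%:E)%E by rewrite lee_fin sqr_ge0.
have mt r : measurable_fun setT (fun p => (b r ^+ 2 / w r)%:E * ((ze r p) ^+ 2)%:E)%E.
  exact: measurable_funeM.
have t0 r p : (0 <= (b r ^+ 2 / w r)%:E * ((ze r p) ^+ 2)%:E)%E.
  by rewrite -EFinM lee_fin mulr_ge0// sqr_ge0.
apply: (@le_trans _ _ (\int[q]_p (W%:E * \sum_(r <- s)
    ((b r ^+ 2 / w r)%:E * ((ze r p) ^+ 2)%:E))%E)%E).
  apply: ge0_le_integral => //.
  - by move=> p _; rewrite lee_fin sqr_ge0.
  - by apply: measurable_sqr; apply: measurable_sum => r; exact: measurable_funM.
  - by apply: measurable_funeM; exact: emeasurable_sum.
  move=> p _.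
  have := weighted_cauchy_schwarz s (w := w) (fun r => b r * ze r p / w r)
    (fun r => ltW (w0 r)).
  rewrite (eq_bigr (fun r => b r * ze r p)); last first.
    by move=> r _; field; exact: lt0r_neq0.
  move=> H; rewrite (eq_bigr (fun r => (b r ^+ 2 / w r * ze r p ^+ 2)%:E))//.
  rewrite sumEFin lee_fin.
  apply: (le_trans H); rewrite ler_wpM2l//.
  rewrite le_eqVlt; apply/orP; left; apply/eqP; apply: eq_bigr => r _.
  by field; exact: lt0r_neq0.
rewrite ge0_integralZl//; first last.
- by move=> p _; exact: sume_ge0.
- exact: emeasurable_sum.
rewrite ge0_integral_sum// EFinM; apply: lee_wpmul2l; first by rewrite lee_fin.
rewrite mulr_sumr -sumEFin; apply: lee_sum => r _.
rewrite ge0_integralZl//; last by rewrite lee_fin.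
apply: (@le_trans _ _ ((b r ^+ 2 / w r)%:E * (D * th ^+ (2 * `|r|))%:E)%E).
  by apply: lee_wpmul2l; [rewrite lee_fin|exact: zeD].
rewrite -EFinM lee_fin mul2n -addnn exprD -/(w r).
by rewrite le_eqVlt; apply/orP; left; apply/eqP; field; exact: lt0r_neq0.
Qed.

Definition series_const : R := 4 * D / (1 - th) ^+ 2.

Let inv_ge0 : 0 <= (1 - th)^-1. Proof. by rewrite invr_ge0 subr_ge0; exact: ltW. Qed.

Lemma partial_series_cauchy n N : (n <= N)%N ->
  (sqnorm q (partial_series N \- partial_series n)%R <= (series_const * th ^+ n)%:E)%E.
Proof.
move=> nN.
have -> : partial_series N \- partial_series n =
    (fun p => \sum_(r <- sym_range N) (n < `|r|)%N%:R * ze r p).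
  by apply/funext => p /=; rewrite /partial_series sum_sym_range_tail.
apply: (le_trans (series_norm2 _ _)); rewrite lee_fin.
rewrite (_ : series_const * th ^+ n = 2 / (1 - th) * (D * (2 * th ^+ n / (1 - th)))).
  apply: ler_pM.
  - by apply: sumr_ge0 => r _; exact/exprn_ge0/ltW.
  - apply: mulr_ge0 => //; apply: sumr_ge0 => r _.
    by rewrite mulr_ge0 ?sqr_ge0//; exact/exprn_ge0/ltW.
  - exact: sym_geometric_sum_le.
  rewrite ler_wpM2l// (le_trans _ (sym_geometric_tail_le th0 th1 n N))//.
  by apply: ler_sum => r _; case: (_ < _)%N; rewrite ?expr1n// expr0n.
rewrite /series_const; field; rewrite subr_eq0; apply/eqP => h; move: th1.
by rewrite -h ltxx.
Qed.

Let term (k : nat) (p : Th) : R := ze k.+1%:Z p + ze (- k.+1%:Z) p.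

Let term_int (k : nat) : (\int[q]_p `|term k p|%:E <=
  (2 * (fine (q setT) + D) * th ^+ k)%:E)%E.
Proof.
have thk : 0 < th ^+ k.+1 by exact: exprn_gt0.
have one r : `|r|%N = k.+1 -> (\int[q]_p `|ze r p|%:E <=
    ((fine (q setT) + D) * th ^+ k.+1)%:E)%E.
  move=> rk.
  apply: (@le_trans _ _ (\int[q]_p ((th ^+ k.+1)%:E +
      (th ^+ k.+1)^-1%:E * ((ze r p) ^+ 2)%:E))%E).
    apply: ge0_le_integral => //.
    - by apply/measurable_EFinP; exact: measurableT_comp.
    - by apply: emeasurable_funD => //; apply: measurable_funeM; exact: measurable_sqr.
    move=> p _; rewrite -EFinM -EFinD lee_fin -(ler_pM2l thk).
    rewrite mulrDr mulrA divff ?lt0r_neq0// mul1r.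
    have := sqr_ge0 (th ^+ k.+1 - `|ze r p| / 2); have := sqr_ge0 (ze r p).
    rewrite sqrrB expr_div_n real_normK ?num_real//; move: (ze r p ^+ 2) => z.
    by rewrite -[2 ^+ 2]/(2 * 2); lra.
  rewrite ge0_integralD//; first last.
  - by apply: measurable_funeM; exact: measurable_sqr.
  - by move=> p _; apply: mule_ge0; rewrite lee_fin ?sqr_ge0// invr_ge0; exact: ltW.
  - by move=> p _; rewrite lee_fin; exact: ltW.
  rewrite integral_cst//= mulrDl EFinD; apply: leeD.
    by rewrite mulrC EFinM fineK// fin_num_measure.
  rewrite ge0_integralZl//; first last.
  - by rewrite lee_fin invr_ge0; exact: ltW.
  - by move=> p _; rewrite lee_fin sqr_ge0.
  - exact: measurable_sqr.
  apply: (@le_trans _ _ ((th ^+ k.+1)^-1%:E * (D * th ^+ (2 * k.+1))%:E)%E).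
    apply: lee_wpmul2l; first by rewrite lee_fin invr_ge0; exact: ltW.
    by have := zeD r; rewrite rk.
  rewrite -EFinM lee_fin mul2n -addnn exprD.
  by rewrite le_eqVlt; apply/orP; left; apply/eqP; field; exact: lt0r_neq0.
apply: (@le_trans _ _ (\int[q]_p (`|ze k.+1%:Z p|%:E + `|ze (- k.+1%:Z) p|%:E))%E).
  apply: ge0_le_integral => //.
  - apply/measurable_EFinP; apply: measurableT_comp => //; exact: measurable_funD.
  - by apply: emeasurable_funD; apply/measurable_EFinP; exact: measurableT_comp.
  by move=> p _; rewrite -EFinD lee_fin ler_normD.
rewrite ge0_integralD//; first last.
- by apply/measurable_EFinP; exact: measurableT_comp.
- by apply/measurable_EFinP; exact: measurableT_comp.
apply: (le_trans (leeD (one _ _) (one _ _))); rewrite ?abszN//.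
have qD : 0 <= fine (q setT) + D by rewrite addr_ge0// fine_ge0.
have thS : th ^+ k.+1 <= th ^+ k by rewrite exprS ler_piMl ?exprn_ge0// ltW.
by rewrite -EFinD lee_fin; have := ler_wpM2l qD thS; lra.
Qed.

Lemma partial_series_cvg :
  {ae q, forall p, cvgn (partial_series ^~ p)}.
Proof.
have mterm k : measurable_fun setT (fun p => `|term k p|%:E).
  by apply/measurable_EFinP; apply: measurableT_comp => //; exact: measurable_funD.
have t0 k p : (0 <= `|term k p|%:E)%E by rewrite lee_fin.
pose G p := (\sum_(k <oo) `|term k p|%:E)%E.
have mG : measurable_fun setT G by exact: ge0_emeasurable_sum.
have G0 p : (0 <= G p)%E by exact: nneseries_ge0.
have qD : 0 <= fine (q setT) + D by rewrite addr_ge0// fine_ge0.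
have iG : (\int[q]_p G p <= (2 * (fine (q setT) + D) / (1 - th))%:E)%E.
  rewrite integral_nneseries//; apply: lime_le.
    by apply: is_cvg_nneseries => k _ _; exact: integral_ge0.
  apply: nearW => n; rewrite big_mkord.
  apply: (@le_trans _ _ (\sum_(k < n) (2 * (fine (q setT) + D) * th ^+ k)%:E)%E).
    by apply: lee_sum => k _; exact: term_int.
  rewrite sumEFin lee_fin -mulr_sumr ler_wpM2l ?mulr_ge0//.
  exact: geometric_sum_le.
have : q.-integrable setT G.
  apply/integrableP; split => //; apply: le_lt_trans (ltry _); apply: le_trans iG.
  by apply: ge0_le_integral => //; [exact: measurableT_comp|
    move=> t _; rewrite gee0_abs].
move=> /(integrable_ae measurableT); apply: (ae_impl (mu := q)) => p /(_ I) Gp.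
have cv : cvgn (series (term ^~ p)).
  apply: normed_cvg; apply: nondecreasing_is_cvgn.
    apply/nondecreasing_seqP => n; rewrite /series [leRHS]big_nat_recr//=.
    by rewrite lerDl.
  exists (fine (G p)) => _ [n _ <-]; rewrite -lee_fin fineK// /series /= -sumEFin.
  exact: nneseries_lim_ge.
have -> : partial_series ^~ p = (fun n => ze 0 p + series (term ^~ p) n).
  apply/funext => n; rewrite /partial_series sum_sym_range.
  by rewrite /series /= big_mkord.
by apply: is_cvgD => //; exact: is_cvg_cst.
Qed.

Lemma measurable_limn_einf (f : (Th -> \bar R)^nat) :
  (forall n, measurable_fun [set: Th] (f n)) ->
  measurable_fun [set: Th] (fun p => limn_einf (f ^~ p)).
Proof.
move=> mf.
have -> : (fun p => limn_einf (f ^~ p)) =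
    (fun p => - limn_esup (fun n => - f n p))%E.
  apply/funext => p; have := limn_esupN (f ^~ p).
  by rewrite -[-%E \o _]/(fun n => - f n p)%E => ->; rewrite oppeK.
apply: measurableT_comp => //; apply: measurable_fun_limn_esup => n.
exact: measurableT_comp.
Qed.

(** The terms are summable almost everywhere, so that the partial sums converge
    there, and Fatou's lemma carries the bound on their differences to the limit. *)
Lemma series_limit : exists z : Th -> R, measurable_fun [set: Th] z /\
  forall n, (sqnorm q (partial_series n \- z)%R <= (series_const * th ^+ n)%:E)%E.
Proof.
pose z p := fine (limn_esup (fun n => (partial_series n p)%:E)).
have mz : measurable_fun [set: Th] z.
  apply: measurableT_comp => //; apply: measurable_fun_limn_esup => n.
  by apply/measurable_EFinP; exact: measurable_partial_series.
exists z; split => // n.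
pose f N p := ((partial_series N p - partial_series n p) ^+ 2)%:E.
have mf N : measurable_fun setT (f N).
  by apply: measurable_sqr; apply: measurable_funB; exact: measurable_partial_series.
have f0 N p : (0 <= f N p)%E by rewrite lee_fin sqr_ge0.
have -> : (sqnorm q (partial_series n \- z)%R = \int[q]_p limn_einf (f^~ p))%E.
  apply: ae_eq_integral => //.
  - by apply: measurable_sqr; apply: measurable_funB => //; exact: measurable_partial_series.
  - exact: measurable_limn_einf.
  apply: (ae_impl (mu := q) _ partial_series_cvg) => p /cvg_ex[/= l pl] _.
  have pl' : (partial_series N p)%:E @[N --> \oo] --> l%:E by apply: cvg_EFin => //; exact: nearW.
  have -> : z p = l.
    rewrite /z is_cvg_limn_esupE; last by apply/cvg_ex; exists l%:E.
    by rewrite (cvg_lim _ pl').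
  have fl : f N p @[N --> \oo] --> ((l - partial_series n p) ^+ 2)%:E.
    apply: cvg_EFin; first exact: nearW.
    have pln : partial_series N p - partial_series n p @[N --> \oo] -->
        l - partial_series n p.
      by apply: cvgB; [exact: pl|exact: cvg_cst].
    rewrite expr2; under eq_fun do rewrite /f /= expr2.
    exact: cvgM.
  rewrite is_cvg_limn_einfE; last by apply/cvg_ex; eexists; exact: fl.
  by rewrite (cvg_lim _ fl)// -sqrrN opprB.
apply: (le_trans (fatou _ _ _ _)) => //.
rewrite limn_einf_lim; apply: lime_le; first exact: is_cvg_einfs.
near=> N; apply: ge_ereal_inf; exists (\int[q]_p f N p)%E; first by exists N => /=.
by apply: partial_series_cauchy; near: N; exists n.
Unshelve. all: by end_near. Qed.

End kernel_series.

(** * The long run covariance kernel *)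

Section long_run_covariance.
Context d (Omega : measurableType d) (R : realType) (P : probability Omega R).
Local Notation T := (measurableTypeR R).
Local Notation lam2 := (leb2 R).

Lemma knorm2_sqr (k : T * T -> R) :
  (knorm2 k * knorm2 k = sqnorm lam2 k)%E.
Proof.
have H : (knorm2 k `^ 2 = sqnorm lam2 k)%E.
  rewrite /knorm2 poweR_Lnorm//; apply: eq_integral => p _.
  rewrite -[`|_|%E]/(`|k p|%:E) poweR_EFin -[2]/(2%:R) powR_mulrn//.
  by rewrite real_normK// num_real.
rewrite -H; have : (0 <= knorm2 k)%E by exact: Lnorm_ge0.
case: (knorm2 k) => [x| |]// x0.
  by rewrite poweR_EFin -[2]/(2%:R) powR_mulrn// -EFinM.
by rewrite poweRyr// mulyy.
Qed.

Lemma knorm2_ge0 (k : T * T -> R) : (0 <= knorm2 k)%E.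
Proof. exact: Lnorm_ge0. Qed.

Lemma sqre_le (x : \bar R) (r : R) : (0 <= x)%E -> 0 <= r ->
  (x * x <= (r ^+ 2)%:E)%E -> (x <= r%:E)%E.
Proof.
case: x => [x| |]// x0 r0.
by move: x0; rewrite !lee_fin -expr2 => x0; rewrite ler_sqr.
Qed.

Variables (th B : R) (m0 : nat) (Y : int -> Omega -> L2 R)
  (Z : nat -> int -> Omega * T -> R).
Hypotheses (th0 : 0 < th) (th1 : th < 1) (B0 : 0 <= B).
Hypothesis YZ : approximable_field P th B m0 (field_of Y) Z.

Let ze := zeta P (field_of Y).

Let mze r : measurable_fun [set: T * T] (ze r).
Proof. exact: measurable_zeta YZ r. Qed.

Let D := zeta_const th B m0.

Let D0 : 0 <= D.
Proof.
rewrite /D /zeta_const; apply: divr_ge0; last exact/exprn_ge0/ltW.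
by apply: addr_ge0; apply: mulr_ge0 => //; exact: sqr_ge0.
Qed.

Let zeD r : (sqnorm lam2 (ze r) <= (D * th ^+ (2 * `|r|))%:E)%E.
Proof. exact: zeta_norm2 YZ r. Qed.

Lemma long_run_partialE N : long_run_partial P Y N = partial_series ze N.
Proof.
by apply/funext => p; apply: eq_bigr => r _; rewrite unlock.
Qed.

Let E := series_const th D.

Let E0 : 0 <= E.
Proof. by apply: divr_ge0; [exact: mulr_ge0|exact: sqr_ge0]. Qed.

Let rt := Num.sqrt th.
Let rt0 : 0 < rt. Proof. by rewrite /rt sqrtr_gt0. Qed.
Let rt2 n : (rt ^+ n) ^+ 2 = th ^+ n.
Proof. by rewrite exprAC sqr_sqrtr// ltW. Qed.

Lemma long_run_cov_exists : exists z : L2kernel R,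
  (knorm2 (long_run_partial P Y N \- z)%R @[N --> \oo] --> 0)%E.
Proof.
have [z [mz zE]] := series_limit (q := lam2) th0 th1 D0 mze zeD.
have mS N := measurable_partial_series mze N.
have zfin : z \in Lfun (leb01 R \x leb01 R)%E 2%:E.
  apply/andP; split; first by rewrite inE.
  rewrite inE; rewrite /finite_norm.
  have : (sqnorm lam2 z < +oo)%E.
    have -> : z = partial_series ze 0 \+ (z \- partial_series ze 0).
      by apply/funext => p /=; ring.
    apply: le_lt_trans (sqnormD_le _ (mS 0%N) (measurable_funB mz (mS 0%N))) _.
    have -> : sqnorm lam2 (z \- partial_series ze 0) =
        sqnorm lam2 (partial_series ze 0 \- z).
      by apply: eq_integral => p _ /=; rewrite -sqrrN opprB.
    have -> : partial_series ze 0 = ze 0.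
      by apply/funext => p; rewrite /partial_series sum_sym_range big_ord0 addr0.
    apply: lte_mul_pinfty => //; apply: lte_add_pinfty.
      exact: le_lt_trans (zeD 0) (ltry _).
    have -> : ze 0 = partial_series ze 0.
      by apply/funext => p; rewrite /partial_series sum_sym_range big_ord0 addr0.
    exact: le_lt_trans (zE 0%N) (ltry _).
  rewrite -knorm2_sqr -[X in _ -> (X < _)%E]/(knorm2 z).
  have := knorm2_ge0 z; case: (knorm2 z) => [x _ _|_|].
  - by rewrite ltry.
  - by rewrite mulyy.
  - by rewrite leeNy_eq.
exists (Lfun_Sub (lee1n 2) zfin).
apply: (@squeeze_cvge _ _ _ _ (cst 0%E) _ (fun N => (geometric (Num.sqrt E) rt N)%:E)).
- apply: nearW => N; rewrite knorm2_ge0 /=; apply: sqre_le.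
  + exact: knorm2_ge0.
  + by rewrite mulr_ge0 ?sqrtr_ge0// exprn_ge0// sqrtr_ge0.
  rewrite exprMn sqr_sqrtr// rt2 knorm2_sqr long_run_partialE.
  exact: zE.
- exact: cvg_cst.
- apply: cvg_EFin; first exact: nearW.
  apply: cvg_geometric; rewrite ger0_norm ?sqrtr_ge0//.
  by rewrite -(sqrtr1 R) ltr_sqrt.
Qed.

(** [long_run_cov] is only known as a limit in L2; it is reached through partial
    sums of a higher order. *)
Lemma long_run_cov_approx n :
  (sqnorm lam2 (long_run_partial P Y n \- long_run_cov P Y)%R <=
   ((2 * E + 2) * th ^+ n)%:E)%E.
Proof.
have := long_run_cov_exists => -[z0 z0P].
have kz : (knorm2 (long_run_partial P Y N \- long_run_cov P Y)%R @[N --> \oo] --> 0)%E.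
  rewrite /long_run_cov; exact: (@xgetPex _ 0 [set z : L2kernel R |
    (knorm2 (long_run_partial P Y N \- z)%R @[N --> \oo] --> 0)%E] (ex_intro _ z0 z0P)).
have [N nN kN] : exists2 N, (n <= N)%N &
    (knorm2 (long_run_partial P Y N \- long_run_cov P Y)%R <= (rt ^+ n)%:E)%E.
  have [N0 _ H] := kz _ (open_ereal_lt' (x := 0%E) (y := (rt ^+ n)%:E)
    ltac:(by rewrite lte_fin exprn_gt0)).
  exists (maxn n N0); first exact: leq_maxl.
  by apply: ltW; apply: H => /=; exact: leq_maxr.
have mS k : measurable_fun [set: T * T] (long_run_partial P Y k).
  by rewrite long_run_partialE; exact: measurable_partial_series.
have ml : measurable_fun [set: T * T] (long_run_cov P Y) by exact: measurable_funPT.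
have -> : long_run_partial P Y n \- long_run_cov P Y =
    (long_run_partial P Y n \- long_run_partial P Y N) \+
    (long_run_partial P Y N \- long_run_cov P Y).
  by apply/funext => p /=; ring.
apply: (le_trans (sqnormD_le _ _ _)); do ?exact: measurable_funB.
rewrite (_ : (2 * E + 2) * th ^+ n = 2 * (E * th ^+ n + th ^+ n)); last by ring.
rewrite EFinM; apply: lee_wpmul2l; first by rewrite lee_fin.
rewrite [leRHS]EFinD; apply: leeD.
  have := partial_series_cauchy (q := lam2) th0 th1 D0 mze zeD nN.
  rewrite !long_run_partialE; apply: le_trans; rewrite le_eqVlt; apply/orP; left.
  by apply/eqP; apply: eq_integral => p _ /=; rewrite -sqrrN opprB.
rewrite -knorm2_sqr -rt2 expr2 [leRHS]EFinM.
by apply: lee_pmul => //; exact: knorm2_ge0.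
Qed.

End long_run_covariance.

(** * Decomposition of the sample autocovariances *)

Section estimator.
Context d (Omega : measurableType d) (R : realType) (P : probability Omega R).
Local Notation T := (measurableTypeR R).
Local Notation lam := (leb01 R).
Local Notation lam2 := (leb2 R).

(** At lag [r] the averaged products are those of the observations with indices
    [i + lag_left r] and [i + lag_right r], in this order of the arguments. *)
Definition lag_left (r : int) : nat := if r is Posz _ then 0%N else `|r|%N.
Definition lag_right (r : int) : nat := if r is Posz k then k else 0%N.

Lemma lag_sub r : ((lag_left r - lag_right r) + (lag_right r - lag_left r))%N = `|r|%N.
Proof. by case: r => k /=; lia. Qed.

Lemma lag_diff r : (lag_right r)%:Z - (lag_left r)%:Z = r.
Proof. by case: r => k /=; lia. Qed.

Lemma sample_autocovE (X : nat -> Omega -> R -> R) n r w t s :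
  sample_autocov X n r w t s = n%:R^-1 * \sum_(i < n - `|r|)
    (X (i + (lag_left r).+1)%N w t - sample_mean X n w t) *
    (X (i + (lag_right r).+1)%N w s - sample_mean X n w s).
Proof.
have shift i k : (i + k.+1 = i.+1 + k)%N by rewrite addnS addSn.
case: r => k; rewrite /sample_autocov /sample_autocov_nat big_add1 big_mkord;
  congr (_ * _); apply: eq_bigr => i _.
  by rewrite [lag_left _]/= [lag_right _]/= addn1 shift.
by rewrite [lag_left _]/= [lag_right _]/= addn1 !shift mulrC.
Qed.

Variables (th B : R) (m0 : nat) (Y : int -> Omega -> L2 R)
  (Z : nat -> int -> Omega * T -> R).
Hypotheses (th0 : 0 < th) (th1 : th < 1) (B0 : 0 <= B).
Hypothesis YZ : approximable_field P th B m0 (field_of Y) Z.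

Local Notation Yf := (field_of Y).

Let mY i : measurable_fun [set: Omega * T] (Yf i).
Proof. exact: (field_measurable YZ). Qed.

Variable n : nat.
Hypothesis n0 : (0 < n)%N.

Let nR : 0 < n%:R :> R. Proof. by rewrite ltr0n. Qed.

Definition scaled_sum (a N : nat) (z : Omega * T) : R :=
  n%:R^-1 * \sum_(i < N) Yf (i + a)%N z.

Definition centered_product (r : int) (z : Omega * (T * T)) : R :=
  n%:R^-1 * \sum_(i < n - `|r|)
    (tensor (Yf (i + (lag_left r).+1)%N) (Yf (i + (lag_right r).+1)%N) z -
     mean P (fun w => tensor (Yf (i + (lag_left r).+1)%N)
                             (Yf (i + (lag_right r).+1)%N) (w, z.2))).

Definition mean_correction (r : int) (z : Omega * (T * T)) : R :=
  (n - `|r|)%:R / n%:R * tensor (scaled_sum 1 n) (scaled_sum 1 n) z -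
  tensor (scaled_sum 1 n) (scaled_sum (lag_right r).+1 (n - `|r|)) z -
  tensor (scaled_sum (lag_left r).+1 (n - `|r|)) (scaled_sum 1 n) z.

Lemma measurable_scaled_sum a N : measurable_fun [set: Omega * T] (scaled_sum a N).
Proof. by apply: measurable_funM => //; exact: measurable_sum. Qed.

Lemma measurable_centered_product r :
  measurable_fun [set: Omega * (T * T)] (centered_product r).
Proof.
apply: measurable_funM => //; apply: measurable_sum => i; apply: measurable_funB.
  exact: measurable_tensor.
apply: (measurableT_comp (measurable_mean P (measurable_tensor
  (mY (i + (lag_left r).+1)%N) (mY (i + (lag_right r).+1)%N)))).
exact: measurable_snd.
Qed.

Lemma measurable_mean_correction r :
  measurable_fun [set: Omega * (T * T)] (mean_correction r).
Proof.
by apply: measurable_funB; [apply: measurable_funB; [apply: measurable_funM => //|]|];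
  apply: measurable_tensor; exact: measurable_scaled_sum.
Qed.

(** Expanding the product of two deviations from the sample mean leaves, besides
    the products of the observations, only products of normalized sums. *)
Lemma autocov_decomposition r w t s :
  sample_autocov (fun i w t => Yf i (w, t)) n r w t s =
  mean_correction r (w, (t, s)) + centered_product r (w, (t, s)) +
  n%:R^-1 * \sum_(i < n - `|r|) mean P (fun w => tensor (Yf (i + (lag_left r).+1)%N)
                             (Yf (i + (lag_right r).+1)%N) (w, (t, s))).
Proof.
rewrite sample_autocovE /centered_product sumrB mulrBr.
rewrite -[RHS]addrA subrK /mean_correction /tensor /scaled_sum /=.
have mE u : sample_mean (fun i w t => Yf i (w, t)) n w u =
    n%:R^-1 * \sum_(i < n) Yf (i + 1)%N (w, u).
  rewrite /sample_mean big_add1 /= big_mkord; congr (_ * _).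
  by apply: eq_bigr => i _; rewrite addn1.
rewrite -!mE; set mt := sample_mean _ n w t; set ms := sample_mean _ n w s.
clearbody mt ms.
set N := (n - `|r|)%N.
rewrite (eq_bigr (fun i : 'I_N => Yf (i + (lag_left r).+1)%N (w, t) *
    Yf (i + (lag_right r).+1)%N (w, s) - (ms * Yf (i + (lag_left r).+1)%N (w, t) +
    (mt * Yf (i + (lag_right r).+1)%N (w, s) - mt * ms)))); last first.
  by move=> i _; ring.
rewrite sumrB big_split /= sumrB -!mulr_sumr sumr_const card_ord -[_ *+ N]mulr_natr.
by ring.
Qed.

End estimator.

(** * Mean squares of the parts of the error *)

Section squared_norms.
Context (R : realType).

Lemma sqnormZ d (T : measurableType d) (q : {sigma_finite_measure set T -> \bar R})
    (a : R) (u : T -> R) : measurable_fun [set: T] u ->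
  (sqnorm q (fun t => a * u t)%R = (a ^+ 2)%:E * sqnorm q u)%E.
Proof.
move=> mu; rewrite /sqnorm -ge0_integralZl//.
- by apply: eq_integral => t _; rewrite exprMn EFinM.
- exact: measurable_sqr.
- by move=> t _; rewrite lee_fin sqr_ge0.
- by rewrite lee_fin sqr_ge0.
Qed.

Lemma sqnormN d (T : measurableType d) (q : {sigma_finite_measure set T -> \bar R})
    (u : T -> R) : sqnorm q (fun t => - u t) = sqnorm q u.
Proof. by apply: eq_integral => t _; rewrite sqrrN. Qed.

Lemma field_norm2Z d (Omega : measurableType d) (P : probability Omega R)
    d' (T : measurableType d') (q : {sigma_finite_measure set T -> \bar R})
    (a : R) (U : Omega * T -> R) : measurable_fun [set: Omega * T] U ->
  (field_norm2 P q (fun z => a * U z)%R = (a ^+ 2)%:E * field_norm2 P q U)%E.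
Proof.
move=> mU; rewrite !field_norm2E//; last exact: measurable_funM.
rewrite -ge0_integralZl//.
- by apply: eq_integral => w _; rewrite sqnormZ//; exact: measurable_field1.
- exact: measurable_sqnorm.
- by move=> w _; exact: sqnorm_ge0.
- by rewrite lee_fin sqr_ge0.
Qed.

Lemma sum_sqr_le (I : Type) (s : seq I) (x : I -> \bar R) :
  (forall i, 0 <= x i)%E ->
  (\sum_(i <- s) x i * x i <= (\sum_(i <- s) x i) * \sum_(i <- s) x i)%E.
Proof.
move=> x0; elim: s => [|i s IHs]; first by rewrite !big_nil mule0.
rewrite !big_cons; set t := (\sum_(j <- s) x j)%E in IHs *.
have t0 : (0 <= t)%E by exact: sume_ge0.
have xt0 : (0 <= x i + t)%E by exact: adde_ge0.
rewrite ge0_muleDl//; apply: leeD.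
  by apply: lee_wpmul2l => //; rewrite leeDl.
by apply: (le_trans IHs); apply: lee_wpmul2l => //; rewrite leeDr.
Qed.

Lemma three_term_sqr_le (x y z : \bar R) : (0 <= x)%E -> (0 <= y)%E -> (0 <= z)%E ->
  (x * x + x * y + z * x <= (x + (y + z)) * (x + (y + z)))%E.
Proof.
move=> x0 y0 z0; have yz0 : (0 <= y + z)%E by exact: adde_ge0.
rewrite [leRHS]ge0_muleDl//.
apply: leeD.
  by rewrite -ge0_muleDr//; apply: lee_wpmul2l => //; rewrite addeA leeDl.
rewrite muleC [leRHS]muleC; apply: lee_pmul => //; first by rewrite leeDl.
by rewrite leeDr.
Qed.

(** Cauchy-Schwarz over the lags in a window: only there are the weights [k]
    different from zero, so the number of lags in the window is the price. *)
Lemma windowed_sum_norm2 d (T : measurableType d)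
    (q : {sigma_finite_measure set T -> \bar R}) (I : Type) (s : seq I)
    (J : pred I) (k : I -> R) (M : R) (F : I -> T -> R) :
  (forall i, `|k i| <= M * (J i)%:R) -> (forall i, measurable_fun [set: T] (F i)) ->
  (sqnorm q (fun t => \sum_(i <- s) k i * F i t)%R <=
   ((\sum_(i <- s) (J i)%:R) * M ^+ 2)%:E *
   \sum_(i <- s) ((J i)%:R)%:E * sqnorm q (F i))%E.
Proof.
move=> kM mF.
have k0 i : J i = false -> k i = 0 :> R.
  by move=> Ji; apply/eqP; rewrite -normr_le0; have := kM i; rewrite Ji mulr0.
have m2 i : measurable_fun setT (fun t => ((J i)%:R)%:E * ((F i t) ^+ 2)%:E)%E.
  by apply: measurable_funeM; exact: measurable_sqr.
have p2 i t : (0 <= ((J i)%:R)%:E * ((F i t) ^+ 2)%:E)%E.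
  by rewrite lee_fin mulr_ge0// sqr_ge0.
have c0 : 0 <= (\sum_(i <- s) (J i)%:R : R) * M ^+ 2.
  by rewrite mulr_ge0 ?sqr_ge0// sumr_ge0.
have -> : (\sum_(i <- s) ((J i)%:R)%:E * sqnorm q (F i) =
    \int[q]_t \sum_(i <- s) ((J i)%:R)%:E * ((F i t) ^+ 2)%:E)%E.
  rewrite ge0_integral_sum//; apply: eq_bigr => i _.
  rewrite ge0_integralZl//; first exact: measurable_sqr.
  by move=> t _; rewrite lee_fin sqr_ge0.
rewrite -ge0_integralZl//; first last.
- by move=> t _; exact: sume_ge0.
- exact: emeasurable_sum.
apply: ge0_le_integral => //.
- by move=> t _; rewrite lee_fin sqr_ge0.
- by apply: measurable_sqr; apply: measurable_sum => i; exact: measurable_funM.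
- by apply: measurable_funeM; exact: emeasurable_sum.
move=> t _; rewrite (eq_bigr (fun i => ((J i)%:R * F i t ^+ 2)%:E))//.
rewrite sumEFin lee_fin.
have := weighted_cauchy_schwarz s (w := fun i => (J i)%:R) (fun i => k i * F i t)
  (fun i => ler0n _ _).
rewrite (eq_bigr (fun i => k i * F i t)); last first.
  move=> i _; have := k0 i; case: (J i) => [_|->//]; first by rewrite mul1r.
  by rewrite !mul0r.
move=> /le_trans; apply; rewrite -[leRHS]mulrA ler_wpM2l ?sumr_ge0// mulr_sumr.
apply: ler_sum => i _; have := kM i; case: (J i) => [|_]; last by rewrite !mul0r mulr0.
rewrite mulr1 !mul1r exprMn => kiM; rewrite ler_wpM2r ?sqr_ge0//.
by rewrite -real_normK ?num_real// lerXn2r// nnegrE// (le_trans _ kiM).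
Qed.

Lemma count_window n L :
  \sum_(r <- sym_range n) (`|r| <= L)%N%:R <= (2 * L + 1)%:R :> R.
Proof.
rewrite sum_sym_range leq0n natrD [leLHS]addrC lerD2r.
rewrite (eq_bigr (fun k : 'I_n => 2 * (k < L)%N%:R)); last by move=> k _; ring.
rewrite -mulr_sumr natrM ler_pM2l// -natr_sum ler_nat.
rewrite (@leq_trans (minn n L))//; last exact: geq_minr.
by elim: n => [|n IHn]; rewrite ?big_ord0// big_ord_recr /=; case: ltnP; lia.
Qed.

End squared_norms.

Section pieces.
Context d (Omega : measurableType d) (R : realType) (P : probability Omega R).
Local Notation T := (measurableTypeR R).
Local Notation lam := (leb01 R).
Local Notation lam2 := (leb2 R).
Variables (th B : R) (m0 : nat) (Y : int -> Omega -> L2 R)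
  (Z : nat -> int -> Omega * T -> R).
Hypotheses (th0 : 0 < th) (th1 : th < 1) (B0 : 0 <= B).
Hypothesis YZ : approximable_field P th B m0 (field_of Y) Z.

Local Notation Yf := (field_of Y).

Let mY i : measurable_fun [set: Omega * T] (Yf i).
Proof. exact: (field_measurable YZ). Qed.

Variable n : nat.
Hypothesis n0 : (0 < n)%N.

Let nR : 0 < n%:R :> R. Proof. by rewrite ltr0n. Qed.

Definition var_const : R := 12 * (8 * (1 + B)) / th ^+ m0.+1 / (1 - th).

Lemma var_const_ge0 : 0 <= var_const.
Proof.
rewrite /var_const; apply: divr_ge0; last by rewrite subr_ge0 ltW.
apply: divr_ge0; last exact/exprn_ge0/ltW.
by apply: mulr_ge0 => //; apply: mulr_ge0 => //; exact: addr_ge0.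
Qed.

Let var_const_le (a : R) : a <= 8 * (1 + B) ->
  12 * a / th ^+ m0.+1 / (1 - th) <= var_const.
Proof.
move=> ab; rewrite /var_const !ler_wpM2r// ?ler_wpM2l// invr_ge0.
  by rewrite subr_ge0 ltW.
exact/exprn_ge0/ltW.
Qed.

Let scaled (N : nat) : (N <= n)%N -> (n%:R^-1 ^+ 2 * N%:R : R) <= n%:R^-1.
Proof.
move=> Nn; rewrite expr2 -mulrA ler_piMr ?invr_ge0 ?(ltW nR)//.
by rewrite mulrC ler_pdivrMr// mul1r ler_nat.
Qed.

Lemma scaled_sum_norm2 a N : (N <= n)%N ->
  (field_norm2 P lam (scaled_sum Y n a N) <= (var_const / n%:R)%:E)%E.
Proof.
move=> Nn; rewrite field_norm2Z; last exact: measurable_sum.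
apply: (@le_trans _ _ ((n%:R^-1 ^+ 2)%:E * (var_const * N%:R)%:E)%E).
  apply: lee_wpmul2l; first by rewrite lee_fin sqr_ge0.
  apply: (le_trans (sum_var th0 th1 B0 YZ a N)); rewrite lee_fin ler_wpM2r//.
  by apply: var_const_le => //; have b := B0; lra.
by rewrite lee_fin mulrCA ler_wpM2l ?var_const_ge0//; exact: scaled.
Qed.

Lemma centered_product_norm2 r :
  (field_norm2 P lam2 (centered_product P Y n r) <=
   (var_const * (1 + `|r|%N%:R) / n%:R)%:E)%E.
Proof.
rewrite field_norm2Z; last first.
  apply: measurable_sum => i; apply: measurable_funB.
    exact: measurable_tensor.
  apply: (measurableT_comp (measurable_mean P (measurable_tensor
    (mY (i + (lag_left r).+1)%N) (mY (i + (lag_right r).+1)%N)))).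
  exact: measurable_snd.
apply: (@le_trans _ _ ((n%:R^-1 ^+ 2)%:E *
    (var_const * (1 + `|r|%N%:R) * (n - `|r|)%:R)%:E)%E).
  apply: lee_wpmul2l; first by rewrite lee_fin sqr_ge0.
  apply: (le_trans (autocov_var th0 th1 B0 YZ _ _ _)); rewrite subSS subSS lag_sub.
  rewrite lee_fin 2?ler_wpM2r// ?addr_ge0//.
  by apply: var_const_le => //; have b := B0; lra.
have c0 : 0 <= var_const * (1 + `|r|%N%:R).
  by apply: mulr_ge0; [exact: var_const_ge0|exact: addr_ge0].
by rewrite lee_fin mulrCA ler_wpM2l//; apply: scaled; exact: leq_subr.
Qed.

Definition lagged_norm2 (r : int) (w : Omega) : \bar R :=
  (sqnorm lam (fun t => scaled_sum Y n 1 n (w, t)) +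
   (sqnorm lam (fun t => scaled_sum Y n (lag_right r).+1 (n - `|r|) (w, t)) +
    sqnorm lam (fun t => scaled_sum Y n (lag_left r).+1 (n - `|r|) (w, t))))%E.

Lemma lagged_norm2_ge0 r w : (0 <= lagged_norm2 r w)%E.
Proof. by apply: adde_ge0; [|apply: adde_ge0]; exact: sqnorm_ge0. Qed.

Lemma measurable_lagged_norm2 r : measurable_fun [set: Omega] (lagged_norm2 r).
Proof.
by apply: emeasurable_funD; [|apply: emeasurable_funD]; apply: measurable_sqnorm;
  exact: (measurable_scaled_sum YZ).
Qed.

Lemma lagged_norm2_mean r : (\int[P]_w lagged_norm2 r w <= (3 * var_const / n%:R)%:E)%E.
Proof.
have mS a N : measurable_fun setT
    (fun w => sqnorm lam (fun t => scaled_sum Y n a N (w, t))).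
  by apply: measurable_sqnorm; exact: (measurable_scaled_sum YZ).
have S0 a N w : (0 <= sqnorm lam (fun t => scaled_sum Y n a N (w, t)))%E.
  exact: sqnorm_ge0.
rewrite ge0_integralD//; last 2 first.
- by move=> w _; exact: adde_ge0.
- exact: emeasurable_funD.
rewrite ge0_integralD//.
rewrite -!field_norm2E; do ?exact: (measurable_scaled_sum YZ).
have Nn : (n - `|r| <= n)%N by exact: leq_subr.
apply: (@le_trans _ _ ((var_const / n%:R)%:E + ((var_const / n%:R)%:E +
    (var_const / n%:R)%:E))%E).
  by apply: leeD; [|apply: leeD]; exact: scaled_sum_norm2.
by rewrite lee_fin -!mulrA; lra.
Qed.

(** The products of two normalized sums factor, so that their squared norms are
    products of squared norms. *)
Lemma mean_correction_norm2 r w :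
  (sqnorm lam2 (fun p => mean_correction Y n r (w, p)) <=
   4%:E * (lagged_norm2 r w * lagged_norm2 r w))%E.
Proof.
have mS a N : measurable_fun [set: T] (fun t => scaled_sum Y n a N (w, t)).
  by apply: measurable_field1; exact: (measurable_scaled_sum YZ).
have mt a N a' N' : measurable_fun [set: T * T]
    (fun p => tensor (scaled_sum Y n a N) (scaled_sum Y n a' N') (w, p)).
  apply: (@measurable_field1 _ _ _ _ _ (tensor _ _)).
  by apply: measurable_tensor; exact: (measurable_scaled_sum YZ).
have tE a N a' N' : (sqnorm lam2
    (fun p => tensor (scaled_sum Y n a N) (scaled_sum Y n a' N') (w, p)) =
    sqnorm lam (fun t => scaled_sum Y n a N (w, t)) *
    sqnorm lam (fun t => scaled_sum Y n a' N' (w, t)))%E.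
  exact: (sqnorm_tensor (mS a N) (mS a' N')).
pose k : R := (n - `|r|)%:R / n%:R.
have k0 : 0 <= k by rewrite divr_ge0.
have k1 : k <= 1 by rewrite ler_pdivrMr// mul1r ler_nat leq_subr.
pose f a N a' N' p := tensor (scaled_sum Y n a N) (scaled_sum Y n a' N') (w, p).
pose F1 p := k * f 1%N n 1%N n p.
pose F2 p := - f 1%N n (lag_right r).+1 (n - `|r|)%N p.
pose F3 p := - f (lag_left r).+1 (n - `|r|)%N 1%N n p.
have mF1 : measurable_fun setT F1 by apply: measurable_funM; [exact: measurable_cst|exact: mt].
have mF2 : measurable_fun setT F2 by apply: measurable_funN; exact: mt.
have mF3 : measurable_fun setT F3 by apply: measurable_funN; exact: mt.
apply: (le_trans (sqnormD_le (u := F1 \+ F2) (v := F3) lam2 _ mF3)).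
  exact: measurable_funD.
have h := sqnormD_le lam2 mF1 mF2.
apply: (@le_trans _ _ (2%:E * (2%:E * (sqnorm lam2 F1 + sqnorm lam2 F2) +
    sqnorm lam2 F3))%E).
  by apply: lee_wpmul2l; [rewrite lee_fin|apply: leeD].
rewrite !sqnormN sqnormZ; last exact: mt.
rewrite /lagged_norm2 !tE.
set x := sqnorm lam _; set y := sqnorm lam _; set z := sqnorm lam _.
have x0 : (0 <= x)%E by exact: sqnorm_ge0.
have y0 : (0 <= y)%E by exact: sqnorm_ge0.
have z0 : (0 <= z)%E by exact: sqnorm_ge0.
have kk : ((k ^+ 2)%:E * (x * x) <= x * x)%E.
  by rewrite gee_pMl ?mule_ge0// lee_fin exprn_ile1.
apply: (@le_trans _ _ (2%:E * (2%:E * (x * x + x * y + z * x)))%E).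
  apply: lee_wpmul2l; first by rewrite lee_fin.
  rewrite [leRHS]ge0_muleDr ?adde_ge0 ?mule_ge0//; apply: leeD.
    by apply: lee_wpmul2l; [rewrite lee_fin|apply: leeD].
  by rewrite -[leLHS]mul1e; apply: lee_wpmul2r; rewrite ?mule_ge0// lee_fin ler1n.
rewrite muleA -EFinM (_ : 2 * 2 = 4 :> R); last by ring.
apply: lee_wpmul2l; first by rewrite lee_fin.
exact: three_term_sqr_le.
Qed.

(** By stationarity all products at lag [r] have the mean [zeta r]; their number
    [n - |r|] is smaller than the denominator [n]. *)
Lemma product_means r : {ae lam2, forall p : T * T,
  n%:R^-1 * \sum_(i < n - `|r|) mean P (fun w => tensor (Yf (i + (lag_left r).+1)%N)
                             (Yf (i + (lag_right r).+1)%N) (w, p)) =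
  (n - `|r|)%:R / n%:R * zeta P Yf r p}.
Proof.
clear - YZ.
have H : {ae lam2, forall p : T * T, forall i : nat,
    mean P (fun w => tensor (Yf (i + (lag_left r).+1)%N)
                            (Yf (i + (lag_right r).+1)%N) (w, p)) = zeta P Yf r p}.
  apply: ae_foralln => i.
  have := field_stationary YZ 0 r (i + (lag_left r).+1)%N%:Z.
  rewrite addr0 (_ : (i + (lag_left r).+1)%N%:Z + r = (i + (lag_right r).+1)%N%:Z).
    exact.
  by rewrite -[X in _ + X](lag_diff r); lia.
apply: (ae_impl (mu := lam2) _ H) => p Hp; rewrite (eq_bigr (fun=> zeta P Yf r p))//.
by rewrite sumr_const card_ord -mulr_natl; ring.
Qed.

End pieces.

(** * The estimation error *)

Section polynomial_geometric.
Context (R : realType).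

Lemma mul_geometric_le (s : R) j : 0 < s -> s < 1 -> j%:R * s ^+ j <= (1 - s)^-1.
Proof.
move=> s0 s1; apply: le_trans (geometric_sum_le s0 s1 j).
rewrite (_ : j%:R * s ^+ j = \sum_(i < j) s ^+ j); last by rewrite sumr_const card_ord mulr_natl.
by apply: ler_sum => i _; apply: ler_wiXn2l; rewrite ?ltW// ltnW.
Qed.

(** Each factor [|r|] is absorbed by the square root of the geometric term. *)
Lemma sym_polynomial_geometric_sum_le (k : nat) (th : R) : 0 < th -> th < 1 ->
  exists2 S, 0 <= S &
    forall N, \sum_(r <- sym_range N) (`|r|%N%:R ^+ k) * th ^+ `|r| <= S.
Proof.
elim: k th => [|k IHk] th th0 th1.
  exists (2 / (1 - th)); first by rewrite divr_ge0// subr_ge0 ltW.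
  move=> N; rewrite (eq_bigr (fun r : int => th ^+ `|r|)); last first.
    by move=> r _; rewrite mul1r.
  exact: sym_geometric_sum_le.
pose s := Num.sqrt th.
have s0 : 0 < s by rewrite sqrtr_gt0.
have s1 : s < 1 by rewrite -(sqrtr1 R) ltr_sqrt.
have [S S0 HS] := IHk s s0 s1.
have c0 : 0 <= (1 - s)^-1 by rewrite invr_ge0 subr_ge0 ltW.
exists ((1 - s)^-1 * S) => [|N]; first exact: mulr_ge0.
apply: le_trans (ler_wpM2l c0 (HS N)); rewrite mulr_sumr; apply: ler_sum => r _.
have -> : th ^+ `|r| = s ^+ `|r| * s ^+ `|r|.
  by rewrite -expr2 exprAC sqr_sqrtr// ltW.
rewrite exprS mulrACA ler_wpM2r//; last exact: mul_geometric_le.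
by apply: mulr_ge0; [exact: exprn_ge0|exact/exprn_ge0/ltW].
Qed.

End polynomial_geometric.

Section estimation_error.
Context d (Omega : measurableType d) (R : realType) (P : probability Omega R).
Local Notation T := (measurableTypeR R).
Local Notation lam := (leb01 R).
Local Notation lam2 := (leb2 R).
Variables (th B : R) (m0 : nat) (Y : int -> Omega -> L2 R)
  (Z : nat -> int -> Omega * T -> R).
Hypotheses (th0 : 0 < th) (th1 : th < 1) (B0 : 0 <= B).
Hypothesis YZ : approximable_field P th B m0 (field_of Y) Z.

Local Notation Yf := (field_of Y).
Local Notation ze := (zeta P Yf).
Local Notation V := (var_const th B m0).
Local Notation D := (zeta_const th B m0).

Variables (n L : nat) (k : int -> R) (M : R).
Hypothesis n0 : (0 < n)%N.
Hypothesis kM : forall r, `|k r| <= M * (`|r| <= L)%N%:R.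

Let nR : 0 < n%:R :> R. Proof. by rewrite ltr0n. Qed.

Local Notation J := (fun r : int => (`|r| <= L)%N).

Definition weighted_estimator (w : Omega) (p : T * T) : R :=
  \sum_(r <- sym_range n) k r * sample_autocov (fun i w t => Yf i (w, t)) n r w p.1 p.2.

Definition noise (w : Omega) : \bar R :=
  (\sum_(r <- sym_range n) ((`|r| <= L)%N%:R)%:E *
     sqnorm lam2 (fun p => centered_product P Y n r (w, p)))%E.

Definition correction (w : Omega) : \bar R :=
  (\sum_(r <- sym_range n) ((`|r| <= L)%N%:R)%:E * lagged_norm2 Y n r w)%E.

Definition bias (p : T * T) : R :=
  \sum_(r <- sym_range n) (k r * ((n - `|r|)%:R / n%:R) - 1) * ze r p.

Lemma noise_ge0 w : (0 <= noise w)%E.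
Proof.
apply: sume_ge0 => r _; apply: mule_ge0; last exact: sqnorm_ge0.
by rewrite lee_fin.
Qed.

Lemma correction_ge0 w : (0 <= correction w)%E.
Proof.
apply: sume_ge0 => r _; apply: mule_ge0; last exact: lagged_norm2_ge0.
by rewrite lee_fin.
Qed.

Let mc r : measurable_fun [set: Omega]
  (fun w => sqnorm lam2 (fun p => centered_product P Y n r (w, p))).
Proof. by apply: measurable_sqnorm; exact: (measurable_centered_product YZ). Qed.

Lemma measurable_noise : measurable_fun [set: Omega] noise.
Proof. by apply: emeasurable_sum => r; exact: measurable_funeM. Qed.

Lemma measurable_correction : measurable_fun [set: Omega] correction.
Proof.
by apply: emeasurable_sum => r; apply: measurable_funeM; exact: measurable_lagged_norm2 YZ _ _.
Qed.

Let windowed_mean (f : int -> Omega -> \bar R) (c : R) : 0 <= c ->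
  (forall r, measurable_fun [set: Omega] (f r)) -> (forall r w, 0 <= f r w)%E ->
  (forall r, (`|r| <= L)%N -> \int[P]_w f r w <= c%:E)%E ->
  (\int[P]_w \sum_(r <- sym_range n) ((`|r| <= L)%N%:R)%:E * f r w <=
   ((2 * L + 1)%:R * c)%:E)%E.
Proof.
move=> c0 mf f0 fc; rewrite ge0_integral_sum//; last 2 first.
- by move=> r; exact: measurable_funeM.
- by move=> r w _; apply: mule_ge0 => //; rewrite lee_fin.
apply: (@le_trans _ _ (\sum_(r <- sym_range n) ((`|r| <= L)%N%:R * c)%:E)%E).
  apply: lee_sum => r _; rewrite ge0_integralZl//.
  case rL : (`|r| <= L)%N; last by rewrite mul0e mul0r.
  by rewrite mul1e mul1r; exact: fc.
by rewrite sumEFin lee_fin -mulr_suml ler_wpM2r//; exact: count_window.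
Qed.

Lemma noise_mean :
  (\int[P]_w noise w <= ((2 * L + 1)%:R * (V * (1 + L%:R) / n%:R))%:E)%E.
Proof.
have V0 : 0 <= V by exact: var_const_ge0.
apply: windowed_mean => // [||r rL].
- by apply: divr_ge0 => //; apply: mulr_ge0 => //; exact: addr_ge0.
- by move=> r w; exact: sqnorm_ge0.
rewrite -field_norm2E; last exact: (measurable_centered_product YZ).
apply: (le_trans (centered_product_norm2 th0 th1 B0 YZ n0 r)).
by rewrite lee_fin ler_wpM2r ?invr_ge0 ?(ltW nR)// ler_wpM2l// lerD2l ler_nat.
Qed.

Lemma correction_mean :
  (\int[P]_w correction w <= ((2 * L + 1)%:R * (3 * V / n%:R))%:E)%E.
Proof.
have V0 : 0 <= V by exact: var_const_ge0.
apply: windowed_mean => // [|r|r w|r _].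
- by apply: divr_ge0 => //; exact: mulr_ge0.
- exact: measurable_lagged_norm2 YZ _ _.
- exact: lagged_norm2_ge0.
- apply: le_trans (lagged_norm2_mean th0 th1 B0 YZ n0 r) _. by [].
Qed.

Lemma measurable_weighted_estimator :
  measurable_fun [set: Omega * (T * T)] (fun z => weighted_estimator z.1 z.2).
Proof.
apply: measurable_sum => r; apply: measurable_funM => //.
rewrite (_ : (fun z : Omega * (T * T) => _) = (fun z =>
  mean_correction Y n r z + centered_product P Y n r z +
  n%:R^-1 * \sum_(i < n - `|r|) mean P (fun w =>
    tensor (Yf (i + (lag_left r).+1)%N) (Yf (i + (lag_right r).+1)%N) (w, z.2)))).
  apply: measurable_funD.
    apply: measurable_funD; first exact: (measurable_mean_correction YZ).
    exact: (measurable_centered_product YZ).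
  apply: measurable_funM => //; apply: measurable_sum => i.
  apply: (measurableT_comp (measurable_mean P (measurable_tensor
    (field_measurable YZ (i + (lag_left r).+1)%N)
    (field_measurable YZ (i + (lag_right r).+1)%N)))).
  exact: measurable_snd.
by apply/funext => -[w [t s]]; rewrite (autocov_decomposition P).
Qed.

Lemma measurable_bias : measurable_fun [set: T * T] bias.
Proof.
apply: measurable_sum => r; apply: measurable_funM => //.
exact: measurable_zeta YZ r.
Qed.

Lemma estimator_split w : {ae lam2, forall p : T * T,
  weighted_estimator w p - long_run_cov P Y p =
  (\sum_(r <- sym_range n) k r * mean_correction Y n r (w, p) +
   \sum_(r <- sym_range n) k r * centered_product P Y n r (w, p)) +
  (bias p + (long_run_partial P Y n p - long_run_cov P Y p))}.
Proof.
clear - YZ.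
have H : {ae lam2, forall p : T * T, forall i : nat,
  n%:R^-1 * \sum_(j < n - `|(i%:Z - n%:Z)%R|)
    mean P (fun w => tensor (Yf (j + (lag_left (i%:Z - n%:Z)).+1)%N)
                            (Yf (j + (lag_right (i%:Z - n%:Z)).+1)%N) (w, p)) =
  (n - `|(i%:Z - n%:Z)%R|)%:R / n%:R * ze (i%:Z - n%:Z) p}.
  by apply: ae_foralln => i; exact: (product_means YZ n (i%:Z - n%:Z)).
apply: (ae_impl (mu := lam2) _ H) => -[t s] Hp.
rewrite long_run_partialE /bias /partial_series addrA addrA; congr (_ - _).
rewrite -!big_split /= /weighted_estimator big_seq [RHS]big_seq.
apply: eq_bigr => r /mapP[i _ ->].
rewrite (autocov_decomposition P) Hp; ring.
Qed.

Let W : R := (2 * L + 1)%:R.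

(** The four parts are the effect of centring at the sample mean, the
    fluctuation of the sample autocovariances, the bias of their weighted sum
    and the tail of the series that defines the long run covariance. *)
Lemma estimator_error w :
  (sqnorm lam2 (weighted_estimator w \- long_run_cov P Y)%R <=
   4%:E * (((W * M ^+ 2) * 4)%:E * (correction w * correction w) +
           (W * M ^+ 2)%:E * noise w +
           (sqnorm lam2 bias +
            sqnorm lam2 (long_run_partial P Y n \- long_run_cov P Y)%R)))%E.
Proof.
pose F1 p := \sum_(r <- sym_range n) k r * mean_correction Y n r (w, p).
pose F2 p := \sum_(r <- sym_range n) k r * centered_product P Y n r (w, p).
pose F4 := long_run_partial P Y n \- long_run_cov P Y.
have mm r : measurable_fun [set: T * T] (fun p => mean_correction Y n r (w, p)).
  exact: (measurable_field1 w (measurable_mean_correction YZ n r)).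
have mcp r : measurable_fun [set: T * T] (fun p => centered_product P Y n r (w, p)).
  exact: (measurable_field1 w (measurable_centered_product YZ n r)).
have m1 : measurable_fun setT F1.
  by apply: measurable_sum => r; exact: measurable_funM.
have m2 : measurable_fun setT F2.
  by apply: measurable_sum => r; exact: measurable_funM.
have m3 := measurable_bias.
have ml : measurable_fun [set: T * T] (long_run_cov P Y) by exact: measurable_funPT.
have m4 : measurable_fun setT F4.
  apply: measurable_funB => //; rewrite long_run_partialE.
  by apply: measurable_partial_series => r; exact: measurable_zeta YZ r.
have me : measurable_fun [set: T * T] (weighted_estimator w).
  exact: (measurable_field1 w measurable_weighted_estimator).
rewrite (@ae_eq_sqnorm _ _ _ _ _ ((F1 \+ F2) \+ (bias \+ F4))); first last.
- exact: (estimator_split w).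
- by apply: measurable_funD; exact: measurable_funD.
- exact: measurable_funB.
apply: (le_trans (sqnormD_le _ _ _)); do ?exact: measurable_funD.
have e4 : 4%:E = (2%:E * 2%:E)%E :> \bar R by rewrite -EFinM -natrM.
rewrite e4 -muleA; apply: lee_wpmul2l; first by rewrite lee_fin.
have h1 := sqnormD_le lam2 m1 m2; have h2 := sqnormD_le lam2 m3 m4.
apply: (le_trans (leeD h1 h2)); rewrite -ge0_muleDr; last 2 first.
- by apply: adde_ge0; exact: sqnorm_ge0.
- by apply: adde_ge0; exact: sqnorm_ge0.
apply: lee_wpmul2l; first by rewrite lee_fin.
have Mc : (\sum_(r <- sym_range n) (`|r| <= L)%N%:R) * M ^+ 2 <= W * M ^+ 2.
  by rewrite ler_wpM2r ?sqr_ge0//; exact: count_window.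
apply: leeD => //; apply: leeD; last first.
  apply: (le_trans (windowed_sum_norm2 lam2 _ kM mcp)).
  by apply: lee_wpmul2r; [exact: noise_ge0|rewrite lee_fin].
apply: (le_trans (windowed_sum_norm2 lam2 _ kM mm)).
rewrite [in leRHS]EFinM -[leRHS]muleA; apply: lee_pmul.
- by rewrite lee_fin mulr_ge0 ?sqr_ge0// sumr_ge0.
- by apply: sume_ge0 => r _; apply: mule_ge0; [rewrite lee_fin|exact: sqnorm_ge0].
- by rewrite lee_fin.
apply: (@le_trans _ _ (\sum_(r <- sym_range n) 4%:E *
    ((((`|r| <= L)%N%:R)%:E * lagged_norm2 Y n r w) *
     (((`|r| <= L)%N%:R)%:E * lagged_norm2 Y n r w)))%E).
  apply: lee_sum => r _; case: (`|r| <= L)%N; last by rewrite !mul0e mule0.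
  by rewrite !mul1e; exact: (mean_correction_norm2 YZ n0).
rewrite -ge0_sume_distrr; last first.
  by move=> r _; apply: mule_ge0; apply: mule_ge0; rewrite ?lee_fin// lagged_norm2_ge0.
apply: lee_wpmul2l; first by rewrite lee_fin.
apply: sum_sqr_le => r.
by apply: mule_ge0; rewrite ?lee_fin// lagged_norm2_ge0.
Qed.

(** The weights differ from one because of the lag kernel and because only
    [n - |r|] products are divided by [n]; against the geometric decay of the
    autocovariances a polynomial growth of these differences is harmless. *)
Lemma bias_norm2 (kappa : nat) (e S : R) : (0 < kappa)%N -> 0 <= e ->
  (forall r, (`|r| <= n)%N -> (k r - 1) ^+ 2 <= e * `|r|%N%:R ^+ (2 * kappa)) ->
  (\sum_(r <- sym_range n) (`|r|%N%:R ^+ (2 * kappa)) * th ^+ `|r| <= S) ->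
  (sqnorm lam2 bias <=
   (2 / (1 - th) * (D * (2 * (e + n%:R^-1 ^+ 2) * S)))%:E)%E.
Proof.
move=> kap0 e0 ke HS.
have D0 : 0 <= D.
  rewrite /zeta_const; apply: divr_ge0; last exact/exprn_ge0/ltW.
  by apply: addr_ge0; apply: mulr_ge0 => //; exact: sqr_ge0.
have H := series_norm2 (q := lam2) th0 (measurable_zeta YZ)
  (fun r => zeta_norm2 th0 th1 B0 YZ r) (sym_range n)
  (fun r => k r * ((n - `|r|)%:R / n%:R) - 1).
apply: le_trans H _.
rewrite lee_fin; apply: ler_pM.
- by apply: sumr_ge0 => r _; exact/exprn_ge0/ltW.
- apply: mulr_ge0 => //; apply: sumr_ge0 => r _.
  by rewrite mulr_ge0 ?sqr_ge0//; exact/exprn_ge0/ltW.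
- exact: sym_geometric_sum_le.
rewrite ler_wpM2l//.
have c0 : 0 <= 2 * (e + n%:R^-1 ^+ 2) by rewrite mulr_ge0// addr_ge0// sqr_ge0.
apply: le_trans (ler_wpM2l c0 HS); rewrite mulr_sumr big_seq [leRHS]big_seq.
apply: ler_sum => r /mapP[j]; rewrite mem_iota add0n ltnS => /andP[_ j2] rE.
have rn : (`|r| <= n)%N by rewrite rE; lia.
rewrite [leRHS]mulrA ler_wpM2r//; first exact/exprn_ge0/ltW.
have := ke r rn; set x : R := `|r|%N%:R; set y := k r - 1 => yx.
have -> : k r * ((n - `|r|)%:R / n%:R) - 1 = y * ((n - `|r|)%:R / n%:R) - x / n%:R.
  by rewrite /y /x natrB//; field; exact: lt0r_neq0.
have z0 : 0 <= (n - `|r|)%:R / n%:R :> R by rewrite divr_ge0.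
have z1 : (n - `|r|)%:R / n%:R <= 1 :> R by rewrite ler_pdivrMr// mul1r ler_nat leq_subr.
set z := _ / _ in z0 z1 *.
have yz : (y * z) ^+ 2 <= y ^+ 2.
  by rewrite exprMn ler_piMr ?sqr_ge0// exprn_ile1.
have xx : x ^+ 2 <= x ^+ (2 * kappa).
  rewrite /x -!natrX ler_nat; case: (`|r|%N) => [|i]; first by rewrite exp0n.
  by rewrite leq_pexp2l// leq_pmulr.
have xn : (x / n%:R) ^+ 2 <= n%:R^-1 ^+ 2 * x ^+ (2 * kappa).
  by rewrite exprMn mulrC ler_wpM2l// sqr_ge0.
apply: (@le_trans _ _ (2 * ((y * z) ^+ 2 + (x / n%:R) ^+ 2))).
  by have := sqr_ge0 (y * z + x / n%:R); rewrite sqrrD sqrrB; lra.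
by rewrite -mulrA ler_pM2l// [leRHS]mulrDl; apply: lerD => //; exact: le_trans yz yx.
Qed.

End estimation_error.

Lemma window_size (R : realType) (A H : nat) : (0 < H)%N ->
  (2 * (A * H) + 1)%:R <= (2 * A + 1)%:R * H%:R :> R.
Proof. by move=> H0; rewrite -natrM ler_nat; lia. Qed.

Section scaled_errors.
Context d (Omega : measurableType d) (R : realType) (P : probability Omega R).
Local Notation T := (measurableTypeR R).
Local Notation lam2 := (leb2 R).
Variables (th B : R) (m0 : nat) (Y : int -> Omega -> L2 R)
  (Z : nat -> int -> Omega * T -> R).
Hypotheses (th0 : 0 < th) (th1 : th < 1) (B0 : 0 <= B).
Hypothesis YZ : approximable_field P th B m0 (field_of Y) Z.

Variables (A n H : nat).

(** The random quantities that enter the error, normalized to have bounded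
    means. *)
Definition scaled_error (w : Omega) : \bar R :=
  ((n%:R / H%:R ^+ 2)%:E * noise P Y n (A * H) w +
   (n%:R / H%:R)%:E * correction Y n (A * H) w)%E.

Definition mean_const : R :=
  (2 * A + 1)%:R * (var_const th B m0 * (1 + A%:R)) +
  (2 * A + 1)%:R * (3 * var_const th B m0).

Hypotheses (n0 : (0 < n)%N) (H0 : (0 < H)%N).

Let nR : 0 < n%:R :> R. Proof. by rewrite ltr0n. Qed.
Let HR : 0 < H%:R :> R. Proof. by rewrite ltr0n. Qed.
Let H1 : 1 <= H%:R :> R. Proof. by rewrite ler1n. Qed.

Let V0 : 0 <= var_const th B m0.
Proof. exact: var_const_ge0. Qed.

Lemma measurable_scaled_error : measurable_fun [set: Omega] (scaled_error).
Proof.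
apply: emeasurable_funD; apply: measurable_funeM.
  exact: (measurable_noise YZ).
exact: (measurable_correction YZ).
Qed.

Lemma scaled_error_ge0 w : (0 <= scaled_error w)%E.
Proof.
apply: adde_ge0; apply: mule_ge0; rewrite ?lee_fin ?divr_ge0 ?sqr_ge0//.
  exact: noise_ge0.
exact: correction_ge0.
Qed.

Lemma scaled_error_mean : (\int[P]_w scaled_error w <= mean_const%:E)%E.
Proof.
have mN := measurable_noise YZ n (A * H); have mC := measurable_correction YZ n (A * H).
have a0 : 0 <= n%:R / H%:R ^+ 2 :> R by rewrite divr_ge0// sqr_ge0.
have b0 : 0 <= n%:R / H%:R :> R by rewrite divr_ge0.
rewrite ge0_integralD//; last 4 first.
- by move=> w _; apply: mule_ge0; [rewrite lee_fin|exact: noise_ge0].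
- exact: measurable_funeM.
- by move=> w _; apply: mule_ge0; [rewrite lee_fin|exact: correction_ge0].
- exact: measurable_funeM.
rewrite ge0_integralZl//; last by move=> w _; exact: noise_ge0.
rewrite ge0_integralZl//; last by move=> w _; exact: correction_ge0.
rewrite /mean_const EFinD; apply: leeD.
  apply: (le_trans (lee_wpmul2l _ (noise_mean th0 th1 B0 YZ (A * H) n0))) => //.
  rewrite -EFinM lee_fin; apply: (@le_trans _ _ (n%:R / H%:R ^+ 2 *
      ((2 * A + 1)%:R * H%:R * (var_const th B m0 * ((1 + A%:R) * H%:R) / n%:R)))).
    apply: ler_wpM2l => //; apply: ler_pM => //.
    - by rewrite divr_ge0// mulr_ge0// addr_ge0.
    - exact: window_size.
    apply: ler_wpM2r; first by rewrite invr_ge0 ltW.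
    by apply: ler_wpM2l => //; rewrite mulrDl mul1r natrM lerD2r.
  rewrite le_eqVlt; apply/orP; left; apply/eqP.
  by field; rewrite !lt0r_neq0.
apply: (le_trans (lee_wpmul2l _ (correction_mean th0 th1 B0 YZ (A * H) n0))) => //.
rewrite -EFinM lee_fin; apply: (@le_trans _ _ (n%:R / H%:R *
    ((2 * A + 1)%:R * H%:R * (3 * var_const th B m0 / n%:R)))).
  apply: ler_wpM2l => //; apply: ler_wpM2r; last exact: window_size.
  by rewrite divr_ge0// mulr_ge0.
rewrite le_eqVlt; apply/orP; left; apply/eqP.
by field; rewrite !lt0r_neq0.
Qed.

End scaled_errors.

Section error_bound.
Context d (Omega : measurableType d) (R : realType) (P : probability Omega R).
Local Notation T := (measurableTypeR R).
Local Notation lam2 := (leb2 R).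
Variables (th B : R) (m0 : nat) (Y : int -> Omega -> L2 R)
  (Z : nat -> int -> Omega * T -> R).
Hypotheses (th0 : 0 < th) (th1 : th < 1) (B0 : 0 <= B).
Hypothesis YZ : approximable_field P th B m0 (field_of Y) Z.

Variables (K : R -> R) (M CK rho S : R) (A kappa : nat).
Hypothesis K_bounded : forall x, `|K x| <= M.
Hypothesis K_support : forall x, A%:R < `|x| -> K x = 0.
Hypothesis K_smooth : forall x, `|K x - 1| <= CK * `|x| `^ rho.
Hypotheses (CK0 : 0 <= CK) (rho0 : 0 < rho) (rho_kappa : rho <= kappa%:R).
Hypothesis S0 : 0 <= S.
Hypothesis S_sum : forall N,
  \sum_(r <- sym_range N) (`|r|%N%:R ^+ (2 * kappa)) * th ^+ `|r| <= S.

Definition error_const (D : R) : R :=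
  4 * ((2 * A + 1)%:R * M ^+ 2 * 4 * D ^+ 2 + (2 * A + 1)%:R * M ^+ 2 * D +
   (2 / (1 - th) * (zeta_const th B m0 * (2 * (CK ^+ 2 + 1) * S)) +
    (2 * series_const th (zeta_const th B m0) + 2) / (1 - th))).

Let weight (H : nat) (r : int) : R := K (r%:~R / H%:R).

Section fixed_sample.
Variables (n H : nat).
Hypotheses (n0 : (0 < n)%N) (H0 : (0 < H)%N).

Let nR : 0 < n%:R :> R. Proof. by rewrite ltr0n. Qed.
Let HR : 0 < H%:R :> R. Proof. by rewrite ltr0n. Qed.
Let n1 : 1 <= n%:R :> R. Proof. by rewrite ler1n. Qed.
Let H1 : 1 <= H%:R :> R. Proof. by rewrite ler1n. Qed.

Let normr_lag (r : int) : `|r%:~R / H%:R| = `|r|%N%:R / H%:R :> R.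
Proof. by rewrite normrM normfV [`|H%:R|]ger0_norm// -intr_norm -abszE. Qed.

Lemma weight_window r : `|weight H r| <= M * (`|r| <= A * H)%N%:R.
Proof.
case: leqP => [_|AHr]; first by rewrite mulr1 K_bounded.
rewrite /weight K_support ?normr0 ?mulr0// normr_lag.
by rewrite ltr_pdivlMr// -natrM ltr_nat.
Qed.

(** Lags are integers, so that the power [rho] may be increased to an integer. *)
Lemma weight_smooth r :
  (weight H r - 1) ^+ 2 <= (CK ^+ 2 * (H%:R `^ rho)^-1 ^+ 2) * `|r|%N%:R ^+ (2 * kappa).
Proof.
have h0 : 0 < H%:R `^ rho :> R by exact: powR_gt0.
have : `|weight H r - 1| <= CK * (H%:R `^ rho)^-1 * `|r|%N%:R ^+ kappa.
  apply: (le_trans (K_smooth _)); rewrite normr_lag -mulrA ler_wpM2l//.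
  rewrite powRM ?invr_ge0// -powR_inv1// -powRrM mulN1r powRN mulrC ler_wpM2l ?invr_ge0 ?powR_ge0//.
  case: (`|r|%N) => [|j]; first by rewrite powR0 ?gt_eqF// exprn_ge0.
  by rewrite -powR_mulrn// ler_powR// ler1n.
move=> h; rewrite -real_normK ?num_real//.
rewrite (_ : _ * _ = (CK * (H%:R `^ rho)^-1 * `|r|%N%:R ^+ kappa) ^+ 2).
  by rewrite lerXn2r ?nnegrE// (le_trans _ h).
by rewrite !exprMn -exprM mulnC.
Qed.

Let D0 : 0 <= zeta_const th B m0.
Proof.
rewrite /zeta_const; apply: divr_ge0; last exact/exprn_ge0/ltW.
by apply: addr_ge0; apply: mulr_ge0 => //; exact: sqr_ge0.
Qed.

Let E0 : 0 <= series_const th (zeta_const th B m0).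
Proof. by apply: divr_ge0; [exact: mulr_ge0|exact: sqr_ge0]. Qed.

Let th1_ge0 : 0 <= (1 - th)^-1. Proof. by rewrite invr_ge0 subr_ge0; exact: ltW. Qed.

Local Notation rate := (H%:R ^+ 3 / n%:R + (H%:R `^ rho)^-1 ^+ 2).

Let inv_n_le : n%:R^-1 <= H%:R ^+ 3 / n%:R :> R.
Proof. by rewrite ler_peMl ?invr_ge0// exprn_ege1. Qed.

Let bias_bound : (sqnorm lam2 (bias P Y n (weight H)) <=
  (2 / (1 - th) * (zeta_const th B m0 * (2 * (CK ^+ 2 + 1) * S)) * rate)%:E)%E.
Proof.
have kappa0 : (0 < kappa)%N by rewrite -(ltr_nat R); exact: lt_le_trans rho_kappa.
have q0 : 0 <= (H%:R `^ rho)^-1 ^+ 2 :> R by exact: sqr_ge0.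
have e0 : 0 <= CK ^+ 2 * (H%:R `^ rho)^-1 ^+ 2 by rewrite mulr_ge0// sqr_ge0.
apply: (le_trans (bias_norm2 th0 th1 B0 YZ n0 kappa0 e0 (fun r _ => weight_smooth r)
  (S_sum n))).
have n2 : n%:R^-1 ^+ 2 <= H%:R ^+ 3 / n%:R :> R.
  apply: le_trans inv_n_le; rewrite expr2 ler_piMr ?invr_ge0//.
  by rewrite invf_le1.
have c2 : 0 <= CK ^+ 2 by exact: sqr_ge0.
have h3 : 0 <= H%:R ^+ 3 / n%:R :> R by rewrite divr_ge0.
have key : CK ^+ 2 * (H%:R `^ rho)^-1 ^+ 2 + n%:R^-1 ^+ 2 <= (CK ^+ 2 + 1) * rate.
  by have := mulr_ge0 c2 h3; rewrite mulrDl mul1r mulrDr; lra.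
rewrite lee_fin (_ : _ * _ * rate = 2 / (1 - th) *
  (zeta_const th B m0 * (2 * ((CK ^+ 2 + 1) * rate) * S))); last by ring.
apply: ler_wpM2l; first exact: mulr_ge0.
by apply: ler_wpM2l => //; apply: ler_wpM2r => //; apply: ler_wpM2l.
Qed.

Let tail_bound : (sqnorm lam2 (long_run_partial P Y n \- long_run_cov P Y)%R <=
  ((2 * series_const th (zeta_const th B m0) + 2) / (1 - th) * rate)%:E)%E.
Proof.
apply: (le_trans (long_run_cov_approx th0 th1 B0 YZ n)); rewrite lee_fin -mulrA.
have q0 : 0 <= (H%:R `^ rho)^-1 ^+ 2 :> R by exact: sqr_ge0.
apply: ler_wpM2l; first by rewrite addr_ge0// mulr_ge0.
apply: (@le_trans _ _ ((1 - th)^-1 / n%:R)).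
  by rewrite ler_pdivlMr// mulrC; exact: mul_geometric_le.
by apply: ler_wpM2l => //; apply: (le_trans inv_n_le); rewrite lerDl.
Qed.

(** The correction is of order [H / n] and enters quadratically, the noise is of
    order [H ^ 2 / n]; both carry a further factor [H], the size of the window. *)
Lemma estimator_error_bound (D : R) (w : Omega) : 0 <= D ->
  (scaled_error P Y A n H w <= D%:E)%E ->
  (sqnorm lam2 (weighted_estimator Y n (weight H) w \- long_run_cov P Y)%R <=
   (error_const D * rate)%:E)%E.
Proof.
move=> Dge0 wD.
have q0 : 0 <= (H%:R `^ rho)^-1 ^+ 2 :> R by exact: sqr_ge0.
have h3 : 0 <= H%:R ^+ 3 / n%:R :> R by rewrite divr_ge0.
have W0 : 0 <= (2 * A + 1)%:R * M ^+ 2 by rewrite mulr_ge0// sqr_ge0.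
have WH : (2 * (A * H) + 1)%:R * M ^+ 2 <= (2 * A + 1)%:R * M ^+ 2 * H%:R.
  by rewrite mulrAC; apply: ler_wpM2r; [exact: sqr_ge0|exact: window_size].
have nH2 : 0 < n%:R / H%:R ^+ 2 :> R by rewrite divr_gt0// exprn_gt0.
have nH : 0 < n%:R / H%:R :> R by rewrite divr_gt0.
have N0 := noise_ge0 P Y n (A * H) w.
have C0 := correction_ge0 Y n (A * H) w.
have hN : (noise P Y n (A * H) w <= (D * (H%:R ^+ 2 / n%:R))%:E)%E.
  rewrite (_ : D * _ = (n%:R / H%:R ^+ 2)^-1 * D); last by rewrite invf_div mulrC.
  rewrite EFinM lee_pdivlMl//; apply: le_trans wD; rewrite leeDl//.
  by apply: mule_ge0 => //; rewrite lee_fin ltW.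
have hC : (correction Y n (A * H) w <= (D * (H%:R / n%:R))%:E)%E.
  rewrite (_ : D * _ = (n%:R / H%:R)^-1 * D); last by rewrite invf_div mulrC.
  rewrite EFinM lee_pdivlMl//; apply: le_trans wD; rewrite leeDr//.
  by apply: mule_ge0 => //; rewrite lee_fin ltW.
apply: (le_trans (estimator_error YZ n0 weight_window w)).
rewrite /error_const -[4 * _ * _]mulrA [leRHS]EFinM; apply: lee_wpmul2l; first by rewrite lee_fin.
rewrite [in leRHS]mulrDl [X in (_ <= (X + _)%:E)%E]mulrDl [X in (_ <= (_ + X)%:E)%E]mulrDl [leRHS]EFinD [X in (_ <= X + _)%E]EFinD [X in (_ <= _ + X)%E]EFinD.
apply: leeD; last by apply: leeD; [exact: bias_bound|exact: tail_bound].
have hr : H%:R ^+ 3 / n%:R <= rate by rewrite lerDl.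
apply: leeD.
  apply: (@le_trans _ _ ((((2 * (A * H) + 1)%:R * M ^+ 2 * 4)%:E *
     ((D * (H%:R / n%:R))%:E * (D * (H%:R / n%:R))%:E))%E)).
    apply: lee_wpmul2l; first by rewrite lee_fin mulr_ge0// mulr_ge0// sqr_ge0.
    exact: lee_pmul.
  rewrite lee_fin.
  apply: (@le_trans _ _ ((2 * A + 1)%:R * M ^+ 2 * H%:R * 4 *
      (D * (H%:R / n%:R) * (D * (H%:R / n%:R))))).
    by apply: ler_wpM2r; [rewrite -expr2 sqr_ge0|rewrite ler_pM2r].
  rewrite (_ : _ * (_ * _) = (2 * A + 1)%:R * M ^+ 2 * 4 * D ^+ 2 *
    (H%:R ^+ 3 / n%:R / n%:R)); last by field; exact: lt0r_neq0.
  apply: ler_wpM2l; first by rewrite mulr_ge0 ?sqr_ge0// mulr_ge0.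
  apply: le_trans hr; rewrite ler_piMr//; first by rewrite invf_le1.
apply: (@le_trans _ _ (((2 * (A * H) + 1)%:R * M ^+ 2)%:E *
    (D * (H%:R ^+ 2 / n%:R))%:E)%E).
  by apply: lee_wpmul2l => //; rewrite lee_fin mulr_ge0// sqr_ge0.
rewrite lee_fin.
apply: (@le_trans _ _ ((2 * A + 1)%:R * M ^+ 2 * H%:R * (D * (H%:R ^+ 2 / n%:R)))).
  by apply: ler_wpM2r => //; rewrite mulr_ge0// divr_ge0// sqr_ge0.
rewrite (_ : _ * (_ * _) = (2 * A + 1)%:R * M ^+ 2 * D * (H%:R ^+ 3 / n%:R)); last first.
  by field; exact: lt0r_neq0.
by apply: ler_wpM2l => //; exact: mulr_ge0.
Qed.

End fixed_sample.

End error_bound.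

(** * Lag kernels, bandwidths and observations *)

Section lag_kernels.
Context (R : realType) (K : R -> R).
Hypothesis K_lag : lag_kernel K.

Lemma lag_kernel_support : exists A : nat, forall x, A%:R < `|x| -> K x = 0.
Proof.
have [_ _ Kc _] := K_lag.
have [M [_ HM]] := @compact_bounded R R^o _ Kc.
exists (Num.truncn (`|M| + 1)).+1 => x Ax; apply/eqP/negPn/negP => Kx.
have : `|x| <= `|M| + 1.
  apply: HM; first by rewrite (le_lt_trans (ler_norm _))// ltrDl.
  exact: subset_closure.
by apply/negP; rewrite -ltNge; apply: lt_trans Ax; exact: Num.Theory.truncnS_gt.
Qed.

(** Away from the origin [|x| ^ rho] is bounded below, and the kernel is bounded. *)
Lemma lag_kernel_smooth (rho : R) : 0 < rho ->
  (fun x : R => `|K x - 1|) =O_ (0 : R) (fun x : R => `|x| `^ rho) ->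
  exists2 C, 0 <= C & forall x, `|K x - 1| <= C * `|x| `^ rho.
Proof.
move=> rho0 /eqO_exP[C /= C0 /nbhs_ballP[e /= e0 He]].
have [_ [M KM] _ _] := K_lag.
have M0 : 0 <= M by apply: le_trans (KM 0).
have er : 0 < e `^ rho by exact: powR_gt0.
exists (C + (M + 1) / e `^ rho) => [|x].
  by apply: addr_ge0; [exact: ltW|rewrite divr_ge0 ?addr_ge0// ltW].
have [xe|ex] := ltP `|x| e.
  apply: (@le_trans _ _ (C * `|x| `^ rho)).
    have := He x; rewrite /ball /= sub0r normrN => /(_ xe).
    by rewrite normr_id [`|_ `^ _|]ger0_norm ?powR_ge0.
  by rewrite ler_wpM2r ?powR_ge0// lerDl divr_ge0 ?addr_ge0// ltW.
apply: (@le_trans _ _ (M + 1)).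
  by rewrite (le_trans (ler_normB _ _))// normr1 lerD2r.
apply: (@le_trans _ _ ((M + 1) / e `^ rho * `|x| `^ rho)).
  rewrite -mulrA ler_peMr ?addr_ge0// mulrC ler_pdivlMr// mul1r.
  by apply: ge0_ler_powR; rewrite ?nnegrE//; exact: ltW.
by rewrite ler_wpM2r ?powR_ge0// lerDr ltW.
Qed.

End lag_kernels.

Lemma bandwidth_nat (R : realType) (c' gamma : R) : 0 < c' -> 0 < gamma ->
  \forall n \near \oo, exists2 H, (0 < H)%N & bandwidth c' gamma n = H%:R.
Proof.
move=> c0 g0; exists (Num.truncn (c'^-1 `^ gamma)).+1 => // n /= Nn.
have x0 : 0 < c'^-1 by rewrite invr_gt0.
have : 1 <= c' * n%:R `^ gamma^-1.
  rewrite mulrC -ler_pdivrMr// mul1r.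
  have e : c'^-1 = (c'^-1 `^ gamma) `^ gamma^-1.
    by rewrite -powRrM divff ?lt0r_neq0// powRr1// ltW.
  rewrite [leLHS]e.
  apply: ge0_ler_powR; rewrite ?nnegrE ?invr_ge0 ?powR_ge0 ?ler0n ?(ltW g0)//.
  by apply: ltW; apply: (lt_le_trans (Num.Theory.truncnS_gt _)); rewrite ler_nat.
rewrite /bandwidth -[1]/(1%:~R) -floor_ge_int.
case: (Num.floor _) => [[|H]|H]// _.
by exists H.+1.
Qed.

Lemma measurable_long_run_estimator d (Omega : measurableType d) (R : realType)
    (X : nat -> Omega -> R -> R) (K : R -> R) (h : R) n w :
  (forall i, measurable_fun [set: measurableTypeR R] (X i w)) ->
  measurable_fun [set: measurableTypeR R * measurableTypeR R]
    (long_run_estimator X K h n w).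
Proof.
move=> mX; have mm : measurable_fun [set: measurableTypeR R] (sample_mean X n w).
  by apply: measurable_funM => //; exact: measurable_sum.
have mc i : measurable_fun [set: measurableTypeR R]
    (fun t => X i w t - sample_mean X n w t) by exact: measurable_funB.
apply: measurable_sum => r; apply: measurable_funM => //.
under eq_fun do rewrite sample_autocovE.
apply: measurable_funM => //; apply: measurable_sum => i.
by apply: measurable_funM;
  [exact: (measurableT_comp (mc _))|exact: (measurableT_comp (mc _))].
Qed.

Section observations.
Context d (Omega : measurableType d) (R : realType).
Variables (mu : nat -> L2 R) (Y : int -> Omega -> L2 R) (n : nat).
Hypotheses (n0 : (0 < n)%N) (H0 : null_hypothesis mu n).

Local Notation Yv := (fun (i : nat) w t => field_of Y i (w, t)).

Lemma null_hypothesis_ae : {ae leb01 R, forall t, forall i j,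
  (1 <= i <= n)%N -> (1 <= j <= n)%N -> mu i t = mu j t}.
Proof.
apply: ae_foralln => i; apply: ae_foralln => j.
have [i_in|] := boolP (1 <= i <= n)%N; last by move=> ?; apply: (aeW (leb01 R)).
have [j_in|] := boolP (1 <= j <= n)%N; last by move=> ?; apply: (aeW (leb01 R)).
by apply: (ae_impl (mu := leb01 R) _ (H0 i_in j_in)) => t Ht _ _; exact: Ht.
Qed.

Lemma observation_centered t w i :
  (forall i j, (1 <= i <= n)%N -> (1 <= j <= n)%N -> mu i t = mu j t) ->
  (1 <= i <= n)%N ->
  observation mu Y i w t - sample_mean (observation mu Y) n w t =
  Yv i w t - sample_mean Yv n w t.
Proof.
move=> mut i_in; rewrite /sample_mean /observation big_split /= mulrDr.
rewrite (eq_big_nat _ _ (F2 := fun=> mu i t)); last first.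
  by move=> j j_in; apply: mut => //; rewrite -ltnS.
rewrite sumr_const_nat subSS subn0 -[mu i t *+ n]mulr_natl mulrA mulVf ?pnatr_eq0 -?lt0n// mul1r.
by rewrite opprD addrACA subrr add0r.
Qed.

Lemma observation_estimator (K : R -> R) (h : R) w :
  {ae leb2 R, forall p,
    long_run_estimator (observation mu Y) K h n w p =
    weighted_estimator Y n (fun r => K (r%:~R / h)) w p}.
Proof.
have H1 := ae_prod_fst (leb01 R) (m1 := leb01 R) null_hypothesis_ae.
have H2 := ae_prod_snd (leb01 R) (m2 := leb01 R) null_hypothesis_ae.
apply: (ae_impl (mu := leb2 R) _ (ae_and (mu := leb2 R) H1 H2)) => -[t s] [/= mut mus].
apply: eq_bigr => r _; congr (_ * _); rewrite !sample_autocovE; congr (_ * _).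
have ll : (lag_left r <= `|r|)%N /\ (lag_right r <= `|r|)%N by case: r.
by apply: eq_bigr => -[i /= ir] _; rewrite !observation_centered//; lia.
Qed.

End observations.

(** * The rate of convergence *)

Lemma knorm2_gt (R : realType) (k : measurableTypeR R * measurableTypeR R -> R) (x : R) :
  0 <= x -> (x%:E < `|knorm2 k|)%E = ((x ^+ 2)%:E < sqnorm (leb2 R) k)%E.
Proof.
move=> x0; rewrite -knorm2_sqr gee0_abs ?knorm2_ge0//.
have := knorm2_ge0 k; case: (knorm2 k) => [y| |]// y0.
- by rewrite -EFinM !lte_fin -expr2 ltr_sqr.
- by rewrite mulyy !ltry.
Qed.

Lemma rate_sqr_ge (R : realType) (n H : nat) (rho : R) :
  H%:R ^+ 3 / n%:R + (H%:R `^ rho)^-1 ^+ 2 <=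
  (Num.sqrt (H%:R / n%:R) * H%:R + (H%:R `^ rho)^-1) ^+ 2.
Proof.
have a0 : 0 <= H%:R / n%:R :> R by rewrite divr_ge0.
rewrite [leRHS]sqrrD exprMn sqr_sqrtr// (_ : H%:R ^+ 3 / n%:R = H%:R / n%:R * H%:R ^+ 2);
  last by ring.
by rewrite lerD2r lerDl mulrn_wge0// !mulr_ge0 ?sqrtr_ge0 ?invr_ge0 ?powR_ge0.
Qed.

Theorem theorem4p1 (R : realType) (d : measure_display)
    (Omega : measurableType d) (P : probability Omega R)
    (Y : int -> Omega -> L2 R) (mu : nat -> L2 R)
    (K : R -> R) (c c' gamma rho : R)
    (c_gt0 : 0 < c)
    (Y_centered : centered P Y)
    (Y_approx : Lm_approximable P 4 (fun m => expR (- c * m%:R)) Y)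
    (K_lag : lag_kernel K)
    (rho_ge1 : 1 <= rho)
    (K_rho : (fun x : R => `|K x - 1|) =O_ (0 : R) (fun x : R => `|x| `^ rho))
    (gamma_gt3 : 3 < gamma) (c'_gt0 : 0 < c')
    (H0 : forall n, null_hypothesis mu n) :
  let h := bandwidth c' gamma in
  bigO_in_probability P
    (fun n w => knorm2 (long_run_estimator (observation mu Y) K (h n) n w
                        \- long_run_cov P Y))
    (fun n => Num.sqrt (h n / n%:R) * h n + (h n `^ rho)^-1).
Proof.
move=> h e e0.
have [B [m0 [Z [B0 YZ]]]] := approximable_fieldP c_gt0 Y_centered Y_approx.
set th := expR (- c) in YZ.
have th0 : 0 < th by exact: expR_gt0.
have th1 : th < 1 by rewrite expR_lt1 oppr_lt0.
have rho0 : 0 < rho by exact: lt_le_trans rho_ge1.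
have [_ [M KM] _ _] := K_lag.
have [A KA] := lag_kernel_support K_lag.
have [CK CK0 KC] := lag_kernel_smooth K_lag rho0 K_rho.
pose kappa := (Num.truncn rho).+1.
have rho_kappa : rho <= kappa%:R by rewrite ltW// Num.Theory.truncnS_gt.
have [S S0 HS] := sym_polynomial_geometric_sum_le (2 * kappa) th0 th1.
set mc := mean_const th B m0 A.
have mc0 : 0 <= mc.
  have V0 := var_const_ge0 m0 th0 th1 B0.
  by apply: addr_ge0; apply: mulr_ge0 => //; apply: mulr_ge0 => //; exact: addr_ge0.
(* the constant for which Markov's inequality gives a probability below [e] *)
pose D := (mc + 1) / e.
have D0 : 0 < D by rewrite divr_gt0// ltr_wpDl.
pose Ce := error_const th B m0 M CK S A D.
exists (Num.sqrt `|Ce|).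
have [N _ HN] := bandwidth_nat c'_gt0 (lt_trans (ltr0n R 3) gamma_gt3).
exists N.+1 => // n /= Nn.
have n0 : (0 < n)%N by exact: leq_ltn_trans Nn.
have [H Hgt0 hH] := HN n (ltnW Nn).
rewrite /h hH.
set a := _ + _.
have a0 : 0 <= a by rewrite addr_ge0 ?mulr_ge0 ?sqrtr_ge0// invr_ge0 powR_ge0.
pose k (r : int) := K (r%:~R / H%:R).
pose est := weighted_estimator Y n k.
have mest : measurable_fun [set: Omega * (measurableTypeR R * measurableTypeR R)]
    (fun z => est z.1 z.2 - long_run_cov P Y z.2).
  apply: measurable_funB; first exact: (measurable_weighted_estimator YZ).
  by apply: measurableT_comp => //; exact: measurable_funPT.
(* The unknown means cancel at almost every argument; squaring turns the event
   into one that concerns a jointly measurable field. *)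
have -> : [set w | ((Num.sqrt `|Ce| * a)%:E <
    `|knorm2 (long_run_estimator (observation mu Y) K H%:R n w
        \- long_run_cov P Y)%R|)%E] =
    [set w | ((`|Ce| * a ^+ 2)%:E <
       sqnorm (leb2 R) (est w \- long_run_cov P Y)%R)%E].
  apply/funext => w; apply/propext => /=.
  rewrite knorm2_gt ?mulr_ge0 ?sqrtr_ge0// exprMn sqr_sqrtr ?normr_ge0//.
  rewrite (ae_eq_sqnorm (q := leb2 R) (v := est w \- long_run_cov P Y))//.
  - apply: measurable_funB; last exact: measurable_funPT.
    apply: measurable_long_run_estimator => i.
    by apply: measurable_funD; exact: measurable_funPT.
  - exact: (measurable_field1 w mest).
  have := observation_estimator Y n0 (H0 n) K H%:R w.
  by apply: (ae_impl (mu := leb2 R)) => p /= ->.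
set bad := [set w | _].
have mbad : measurable bad.
  rewrite /bad -[X in measurable X]setTI.
  apply: emeasurable_fun_o_infty => //.
  exact: (measurable_sqnorm (leb2 R) mest).
pose Rv := scaled_error P Y A n H.
have mRv : measurable_fun [set: Omega] Rv by exact: (measurable_scaled_error YZ).
have Rv0 w : (0 <= Rv w)%E by exact: scaled_error_ge0.
have sub : bad `<=` [set: Omega] `&` [set w | (D%:E <= `|Rv w|)%E].
  move=> w bw; split => //=; rewrite gee0_abs// leNgt; apply/negP => RD.
  move: bw; rewrite /bad /=; apply/negP; rewrite -leNgt.
  have := estimator_error_bound th0 th1 B0 YZ KM KA KC CK0 rho0 rho_kappa S0 HS n0 Hgt0
    (ltW D0) (ltW RD).
  move=> /le_trans; apply; rewrite lee_fin.
  apply: (@le_trans _ _ (`|Ce| * (H%:R ^+ 3 / n%:R + (H%:R `^ rho)^-1 ^+ 2))).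
    apply: ler_wpM2r; last exact: ler_norm.
    by rewrite addr_ge0 ?divr_ge0 ?sqr_ge0// exprn_ge0.
  by apply: ler_wpM2l => //; exact: rate_sqr_ge.
have mk := le_integral_abse P measurableT mRv D0.
have meanRv : (\int[P]_w `|Rv w| <= mc%:E)%E.
  under eq_integral do rewrite gee0_abs//.
  exact: (scaled_error_mean th0 th1 B0 YZ A n0 Hgt0).
apply: (@le_trans _ _ (P ([set: Omega] `&` [set w | (D%:E <= `|Rv w|)%E]))).
  apply: le_measure => //; rewrite inE//.
  by apply: emeasurable_fun_c_infty => //; exact: measurableT_comp.
have := le_trans mk meanRv; rewrite -lee_pdivlMl// => /le_trans; apply.
have mc1 : 0 < mc + 1 by rewrite ltr_wpDl.
rewrite -EFinM lee_fin /D invf_div -mulrA ler_piMr ?(ltW e0)// mulrC.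
by rewrite ler_pdivrMr// mul1r lerDl.
Qed.
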